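(* Let $s\in(0,1)$, let $\Omega\subset\mathbb{R}^n$ be an open, bounded set and let $E$ be a free boundary $s$-minimal surface in $\Omega$ with $\partial E$ unbounded. Then $$\mathscr{H}^n(E\cap\Omega)=\mathscr{H}^n(E^c\cap\Omega).$$
   Context: $A^c=\mathbb{R}^n\setminus A$ and $\mathscr{H}^n$ is $n$-dimensional Hausdorff (Lebesgue) measure. For $s\in(0,1)$, an open set $\Omega\subset\mathbb{R}^n$ and a measurable set $E\subset\mathbb{R}^n$, the $s$-fractional perimeter is $$\operatorname{Per}_s(E;\Omega)=c_{n,s}\left(\int_{E^c\cap\Omega}\int_{E\cap\Omega}+\int_{E\cap\Omega}\int_{E^c\cap\Omega^c}+\int_{E\cap\Omega^c}\int_{E^c\cap\Omega}\right)\frac{dx\,dy}{|x-y|^{n+s}},$$ with $c_{n,s}=\frac{2^{2+2s}\Gamma\left(\frac{n+s}2\right)}{\pi^{n/2}\Gamma(2-s)}s(1-s)$. Let $\Omega$ have $C^1$ boundary. $\partial E$ (or, with abuse of notation, $E$) is a free boundary $s$-minimal (hyper)surface (also called nonlocal free boundary minimal hypersurface) in $\Omega$ if for every $\mathcal{X}\in C^\infty_c(\mathbb{R}^n,\mathbb{R}^n)$ with $\mathcal{X}(x)\in T_x(\partial\Omega)$ for all $x\in\partial\Omega$ one has $\frac{d}{dt}\big|_{t=0}\operatorname{Per}_s(\Phi_t(E);\Omega)=0$, where $\Phi_t$ is the flow of $\mathcal{X}$ ($\partial_t\Phi_t=\mathcal{X}\circ\Phi_t$, $\Phi_0=\ma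thrm{id}$).
   Formalization: ∂E is taken as the measure-theoretic boundary (points whose every neighborhood meets E and E^c in positive measure); with the topological boundary of an arbitrary measurable E the claim fails, e.g. E = Z^n, a null set with unbounded boundary. *)

(* Defs.v *)
From HB Require Import structures.
From mathcomp Require Import all_boot all_order all_algebra.
From mathcomp Require Import all_classical all_reals all_analysis.
Set Implicit Arguments.
Unset Strict Implicit.
Unset Printing Implicit Defensive.
Import Order.TTheory GRing.Theory Num.Theory.
Import numFieldNormedType.Exports.
Local Open Scope classical_set_scope.
Local Open Scope ring_scope.

(* R^n is 'rV[R]_n.  Its library norm is the sup norm: this is harmless for
   topology, differentiation and boundedness, but the Euclidean norm has to be
   used in the kernel of the fractional perimeter. *)
Definition euclid {R : realType} {n : nat} (x : 'rV[R]_n) : R :=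
  Num.sqrt (\sum_(i < n) x 0 i ^+ 2).

Definition borelRn (R : realType) (n : nat) :=
  g_sigma_algebraType (@open 'rV[R]_n).

(* n-dimensional volume of Borel sets by iterated integration (Cavalieri):
   vol_(n+1) A is the integral over x in R of vol_n of the slice of A whose
   first coordinate is x. *)
Fixpoint volume (R : realType) (n : nat) : set 'rV[R]_n -> \bar R :=
  match n with
  | 0 => fun A => (\1_A (0 : 'rV[R]_0))%:E
  | m.+1 => fun A => (\int[@lebesgue_measure R]_x
      volume [set v : 'rV[R]_m | A (row_mx (x%:M : 'rV[R]_1) v)])%E
  end.

(* Lebesgue outer measure, defined on all subsets of R^n: infimum of the total
   volume of the countable covers by Borel sets. *)
Definition lebesgue {R : realType} {n : nat} : set 'rV[R]_n -> \bar R :=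
  mu_ext (@volume R n : set (borelRn R n) -> \bar R).

Section lebesgue_outer_measure.
Variables (R : realType) (n : nat).
Local Open Scope ereal_scope.

Lemma volume0 : @volume R n set0 = 0.
Proof.
elim: n => [|m IH] /=; first by rewrite indicE in_set0.
rewrite integral0_eq// => x _; rewrite -[RHS]IH; congr volume.
Qed.

Lemma volume_ge0 (A : set 'rV[R]_n) : 0 <= volume A.
Proof.
elim: n A => [A|m IH A] /=; last exact: integral_ge0.
by rewrite lee_fin.
Qed.

HB.instance Definition _ := isOuterMeasure.Build R 'rV[R]_n (@lebesgue R n)
  (@mu_ext0 _ (borelRn R n) R _ volume0 volume_ge0)
  (@mu_ext_ge0 _ (borelRn R n) R _ volume_ge0)
  (@le_mu_ext _ (borelRn R n) R _)
  (@mu_ext_sigma_subadditive _ (borelRn R n) R _ volume_ge0).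

End lebesgue_outer_measure.

(* R^n with the (complete) sigma-algebra of Lebesgue measurable sets. *)
Notation lebesgueRn R n := (caratheodory_type (@lebesgue R n)).

Definition Leb {R : realType} {n : nat} : set (lebesgueRn R n) -> \bar R :=
  @lebesgue R n.

HB.instance Definition _ (R : realType) (n : nat) :=
  isMeasure.Build _ (lebesgueRn R n) R (@Leb R n)
    (@caratheodory_measure0 R _ (@lebesgue R n))
    (@caratheodory_measure_ge0 R _ (@lebesgue R n))
    (@caratheodory_measure_sigma_additive R _ (@lebesgue R n)).

Definition lebesgue_measurable {R : realType} {n : nat} (E : set 'rV[R]_n) :=
  measurable (E : set (lebesgueRn R n)).

Definition Gamma {R : realType} (z : R) : R :=
  \int[@lebesgue_measure R]_(t in `]0, +oo[) (t `^ (z - 1) * expR (- t)).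

Definition cns {R : realType} (n : nat) (s : R) : R :=
  2 `^ (2 + 2 * s) * Gamma ((n%:R + s) / 2)
  / (pi `^ (n%:R / 2) * Gamma (2 - s)) * s * (1 - s).

Definition interaction {R : realType} {n : nat} (s : R) (A B : set 'rV[R]_n) :
    \bar R :=
  (\int[@Leb R n]_(x in A) \int[@Leb R n]_(y in B)
     (euclid (x - y : 'rV[R]_n) `^ (- (n%:R + s)))%:E)%E.

Definition Per {R : realType} {n : nat} (s : R) (E Omega : set 'rV[R]_n) :
    \bar R :=
  ((cns n s)%:E * (interaction s (~` E `&` Omega) (E `&` Omega)
                   + interaction s (E `&` Omega) (~` E `&` ~` Omega)
                   + interaction s (E `&` ~` Omega) (~` E `&` Omega)))%E.

Fixpoint Ck {R : realType} {n : nat} {W : normedModType R} (k : nat)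
    (f : 'rV[R]_n -> W) : Prop :=
  match k with
  | 0 => continuous f
  | j.+1 => (forall x, differentiable f x) /\
            (forall i : 'I_n, Ck j (fun x => 'D_(delta_mx 0 i) f x))
  end.

Definition smooth {R : realType} {n : nat} {W : normedModType R}
    (f : 'rV[R]_n -> W) : Prop := forall k, Ck k f.

Definition compactly_supported {R : realType} {n : nat} {W : normedModType R}
    (f : 'rV[R]_n -> W) : Prop := compact (closure [set x | f x != 0]).

Definition boundary {T : topologicalType} (A : set T) : set T :=
  closure A `\` interior A.

(* Near each boundary point, Omega is, up to the choice of a coordinate i and
   of an orientation b of it, the strict epigraph of a C^1 function of the
   remaining n - 1 coordinates (collected in col' i y). *)
Definition C1_boundary {R : realType} {n : nat} (Omega : set 'rV[R]_n) : Prop :=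
  forall x, boundary Omega x ->
  exists (i : 'I_n) (b : bool) (g : 'rV[R]_n.-1 -> R),
    Ck 1 g /\
    \forall y \near x, Omega y <-> g (col' i y) < (-1) ^+ b * y 0 i.

(* Velocities at x of C^1 curves contained in S. *)
Definition tangent {R : realType} {n : nat} (S : set 'rV[R]_n) (x : 'rV[R]_n) :
    set 'rV[R]_n :=
  [set v | exists c c' : R -> 'rV[R]_n,
     [/\ c 0 = x,
         \forall t \near (0 : R), S (c t) /\ is_derive t (1 : R) c (c' t),
         \forall t \near (0 : R), {for t, continuous c'} &
         c' 0 = v]].

Definition is_flow {R : realType} {n : nat} (X : 'rV[R]_n -> 'rV[R]_n)
    (Phi : R -> 'rV[R]_n -> 'rV[R]_n) : Prop :=
  (forall x, Phi 0 x = x) /\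
  (forall t x, is_derive t (1 : R) (Phi ^~ x) (X (Phi t x))).

(* The perimeter takes values in \bar R; that the derivative at 0 exists
   includes that the perimeter is finite near 0. *)
Definition free_boundary_minimal {R : realType} {n : nat} (s : R)
    (Omega E : set 'rV[R]_n) : Prop :=
  forall X : 'rV[R]_n -> 'rV[R]_n,
    smooth X -> compactly_supported X ->
    (forall x, boundary Omega x -> tangent (boundary Omega) x (X x)) ->
    forall Phi, is_flow X Phi ->
    (\forall t \near (0 : R), Per s (Phi t @` E) Omega \is a fin_num) /\
    is_derive (0 : R) (1 : R) (fun t => fine (Per s (Phi t @` E) Omega)) 0.

(* The boundary of E in the measure-theoretic sense.  E matters only up to
   null sets, and under the usual normalization of E within its class this is
   the topological boundary.  For an arbitrary representative the topological
   boundary is meaningless: adding to E = set0 the points of a lattice changes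
   no perimeter but makes the topological boundary unbounded. *)
Definition mboundary {R : realType} {n : nat} (E : set 'rV[R]_n) :
    set 'rV[R]_n :=
  [set x | forall U, nbhs x U ->
     (0 < lebesgue (E `&` U))%E /\ (0 < lebesgue (~` E `&` U))%E].

(* Main.v *)
(* Far from Omega, deform E by the flow Phi_t of X = rho e_i, where rho is a
   product bump on a small cube Q of side 2e centred at z.  Only the interaction
   of Q with Omega changes:
     Per_s(Phi_t E) = c (C + int_(Q cap Phi_t E) V_(E^c cap Omega)
                           + int_(Q minus Phi_t E) V_(E cap Omega)),
   where V_A(x) is the integral over A of |x - y|^-(n+s) dy, which is Lipschitz
   away from Omega.  Put w = V_(E^c cap Omega) - V_(E cap Omega).  Criticality
   gives |w(z)| |int_(Q cap E) d_i rho| <= K |Q| with K independent of e and z.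
   If w(x0) <> 0, the averages of 1_E at scale e are therefore Lipschitz near x0
   uniformly in e, and E or its complement has density at most 3/4 at all points
   near x0, hence is null there; so x0 is not a boundary point.  Thus w vanishes
   on the part of the boundary of E far from Omega, and letting x go to infinity
   along it in |x|^(n+s) w(x) = 0 gives vol(E^c cap Omega) = vol(E cap Omega). *)
Require Import Defs.
From HB Require Import structures.
From mathcomp Require Import all_boot all_order all_algebra.
From mathcomp Require Import all_classical all_reals all_analysis.
From mathcomp Require Import measurable_realfun.
From mathcomp Require Import ring lra.
Set Implicit Arguments.
Unset Strict Implicit.
Unset Printing Implicit Defensive.
Import Order.TTheory GRing.Theory Num.Theory.
Import numFieldNormedType.Exports.
Local Open Scope classical_set_scope.
Local Open Scope ring_scope.

(** Criticality is tested on flows, so a flow has to be exhibited together with its Jacobian. The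
    bump is chosen for this: the reciprocal of [bumpR] has an elementary primitive [chart], in which
    the one-dimensional flow is a translation, and the product bump moves every line parallel to e_i
    by such a flow. The change of variables is then Fubini plus translation invariance. The
    potentials enter through Lipschitz bounds only. Freezing them at z costs O(|Q|), whereas the
    integral of d_i rho over Q cap E is a priori of order |Q|/e. This is why criticality is used as
    an inequality; the power of e that it gains is what bounds the gradient of the averages
    uniformly in e, that gradient being minus the integral. The averages at x0 need not converge:
    either they are at most 1/2 for arbitrarily small e, or at least 1/2 for all small e, and an
    oscillation of 1/4 on a fixed ball leads to 3/4 in both cases. Integrating them over open sets
    and outer regularity then give a null set. *)

(** * Borel sets of R^n through coordinates *)

Section borel_coordinates.
Context {R : realType}.

Lemma ball_rVP n (x y : 'rV[R]_n) (e : R) : 0 < e ->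
  ball x e y <-> forall j, `|x 0 j - y 0 j| < e.
Proof.
rewrite /ball /= /mx_ball => e0; split=> [[_ h] j|h]; first exact: h.
by split=> // i j; rewrite (ord1 i); exact: h.
Qed.

(** Balls of the sup norm are products of intervals, so a countable union of them reduces Borel
    measurability of maps into R^n to their coordinates. *)
Lemma open_rat_ballE n (U : set 'rV[R]_n) : open U ->
  U = \bigcup_(p in [set p : 'rV[rat]_n * nat |
         ball (map_mx ratr p.1 : 'rV[R]_n) p.2.+1%:R^-1 `<=` U])
       ball (map_mx ratr p.1 : 'rV[R]_n) p.2.+1%:R^-1.
Proof.
move=> oU; apply/seteqP; split=> [x Ux|x [p pU xp]]; last exact: pU.
have [e e0 exU] : exists2 e : R, 0 < e & ball x e `<=` U.
  by have /nbhs_ballP[e /= e0 exU] : nbhs x U by [exact: open_nbhs_nbhs|]; exists e.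
(* Half of [e], because the rational centre is within 1/(N+1) of [x] and the ball around it has the
   same radius. *)
have [N Ne] : exists N : nat, N.+1%:R^-1 < e / 2.
  exists (Num.truncn (e / 2)^-1).
  rewrite invf_plt ?posrE ?divr_gt0//; exact: truncnS_gt.
have N0 k : 0 < k.+1%:R^-1 :> R by rewrite invr_gt0.
have /choice[q qP] : forall i, exists q : rat, `|ratr q - x 0 i| < N.+1%:R^-1.
  move=> i.
  have [|q] := @rat_in_itvoo R (x 0 i - N.+1%:R^-1) (x 0 i + N.+1%:R^-1).
    by rewrite ltrBlDr -addrA ltrDl addr_gt0// invr_gt0.
  by rewrite in_itv/= => /andP[q1 q2]; exists q; rewrite ltr_distl q1.
exists (\row_i q i, N) => /=; last first.
  by apply/ball_rVP => // j; rewrite !mxE.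
move=> y /ball_rVP hy; apply: exU; apply/ball_rVP => // j.
have := hy (N0 _) j; have := qP j; rewrite !mxE => h1 h2.
rewrite (_ : _ - _ = (ratr (q j) - y 0 j) - (ratr (q j) - x 0 j)); last by ring.
apply: le_lt_trans (ler_normB _ _) _; apply: lt_trans (ltrD h2 h1) _.
by rewrite (splitr e) ltrD.
Qed.

Lemma open_measurable_rV n (U : set 'rV[R]_n) :
  open U -> measurable (U : set (borelRn R n)).
Proof. by move=> oU; apply: sub_sigma_algebra. Qed.

Lemma continuous_measurable_rV n (f : 'rV[R]_n -> R) : continuous f ->
  measurable_fun setT (f : borelRn R n -> R).
Proof.
move=> cf; apply: (measurability _ (RGenOpens.measurableE R)).
move=> _ [_ [a [b ->] <-]]; rewrite setTI; apply: open_measurable_rV.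
by move/continuousP : cf; apply; exact: interval_open.
Qed.

Lemma continuous_coord n (i : 'I_n) : continuous (fun x : 'rV[R]_n => x 0 i).
Proof. exact: coord_continuous. Qed.

Lemma measurable_coord n (i : 'I_n) :
  measurable_fun setT (fun x : borelRn R n => (x : 'rV[R]_n) 0 i).
Proof. by apply: continuous_measurable_rV; exact: continuous_coord. Qed.

Lemma measurable_rV d (T : measurableType d) n (f : T -> borelRn R n) :
  (forall i, measurable_fun setT (fun t => (f t : 'rV[R]_n) 0 i)) ->
  measurable_fun setT f.
Proof.
move=> mf; apply: (@measurability _ _ _ _ setT f (@open 'rV[R]_n) erefl).
have N0 k : 0 < k.+1%:R^-1 :> R by rewrite invr_gt0.
move=> _ [U oU <-]; rewrite setTI (open_rat_ballE oU) preimage_bigcup.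
rewrite bigcup_mkcond; apply: countable_bigcupT_measurable => [|p].
  exact: countableP.
case: ifPn => // _.
rewrite [X in measurable X](_ : _ = \bigcap_(i in [set: 'I_n])
   ((fun t => (f t : 'rV[R]_n) 0 i) @^-1` ball (ratr (p.1 0 i) : R) p.2.+1%:R^-1)).
  apply: fin_bigcap_measurable => // i _.
  rewrite -[X in measurable X]setTI; apply: mf => //; exact: measurable_ball.
apply/seteqP; split=> t /=.
  by move=> /ball_rVP h i _ /=; have := h (N0 _) i; rewrite !mxE.
by move=> h; apply/ball_rVP => // i; have := h i I; rewrite !mxE.
Qed.

End borel_coordinates.

(** * Splitting off one coordinate *)

Section insert_coordinate.
Context {R : realType} {m : nat}.
Implicit Types (i : 'I_m.+1) (x : R) (v : 'rV[R]_m).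

(** [volume] slices along coordinate 0 only, while the flow moves along an arbitrary coordinate [i];
    this inverse of the splitting (y_i, [col' i y]) serves both. *)
Definition ins i x v : 'rV[R]_m.+1 :=
  \row_j (if unlift i j is Some k then v 0 k else x).

Lemma ins_id i x v : ins i x v 0 i = x.
Proof. by rewrite mxE unlift_none. Qed.

Lemma ins_lift i x v k : ins i x v 0 (lift i k) = v 0 k.
Proof. by rewrite mxE liftK. Qed.

Lemma col'_ins i x v : col' i (ins i x v) = v.
Proof. by apply/rowP => k; rewrite mxE ins_lift. Qed.

Lemma insK i (y : 'rV[R]_m.+1) : ins i (y 0 i) (col' i y) = y.
Proof.
by apply/rowP => j; case: (unliftP i j) => [k|] ->; rewrite ?ins_lift ?ins_id// mxE.
Qed.

Lemma row_mx_ins x v : row_mx (x%:M : 'rV[R]_1) v = ins ord0 x v.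
Proof.
apply/rowP => j; rewrite mxE -[j]/(j : 'I_(1 + m)); case: splitP => k jk.
  have -> : j = ord0 by apply/val_inj; rewrite /= jk (ord1 k).
  by rewrite ins_id (ord1 k) !mxE.
have -> : j = lift ord0 k by apply/val_inj; rewrite /= jk.
by rewrite ins_lift.
Qed.

Lemma measurable_ins i : measurable_fun setT
  (fun p : measurableTypeR R * borelRn R m => ins i p.1 p.2 : borelRn R m.+1).
Proof.
apply: measurable_rV => j; case: (unliftP i j) => [k|] ->.
  rewrite (_ : (fun _ => _) = (fun v : borelRn R m => (v : 'rV_m) 0 k) \o snd).
    by apply: measurableT_comp; [exact: measurable_coord|exact: measurable_snd].
  by apply/funext => -[x v] /=; rewrite ins_lift.
rewrite (_ : (fun _ => _) = fst); first exact: measurable_fst.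
by apply/funext => -[x v] /=; rewrite ins_id.
Qed.

Lemma measurable_ins_inv i : measurable_fun setT
  (fun y : borelRn R m.+1 => ((y : 'rV_m.+1) 0 i, col' i (y : 'rV_m.+1))
     : measurableTypeR R * borelRn R m).
Proof.
apply: measurable_fun_pair; first exact: measurable_coord.
apply: measurable_rV => k.
rewrite (_ : (fun _ => _) = (fun v : borelRn R m.+1 => (v : 'rV_m.+1) 0 (lift i k))).
  exact: measurable_coord.
by apply/funext => y; rewrite mxE.
Qed.

End insert_coordinate.

(** * The iterated volume as a sigma-finite measure *)

(** An alias that carries a proof of sigma-finiteness, so that the packaged structure can be
    inferred for a measure built inside a proof. *)
Definition sigma_finite_of d (T : measurableType d) (R : realType) (m : measure T R)
  (sm : sigma_finite setT m) : set T -> \bar R := m.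

HB.instance Definition _ d (T : measurableType d) (R : realType) (m : measure T R)
  (sm : sigma_finite setT m) := Measure.on (sigma_finite_of sm).

HB.instance Definition _ d (T : measurableType d) (R : realType) (m : measure T R)
  (sm : sigma_finite setT m) := Measure_isSigmaFinite.Build _ _ _ (sigma_finite_of sm) sm.

Section volume_measure.
Context {R : realType}.
Local Open Scope ereal_scope.

Lemma product_sigma_finite d1 d2 (T1 : measurableType d1) (T2 : measurableType d2)
    (m1 : {sigma_finite_measure set T1 -> \bar R})
    (m2 : {sigma_finite_measure set T2 -> \bar R}) : sigma_finite setT (m1 \x m2).
Proof.
have /sigma_finiteP[F [FT ndF Foo]] := sigma_finiteT m1.
have /sigma_finiteP[G [GT ndG Goo]] := sigma_finiteT m2.
exists (fun k => F k `*` G k).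
  apply/esym; rewrite -subTset => -[x y] _.
  have [i _ Fx] : (\bigcup_i F i) x by rewrite -FT.
  have [j _ Gy] : (\bigcup_j G j) y by rewrite -GT.
  exists (maxn i j) => //; split => /=.
    by move/subsetPset : (ndF _ _ (leq_maxl i j)); exact.
  by move/subsetPset : (ndG _ _ (leq_maxr i j)); exact.
move=> k; have [mF Fk] := Foo k; have [mG Gk] := Goo k.
split; first exact: measurableX.
by rewrite product_measure1E// lte_mul_pinfty// ge0_fin_numE.
Qed.

(** The function [volume] is defined on all sets but is additive only where its slices are
    measurable. The existential form lets the induction carry a packaged measure, which the product
    construction requires. *)
Lemma volume_measure_ex n : exists mu : {sigma_finite_measure set (borelRn R n) -> \bar R},
  forall A : set (borelRn R n), measurable A -> volume A = mu A.
Proof.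
elim: n => [|m [mu volE]].
  by exists (\d_(0%R : borelRn R 0)) => A mA.
pose c := fun p : measurableTypeR R * borelRn R m => ins ord0 p.1 p.2 : borelRn R m.+1.
have mc : measurable_fun setT c by exact: measurable_ins.
have mcP A : measurable A -> measurable (c @^-1` A).
  by move=> mA; rewrite -[X in measurable X]setTI; exact: mc.
pose P : measure (borelRn R m.+1) R := @measure_function_pushforward__canonical__measure_function_Measure
  _ _ _ _ R (@lebesgue_measure R \x mu) c mc.
(* The measurable inverse of [c] transports an exhaustion of the product. *)
have sP : sigma_finite setT P.
  have [F FT Foo] := product_sigma_finite (@lebesgue_measure R) mu.
  pose u := (fun y : borelRn R m.+1 => ((y : 'rV_m.+1) 0%R ord0, col' ord0 (y : 'rV_m.+1))
     : measurableTypeR R * borelRn R m).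
  have mu' : measurable_fun setT u by exact: measurable_ins_inv.
  exists (fun k => u @^-1` F k).
    by rewrite -preimage_bigcup -FT preimage_setT.
  move=> k; have [mF Fk] := Foo k; split; first by rewrite -[X in measurable X]setTI; exact: mu'.
  rewrite /P /= /pushforward -comp_preimage (_ : u \o c = id)//.
  by apply/funext => -[x v]; rewrite /u /c /= ins_id col'_ins.
exists (sigma_finite_of sP) => A mA.
rewrite /sigma_finite_of /P /= /pushforward /product_measure1; apply: eq_integral => x _ /=.
rewrite volE; last first.
  rewrite [X in measurable X](_ : _ = xsection (c @^-1` A) x).
    by have := measurable_xsection x (mcP A mA).
  by rewrite xsectionE; apply/seteqP; split=> v /=; rewrite row_mx_ins.
congr (mu _).
by rewrite xsectionE; apply/seteqP; split=> v /=; rewrite row_mx_ins.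
Qed.

End volume_measure.

(** The same function with a Borel domain, to which the measure structure is attached. *)
Definition volm (R : realType) (n : nat) : set (borelRn R n) -> \bar R := @volume R n.
Arguments volm {R n}.

Section volm_measure.
Context {R : realType} {n : nat}.
Local Open Scope ereal_scope.
Notation volm := (@volm R n).

Let volm0 : volm set0 = 0.
Proof. exact: volume0. Qed.

Let volm_ge0 A : 0 <= volm A.
Proof. exact: volume_ge0. Qed.

Let volm_semi_sigma_additive : semi_sigma_additive volm.
Proof.
have [mu volE] := @volume_measure_ex R n.
move=> F mF tF mUF; rewrite /volm volE//.
rewrite (_ : (fun _ => _) = (fun k => \sum_(0 <= i < k) mu (F i))).
  exact: measure_semi_sigma_additive.
by apply/funext => k; apply: eq_bigr => i _; rewrite volE.
Qed.

HB.instance Definition _ := isMeasure.Build _ (borelRn R n) R volm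
  volm0 volm_ge0 volm_semi_sigma_additive.

Let volm_sigma_finite : sigma_finite setT volm.
Proof.
have [mu volE] := @volume_measure_ex R n.
have [F FT Foo] := sigma_finiteT mu; exists F => // k.
by have [mF ?] := Foo k; split=> //; rewrite /volm volE.
Qed.

HB.instance Definition _ := Measure_isSigmaFinite.Build _ (borelRn R n) R volm
  volm_sigma_finite.

End volm_measure.

Lemma volmS {R : realType} {m : nat} (A : set (borelRn R m.+1)) : measurable A ->
  volm A = (@lebesgue_measure R \x @volm R m)%E
    ((fun p : measurableTypeR R * borelRn R m => ins ord0 p.1 p.2) @^-1` A).
Proof.
move=> mA; rewrite /product_measure1; apply: eq_integral => x _ /=.
congr (volume _).
by rewrite xsectionE; apply/seteqP; split=> v /=; rewrite row_mx_ins.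
Qed.

(** * Rectangles, Fubini along any coordinate, translation invariance *)

Section volume_product.
Context {R : realType}.
Local Open Scope ereal_scope.

Definition rect n (A : 'I_n -> set R) : set 'rV[R]_n :=
  [set x : 'rV[R]_n | forall i, A i (x 0%R i)].

Lemma measurable_rect n (A : 'I_n -> set (measurableTypeR R)) :
  (forall i, measurable (A i)) -> measurable (rect A : set (borelRn R n)).
Proof.
move=> mA; rewrite [X in measurable X](_ : _ = \bigcap_(i in [set: 'I_n])
   ((fun x : borelRn R n => (x : 'rV_n) 0%R i) @^-1` A i)).
  apply: fin_bigcap_measurable => // i _.
  by have := measurable_coord i measurableT (mA i); rewrite setTI.
by apply/seteqP; split=> x /= h => [i _|i]; [exact: h|exact: (h i)].
Qed.

Lemma volm_rect n (A : 'I_n -> set (measurableTypeR R)) :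
  (forall i, measurable (A i)) ->
  volm (rect A) = \prod_(i < n) lebesgue_measure (A i).
Proof.
elim: n A => [|m IH] A mA.
  by rewrite big_ord0 /volm /= indicE mem_set// => -[].
rewrite volmS; last exact: measurable_rect.
rewrite big_ord_recl -IH// -product_measure1E//; last exact: measurable_rect.
congr (product_measure1 _ _ _); apply/seteqP; split=> -[x v] /=.
  move=> h; split=> [|k /=]; first by have := h ord0; rewrite ins_id.
  by have := h (lift ord0 k); rewrite ins_lift.
move=> [/= h0 h] j; case: (unliftP ord0 j) => [k|] ->; rewrite ?ins_id//.
by rewrite ins_lift; exact: h.
Qed.

Definition cube n (k : nat) : set 'rV[R]_n :=
  rect (fun _ => `](- k%:R)%R, k%:R%R[%classic).

Lemma bigcup_cube n : \bigcup_k @cube n k = setT.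
Proof.
apply/seteqP; split=> // x _.
have [M xM] : exists M : R, forall i, (`|x 0 i| < M)%R.
  exists (1 + \sum_i `|x 0 i|)%R => i; rewrite (bigD1 i)//=.
  by rewrite addrCA ltrDl ltr_wpDr// sumr_ge0.
exists (Num.truncn M).+1 => //= i /=.
by rewrite in_itv /= -ltr_norml (lt_trans (xM i))// truncnS_gt.
Qed.

Lemma measurable_cube n k : measurable (@cube n k : set (borelRn R n)).
Proof. by apply: measurable_rect => i; exact: measurable_itv. Qed.

Lemma volm_cube_fin n k : volm (@cube n k) < +oo.
Proof.
rewrite volm_rect => [|i]; last exact: measurable_itv.
suff /andP[] : 0 <= \prod_(i < n) lebesgue_measure (`](- k%:R)%R, (k%:R : R)%R[%classic : set R) < +oo by [].
elim/big_ind : _.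
- by rewrite ltry lee01.
- move=> x y /andP[x0 xoo] /andP[y0 yoo]; rewrite mule_ge0//=.
  by apply: lte_mul_pinfty => //; rewrite ge0_fin_numE.
- move=> i _; rewrite measure_ge0/=.
  by rewrite lebesgue_measure_itv/=; case: ifPn => // _; rewrite -EFinD ltry.
Qed.

(** Rectangles form a generating pi-system and the cubes exhaust R^n with finite volume. Applied to
    push-forwards, this yields the invariances of the volume. *)
Lemma volm_unique n (mu : measure (borelRn R n) R) :
  (forall A : 'I_n -> set (measurableTypeR R), (forall i, measurable (A i)) ->
     mu (rect A) = volm (rect A)) ->
  forall A : set (borelRn R n), measurable A -> mu A = volm A.
Proof.
move=> muE A mA.
pose G : set (set (borelRn R n)) := [set rect B | B in
  [set B : 'I_n -> set (measurableTypeR R) | forall i, measurable (B i)]].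
(* Coordinates are measurable for the sigma-algebra generated by rectangles, hence so is the
   identity into the Borel sets, by [measurable_rV]. *)
have GE : measurable = <<s G >>.
  apply/seteqP; split.
    apply: smallest_sub; first exact: smallest_sigma_algebra.
    move=> U oU.
    pose i0 : borelRn R n -> g_sigma_algebraType G := id.
    have mi : forall i, measurable_fun setT
        (fun x : g_sigma_algebraType G => (x : 'rV_n) 0%R i).
      move=> i _ B mB; rewrite setTI; apply: sub_sigma_algebra.
      exists (fun j => if j == i then B else setT) => [j|]; first by case: ifP.
      apply/seteqP; split=> x /= h; first by have := h i; rewrite eqxx.
      by move=> j; case: eqP => // ->.
    have := @measurable_rV R _ (g_sigma_algebraType G) n id mi.
    move=> /(_ measurableT U); rewrite setTI; apply; exact: open_measurable_rV.
  apply: smallest_sub; first exact: sigma_algebra_measurable.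
  by move=> _ [B mB <-]; exact: measurable_rect.
have Gc k : G (@cube n k).
  by exists (fun _ => `](- k%:R)%R, k%:R%R[%classic) => // i; exact: measurable_itv.
apply: (@measure_unique _ _ _ G (@cube n)) => //.
- move=> _ _ [B mB <-] [C mC <-]; exists (fun i => B i `&` C i).
    by move=> i; apply: measurableI.
  by apply/seteqP; split=> x /= => [h|[h1 h2] i]; [split=> i; have [] := h i|split].
- exact: bigcup_cube.
- by move=> _ [B mB <-]; exact: muE.
- by move=> k; rewrite muE ?volm_cube_fin// => i; exact: measurable_itv.
Qed.

(** Makes any coordinate the distinguished one in Fubini; on rectangles it is a reordering of the
    product of side lengths. *)
Lemma volm_ins m (i : 'I_m.+1) (A : set (borelRn R m.+1)) : measurable A ->
  (@lebesgue_measure R \x @volm R m)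
    ((fun p : measurableTypeR R * borelRn R m => ins i p.1 p.2) @^-1` A) = volm A.
Proof.
pose c := fun p : measurableTypeR R * borelRn R m => ins i p.1 p.2 : borelRn R m.+1.
have mc : measurable_fun setT c by exact: measurable_ins.
pose P : measure (borelRn R m.+1) R := @measure_function_pushforward__canonical__measure_function_Measure
  _ _ _ _ R (@lebesgue_measure R \x @volm R m) c mc.
move: A; apply: (@volm_unique _ P) => A mA.
rewrite volm_rect// (bigD1_ord i)//= -(volm_rect (A := A \o lift i))//=.
rewrite -product_measure1E//; last by apply: measurable_rect => k; exact: mA.
congr (product_measure1 _ _ _); apply/seteqP; split=> -[x v] /=.
  move=> h; split=> [|k /=]; first by have := h i; rewrite ins_id.
  by have := h (lift i k); rewrite ins_lift.
move=> [/= h0 h] j; case: (unliftP i j) => [k|] ->; rewrite ?ins_id//.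
by rewrite ins_lift; exact: h.
Qed.

Lemma ge0_integral_volm_ins m (i : 'I_m.+1) (f : borelRn R m.+1 -> \bar R) :
  measurable_fun setT f -> (forall x, 0 <= f x) ->
  \int[volm]_x f x = \int[volm]_v \int[lebesgue_measure]_x f (ins i x v).
Proof.
move=> mf f0.
pose c := fun p : measurableTypeR R * borelRn R m => ins i p.1 p.2 : borelRn R m.+1.
have mc : measurable_fun setT c by exact: measurable_ins.
pose P : measure (borelRn R m.+1) R := @measure_function_pushforward__canonical__measure_function_Measure
  _ _ _ _ R (@lebesgue_measure R \x @volm R m) c mc.
transitivity (\int[P]_x f x).
  by apply: eq_measure_integral => A mA _; exact/esym/volm_ins.
rewrite /P ge0_integral_pushforward//= preimage_setT.
rewrite fubini_tonelli1//=; last by apply: measurableT_comp.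
by rewrite fubini_tonelli//; exact: measurableT_comp.
Qed.

Lemma lebesgue_measure_translate (c : R) (A : set (measurableTypeR R)) : measurable A ->
  lebesgue_measure ((fun x : R => x + c)%R @^-1` A) = lebesgue_measure A.
Proof.
move=> mA.
pose cT := fun x : measurableTypeR R => (x + c)%R : measurableTypeR R.
have mcT : measurable_fun setT cT by exact: measurable_funD.
pose PT : measure (measurableTypeR R) R := @measure_function_pushforward__canonical__measure_function_Measure
  _ _ _ _ R (@lebesgue_measure R) cT mcT.
apply/esym/(@lebesgue_measure_unique R PT) => // _ [[a b] _ <-].
rewrite /PT/= /pushforward (_ : _ @^-1` _ = `](a - c)%R, (b - c)%R]%classic).
  rewrite !lebesgue_measure_itv/= !lte_fin ltrD2r -!EFinB (_ : b - a = b - c - (a - c))%R//.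
  by ring.
by apply/seteqP; split=> x /=; rewrite /cT !in_itv/= ltrBlDr lerBrDr.
Qed.

Lemma ge0_integral_translate (c : R) (f : R -> \bar R) :
  measurable_fun setT f -> (forall x, 0 <= f x) ->
  \int[lebesgue_measure]_x f (x + c)%R = \int[lebesgue_measure]_x f x.
Proof.
move=> mf f0.
pose cT := fun x : measurableTypeR R => (x + c)%R : measurableTypeR R.
have mcT : measurable_fun setT cT by exact: measurable_funD.
pose PT : measure (measurableTypeR R) R := @measure_function_pushforward__canonical__measure_function_Measure
  _ _ _ _ R (@lebesgue_measure R) cT mcT.
transitivity (\int[PT]_x f x); first by rewrite /PT ge0_integral_pushforward.
by apply: eq_measure_integral => A mA _; exact: lebesgue_measure_translate.
Qed.

Lemma volm_translate n (z : 'rV[R]_n) (A : set (borelRn R n)) : measurable A ->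
  volm ((fun x : 'rV_n => x + z)%R @^-1` A) = volm A.
Proof.
pose c := fun x : borelRn R n => ((x : 'rV_n) + z)%R : borelRn R n.
have mc : measurable_fun setT c.
  apply: measurable_rV => i; rewrite (_ : (fun _ => _) =
     (fun x : borelRn R n => (x : 'rV_n) 0 i + z 0 i)%R).
    by apply: measurable_funD => //; exact: measurable_coord.
  by apply/funext => x; rewrite mxE.
pose P : measure (borelRn R n) R := @measure_function_pushforward__canonical__measure_function_Measure
  _ _ _ _ R (@volm R n) c mc.
move: A; apply: (@volm_unique _ P) => A mA.
rewrite volm_rect// /P/= /pushforward.
pose B i := (fun x : measurableTypeR R => x + z 0 i)%R @^-1` A i.
have mB i : measurable (B i).
  rewrite -[X in measurable X]setTI /B.
  have : measurable_fun setT (fun x : measurableTypeR R => x + z 0 i)%R.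
    exact: measurable_funD.
  by move=> /(_ measurableT _ (mA i)).
rewrite (_ : _ @^-1` _ = rect B); last first.
  by apply/seteqP; split=> x /= h i; have := h i; rewrite /c /B /= mxE.
rewrite volm_rect//; apply: eq_bigr => i _.
exact: lebesgue_measure_translate.
Qed.

End volume_product.

(** * Lebesgue measurable sets up to Borel null sets *)

Section lebesgue_volm.
Context {R : realType} {n : nat}.
Local Open Scope ereal_scope.

Lemma lebesgue_volm (A : set (borelRn R n)) : measurable A -> lebesgue A = volm A.
Proof. by move=> mA; rewrite /lebesgue (measurable_mu_extE (@volm R n)). Qed.

Lemma lebesgue_measurable_borel (A : set (borelRn R n)) :
  measurable A -> lebesgue_measurable (A : set 'rV[R]_n).
Proof. by move=> mA; exact: (caratheodory_measurable_mu_ext (@volm R n)). Qed.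

Lemma lebesgue_approx (A : set 'rV[R]_n) (e : R) : (0 < e)%R ->
  lebesgue A < +oo ->
  exists H : set (borelRn R n),
    [/\ measurable H, A `<=` H & volm H <= lebesgue A + e%:E].
Proof.
move=> e0 Aoo.
have Afin : lebesgue A \is a fin_num by rewrite ge0_fin_numE// outer_measure_ge0.
have [_ [F [mF AF] <-] Fe] := lb_ereal_inf_adherent e0 Afin.
exists (\bigcup_k F k); split => //; first exact: bigcup_measurable.
apply: le_trans (ltW Fe); rewrite -[leLHS]lebesgue_volm; last exact: bigcup_measurable.
apply: le_trans (outer_measure_sigma_subadditive (@lebesgue R n) _) _.
apply: lee_nneseries => [k _ _|k _]; first exact: outer_measure_ge0.
by rewrite le_eqVlt; apply/orP; left; apply/eqP; exact: lebesgue_volm (mF k).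
Qed.

Lemma lebesgue_hull (A : set 'rV[R]_n) : lebesgue A < +oo ->
  exists H : set (borelRn R n),
    [/\ measurable H, A `<=` H & volm H = lebesgue A].
Proof.
move=> Aoo.
have /choice[H HP] : forall k : nat, exists H : set (borelRn R n),
    [/\ measurable H, A `<=` H & volm H <= lebesgue A + (k.+1%:R^-1)%:E].
  by move=> k; apply: lebesgue_approx.
have mH : measurable (\bigcap_k H k) by apply: bigcapT_measurable => k; have [] := HP k.
have AH : A `<=` \bigcap_k H k by move=> x Ax k _; have [_ + _] := HP k; exact.
exists (\bigcap_k H k); split=> //; apply/eqP; rewrite eq_le; apply/andP; split.
  apply/lee_addgt0Pr => e e0.
  have [k ke] : exists k : nat, (k.+1%:R^-1 < e)%R.
    exists (Num.truncn e^-1); rewrite invf_plt ?posrE//; exact: truncnS_gt.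
  have [mHk _ Hk] := HP k.
  apply: (@le_trans _ _ (volm (H k))).
    by apply: le_measure; rewrite ?inE//; exact: bigcap_inf.
  by apply: le_trans Hk _; rewrite leeD2l// lee_fin ltW.
by rewrite -[leRHS]lebesgue_volm//; exact: le_outer_measure.
Qed.

(** [E] is hulled piece by piece inside cubes, because subtracting the measure of a piece from that
    of its hull requires finiteness. Later estimates work with [B] and discard [N]. *)
Lemma lebesgue_ex_borel (E : set 'rV[R]_n) : lebesgue_measurable E ->
  exists B N : set (borelRn R n), [/\ measurable B, measurable N, volm N = 0,
    E `<=` B & B `\` E `<=` N].
Proof.
move=> mE.
pose Ek k : set 'rV[R]_n := E `&` @cube R n k.
have mEk k : measurable (Ek k : set (lebesgueRn R n)).
  by apply: measurableI => //; apply: lebesgue_measurable_borel; exact: measurable_cube.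
have Ekoo k : lebesgue (Ek k) < +oo.
  apply: le_lt_trans (@volm_cube_fin R n k); rewrite -lebesgue_volm; last exact: measurable_cube.
  by apply: le_outer_measure; exact: subIsetr.
have /choice[H HP] k := lebesgue_hull (Ekoo k).
have Nk k : exists Nk : set (borelRn R n), [/\ measurable Nk, volm Nk = 0 & H k `\` Ek k `<=` Nk].
  have [mH EH HE] := HP k.
  have lH : @lebesgue R n (H k `\` Ek k) = 0.
    have mHL : measurable (H k : set (lebesgueRn R n)) by exact: lebesgue_measurable_borel.
    have : @Leb R n (H k `\` Ek k) = @Leb R n (H k) - @Leb R n (H k `&` Ek k).
      by rewrite measureD//= -ge0_fin_numE// /Leb lebesgue_volm// HE ge0_fin_numE// outer_measure_ge0.
    rewrite /Leb => ->; rewrite lebesgue_volm// HE (setIidr EH) subee//.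
    by rewrite ge0_fin_numE// outer_measure_ge0.
  have [|N [mN HN NE]] := @lebesgue_hull (H k `\` Ek k); first by rewrite lH.
  by exists N; split => //; rewrite NE.
have /choice[N NP] := Nk.
exists (\bigcup_k H k), (\bigcup_k N k); split.
- by apply: bigcup_measurable => k _; have [] := HP k.
- by apply: bigcup_measurable => k _; have [] := NP k.
- apply/eqP; rewrite -measure_le0.
  apply: le_trans (measure_sigma_subadditive (@volm R n) _ _ (@subset_refl _ _)) _ => //.
  - by move=> k; have [] := NP k.
  - by apply: bigcup_measurable => k _; have [] := NP k.
  - by rewrite eseries0// => k _ _; have [] := NP k.
- move=> x Ex; have : (\bigcup_k @cube R n k) x by rewrite bigcup_cube.
  by move=> [k _ xk]; exists k => //; have [_ + _] := HP k; apply.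
- move=> x [[k _ Hx] nEx]; exists k => //; have [_ _] := NP k; apply; split=> // -[]//.
Qed.

(** The identity as a measurable map; the push-forward of [Leb] along it is [volm], which moves
    integrals of Borel functions between the two. *)
Definition to_borel (x : lebesgueRn R n) : borelRn R n := x.

Lemma measurable_to_borel : measurable_fun setT to_borel.
Proof. by move=> _ A mA; rewrite setTI; exact: lebesgue_measurable_borel. Qed.

Lemma integral_Leb (A : set (borelRn R n)) (f : borelRn R n -> \bar R) :
  measurable A -> measurable_fun setT f -> (forall x, 0 <= f x) ->
  \int[@Leb R n]_(x in A) f x = \int[volm]_(x in A) f x.
Proof.
move=> mA mf f0.
pose P : measure (borelRn R n) R := @measure_function_pushforward__canonical__measure_function_Measure
  _ _ _ _ R (@Leb R n) to_borel measurable_to_borel.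
transitivity (\int[P]_(x in A) f x).
  apply/esym; apply: (ge0_integral_pushforward measurable_to_borel) => //.
  exact: measurable_funTS.
by apply: eq_measure_integral => B mB _; exact: lebesgue_volm.
Qed.

Lemma integral_ae_set (A' : set 'rV[R]_n) (A N : set (borelRn R n))
    (f : borelRn R n -> \bar R) :
  lebesgue_measurable A' ->
  measurable A -> measurable N -> volm N = 0 -> A `\` A' `<=` N -> A' `\` A `<=` N ->
  measurable_fun setT f -> (forall x, 0 <= f x) ->
  \int[@Leb R n]_(x in A') f x = \int[volm]_(x in A) f x.
Proof.
move=> mA' mA mN N0 AA'N A'AN mf f0.
have mAL : measurable (A : set (lebesgueRn R n)) by exact: lebesgue_measurable_borel.
have mNL : measurable (N : set (lebesgueRn R n)) by exact: lebesgue_measurable_borel.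
have mfL : measurable_fun setT (f : lebesgueRn R n -> \bar R).
  exact: (measurableT_comp mf measurable_to_borel).
rewrite -integral_Leb//.
have mAN : measurable ((A : set (lebesgueRn R n)) `\` N) by exact: measurableD.
have mA'N : measurable ((A' : set (lebesgueRn R n)) `\` N) by exact: measurableD.
have LN : @Leb R n N = 0 by rewrite /Leb lebesgue_volm.
have negl D : measurable D -> \int[@Leb R n]_(x in D) f x = \int[@Leb R n]_(x in D `\` N) f x.
  by move=> mD; apply: ge0_negligible_integral => //; exact: measurable_funTS.
rewrite negl// [RHS]negl//.
congr (integral _ _ _); apply/seteqP; split => x [Ax nN]; split => //.
  by apply: contrapT => nA; apply: nN; exact: A'AN.
by apply: contrapT => nA; apply: nN; exact: AA'N.
Qed.

End lebesgue_volm.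

(** * Smooth functions on the line *)

Section smooth_real_functions.
Context {R : realType}.
Implicit Types f g : R -> R.

Lemma is_derive1_continuous f (df : R -> R) :
  (forall x : R, is_derive x 1 f (df x)) -> continuous f.
Proof.
move=> fd x; apply: differentiable_continuous.
by apply/derivable1_diffP; have [] := fd x.
Qed.

(** Class C^k with the derivatives given as witnesses, so that closure under sums, products and
    inverses is a direct induction. *)
Fixpoint iter_derivable (k : nat) f : Prop :=
  if k is j.+1 then exists2 g : R -> R, (forall x : R, is_derive x 1 f (g x)) & iter_derivable j g
  else continuous f.

Lemma iter_derivableW k f : iter_derivable k.+1 f -> iter_derivable k f.
Proof.
elim: k f => [|k IH] f [g fg gk]; first exact: is_derive1_continuous fg.
by exists g => //; exact: IH.
Qed.

Lemma iter_derivable_cst k (c : R) : iter_derivable k (cst c).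
Proof.
elim: k c => [|k IH] c; first exact: cst_continuous.
by exists (cst 0) => // x; exact: is_derive_cst.
Qed.

Lemma iter_derivableD k f g :
  iter_derivable k f -> iter_derivable k g -> iter_derivable k (f \+ g).
Proof.
elim: k f g => [|k IH] f g; first by move=> cf cg x; apply: continuousD; [exact: cf|exact: cg].
move=> [f' ff' f'k] [g' gg' g'k]; exists (f' \+ g'); last exact: IH.
by move=> x; exact: is_deriveD.
Qed.

Lemma iter_derivableM k f g :
  iter_derivable k f -> iter_derivable k g -> iter_derivable k (f \* g).
Proof.
elim: k f g => [|k IH] f g; first by move=> cf cg x; apply: continuousM; [exact: cf|exact: cg].
move=> fk gk; have [f' ff' f'k] := fk; have [g' gg' g'k] := gk.
exists ((f \* g') \+ (g \* f')); last first.
  by apply: iter_derivableD; apply: IH => //; exact: iter_derivableW.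
by move=> x; exact: is_deriveM.
Qed.

Lemma iter_derivableV k f : (forall x, f x != 0) ->
  iter_derivable k f -> iter_derivable k (fun x => (f x)^-1).
Proof.
move=> f0; elim: k => [|k IH] fk; first by move=> x; apply: continuousV => //; exact: fk.
have [f' ff' f'k] := fk.
have Vk := IH (iter_derivableW fk).
exists ((cst (-1) \* f') \* ((fun x => (f x)^-1) \* (fun x => (f x)^-1))).
  move=> x; apply: (is_derive_eq (is_deriveV (f0 x) (ff' x))).
  by rewrite /GRing.scale /= expr2 invfM; ring.
apply: iter_derivableM; last exact: iter_derivableM.
by apply: iter_derivableM => //; exact: iter_derivable_cst.
Qed.

Lemma iter_derivable_affine k f (a b : R) :
  iter_derivable k f -> iter_derivable k (fun x => f (a * x + b)).
Proof.
elim: k f => [|k IH] f.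
  move=> cf x; apply: (@continuous_comp _ _ _ (fun x => a * x + b) f); last exact: cf.
  by apply: continuousD; [apply: continuousM|]; exact: cvg_cst || exact: cvg_id.
move=> [f' ff' f'k]; exists (cst a \* (fun x => f' (a * x + b))).
  move=> x; apply: is_derive_eq.
  by rewrite /= addr0 /GRing.scale /= mulr1 mulrC.
by apply: iter_derivableM; [exact: iter_derivable_cst|exact: IH].
Qed.

Lemma is_derive0_quadratic f (C x : R) : f x = 0 ->
  (forall y, `|f y| <= C * (y - x) ^+ 2) -> is_derive x 1 f 0.
Proof.
move=> fx0 fC.
have C0 : 0 <= C.
  by have := fC (x + 1); rewrite addrAC subrr add0r expr1n mulr1; exact: le_trans.
have fcvg : (fun h => h^-1 *: (f (h *: 1 + x) - f x)) @ (0 : R)^' --> (0 : R).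
  apply/cvgrPdist_le => e e0; near=> h.
  have h0 : h != 0 by near: h; exact: nbhs_dnbhs_neq.
  rewrite sub0r normrN fx0 subr0 normrZ normfV.
  rewrite ler_pdivrMl ?normr_gt0//.
  apply: le_trans (fC _) _; rewrite /GRing.scale /= mulr1 addrK -real_normK ?num_real//.
  rewrite expr2 mulrCA ler_wpM2l//.
  apply: (@le_trans _ _ ((C + 1) * `|h|)); first by rewrite ler_wpM2r// lerDl.
  rewrite -ler_pdivlMl ?ltr_wpDl//.
  by near: h; apply: dnbhs0_le; rewrite mulr_gt0// invr_gt0 ltr_wpDl.
by apply: DeriveDef; [apply/cvg_ex; exists 0|exact: cvg_lim].
Unshelve. all: by end_near. Qed.

(** The factor y^-m makes the family stable under differentiation: the derivative of [flat m] is a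
    combination of [flat m.+1] and [flat m.+2]. *)
Definition flat (m : nat) (y : R) : R := if 0 < y then y ^- m * expR (- y^-1) else 0.

Lemma flat_quadratic m (y : R) : `|flat m y| <= m.+2%:R ^+ m.+2 * y ^+ 2.
Proof.
rewrite /flat; case: ifPn => [y0|_]; last first.
  by rewrite normr0 mulr_ge0 ?sqr_ge0 ?exprn_ge0.
rewrite ger0_norm; last by rewrite mulr_ge0 ?expR_ge0// invr_ge0 exprn_ge0// ltW.
rewrite -ler_pdivlMl; last by rewrite invr_gt0 exprn_gt0.
rewrite invrK expRN.
have N0 : 0 < m.+2%:R :> R by [].
(* With k = m + 2, exp(1/y) is the k-th power of exp(1/(k y)), which is at least 1/(k y). The two
   powers of y beyond m give the quadratic bound that makes the derivative at 0 vanish. *)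
have : (m.+2%:R * y) ^- m.+2 <= expR y^-1.
  have -> : y^-1 = (m.+2%:R * y)^-1 *+ m.+2.
    by rewrite -[RHS]mulr_natr invfM -mulrA [y^-1 * _]mulrC mulrA mulVf ?mul1r// gt_eqF.
  rewrite -[X in expR X]mulr_natl expRM_natl -exprVn lerXn2r ?nnegrE ?invr_ge0 ?expR_ge0//.
    by rewrite mulr_ge0 ?ltW.
  by apply: le_trans (expR_ge1Dx _); rewrite lerDr.
move=> h; rewrite invf_ple ?posrE ?expR_gt0//; last first.
  by apply: mulr_gt0; [exact: exprn_gt0|apply: mulr_gt0; exact: exprn_gt0].
apply: le_trans h; rewrite le_eqVlt; apply/orP; left; apply/eqP; congr _^-1.
by rewrite exprMn [y ^+ m.+2]exprS [y ^+ m.+1]exprS; ring.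
Qed.

Lemma is_derive_flat m (y : R) :
  is_derive y 1 (flat m) (- m%:R * flat m.+1 y + flat m.+2 y).
Proof.
have [y0|y0|y0] := ltgtP y 0.
- rewrite /flat !ltNge (ltW y0)/= mulr0 addr0.
  apply: (@near_eq_is_derive _ _ _ (cst (0 : R))).
  by near=> x; rewrite /= ltNge ifF//; apply/negbF/ltW; near: x; exact: lt_nbhsl.
- have yn0 : y != 0 by rewrite gt_eqF.
  have ym0 : y ^+ m != 0 by rewrite expf_neq0.
  have dV : is_derive y 1 (fun y => - y^-1) (- (- y ^- 2 *: 1)).
    by apply: is_deriveN; apply: is_deriveV.
  have dE := @is_derive1_comp _ (@expR R) _ y _ _ (is_derive_expR _) dV.
  have dX : is_derive y 1 (fun y => (y ^+ m)^-1) (- (y ^+ m) ^- 2 *: (m%:R * y ^+ m.-1 *: 1)).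
    apply: is_deriveV => //.
    have := @is_deriveX _ _ (@id R) m y 1 1 (is_derive_id _ _).
    by rewrite (_ : id ^+ m = (fun y : R => y ^+ m))// exprfctE.
  have D := is_deriveM dX dE.
  have fg : \forall x \near y,
      ((fun y : R => (y ^+ m)^-1) * (@expR R \o (fun y => - y^-1))) x = flat m x.
    by near=> x; rewrite /flat ifT//; near: x; exact: lt_nbhsr.
  apply: (is_derive_eq (near_eq_is_derive fg D)).
  rewrite /flat y0 /GRing.scale /= !exprS; case: (m) => [|k]; first by rewrite !expr0; field.
  by rewrite /= !exprS; field; rewrite yn0 expf_neq0.
- rewrite y0 /flat ltxx mulr0 addr0.
  apply: (@is_derive0_quadratic _ (m.+2%:R ^+ m.+2)); first by rewrite ltxx.
  by move=> x; rewrite subr0; exact: flat_quadratic.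
Unshelve. all: by end_near. Qed.

Lemma iter_derivable_flat k m : iter_derivable k (flat m).
Proof.
elim: k m => [|k IH] m; first exact: is_derive1_continuous (is_derive_flat m).
exists ((cst (- m%:R) \* flat m.+1) \+ flat m.+2) => [x|]; first exact: is_derive_flat.
apply: iter_derivableD => //; apply: iter_derivableM => //.
exact: iter_derivable_cst.
Qed.

End smooth_real_functions.

(** * A bump on the line whose flow is explicit *)

Section bumpR.
Context {R : realType}.

(** The factor y^2 makes 1/[plat] the derivative of -exp(1/y) for y > 0. *)
Definition plat (y : R) : R := y ^+ 2 * flat 0 y.

Lemma platE (y : R) : 0 < y -> plat y = y ^+ 2 * expR (- y^-1).
Proof. by move=> y0; rewrite /plat /flat y0 expr0 invr1 mul1r. Qed.

Lemma plat_gt0 (y : R) : 0 < y -> 0 < plat y.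
Proof. by move=> y0; rewrite platE// mulr_gt0 ?expR_gt0 ?exprn_gt0. Qed.

Lemma plat_eq0 (y : R) : y <= 0 -> plat y = 0.
Proof. by move=> y0; rewrite /plat /flat ltNge y0 mulr0. Qed.

Lemma plat_ge0 (y : R) : 0 <= plat y.
Proof. by have [/plat_eq0->//|/plat_gt0/ltW] := leP y 0. Qed.

Lemma plat_le1 (y : R) : y <= 1 -> plat y <= 1.
Proof.
have [/plat_eq0->//|y0 y1] := leP y 0; rewrite platE//.
rewrite mulr_ile1 ?sqr_ge0 ?expR_ge0 ?exprn_ile1 ?(ltW y0)//.
by rewrite -[leRHS]expR0 ler_expR oppr_le0 invr_ge0 ltW.
Qed.

Lemma iter_derivable_plat k : iter_derivable k plat.
Proof.
have id_k : iter_derivable k (@id R).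
  case: k => [x|k]; first exact: cvg_id.
  by exists (cst 1) => [x|]; [exact: is_derive_id|exact: iter_derivable_cst].
have -> : plat = (id \* id) \* flat 0 by apply/funext => y; rewrite /plat expr2.
by apply: iter_derivableM; [exact: iter_derivableM|exact: iter_derivable_flat].
Qed.

(* A smooth bump supported in [-1, 1] whose reciprocal has an elementary
   primitive on ]-1, 1[, see [chart]. *)
Definition bumpR (x : R) : R :=
  plat (1 - x) * plat (1 + x) / (plat (1 - x) + plat (1 + x)).

Lemma plat_add_gt0 (x : R) : 0 < plat (1 - x) + plat (1 + x).
Proof.
have [x0|x0] := ltP x 1.
  by rewrite ltr_pwDl ?plat_ge0// plat_gt0// subr_gt0.
by rewrite ltr_wpDl ?plat_ge0// plat_gt0//; lra.
Qed.

Lemma iter_derivable_bump k : iter_derivable k bumpR.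
Proof.
have p1 : iter_derivable k (fun x => plat (1 - x)).
  rewrite (_ : (fun _ => _) = fun x => plat (-1 * x + 1)).
    exact/iter_derivable_affine/iter_derivable_plat.
  by apply/funext => x; congr plat; ring.
have p2 : iter_derivable k (fun x => plat (1 + x)).
  rewrite (_ : (fun _ => _) = fun x => plat (1 * x + 1)).
    exact/iter_derivable_affine/iter_derivable_plat.
  by apply/funext => x; congr plat; ring.
apply: (@iter_derivableM _ _ (fun x => plat (1 - x) * plat (1 + x))).
  exact: iter_derivableM p1 p2.
apply: iter_derivableV; last exact: iter_derivableD p1 p2.
by move=> x; rewrite gt_eqF ?plat_add_gt0.
Qed.

Lemma bump_ge0 x : 0 <= bumpR x.
Proof. by apply: divr_ge0; [apply: mulr_ge0|apply: addr_ge0]; exact: plat_ge0. Qed.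

Lemma bumpN x : bumpR (- x) = bumpR x.
Proof. by rewrite /bumpR opprK [plat (1 + x) * _]mulrC [plat (1 + x) + _]addrC. Qed.

Lemma bump_gt0 x : `|x| < 1 -> 0 < bumpR x.
Proof.
rewrite ltr_norml => /andP[x1 x2].
by rewrite divr_gt0 ?plat_add_gt0// mulr_gt0// plat_gt0//; lra.
Qed.

Lemma bump_eq0 x : 1 <= `|x| -> bumpR x = 0.
Proof.
rewrite ler_normr => /orP[x1|x1]; rewrite /bumpR.
  by rewrite (@plat_eq0 (1 - x)) ?mul0r// subr_le0.
by rewrite (@plat_eq0 (1 + x)) ?mulr0 ?mul0r// -lerBrDl sub0r lerNr.
Qed.

Lemma bump_le1 x : bumpR x <= 1.
Proof.
rewrite /bumpR ler_pdivrMr ?plat_add_gt0// mul1r.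
have [x0|x0] := leP 0 x.
  apply: (@le_trans _ _ (plat (1 + x))); last by rewrite lerDr plat_ge0.
  by rewrite ler_piMl ?plat_ge0// plat_le1//; lra.
apply: (@le_trans _ _ (plat (1 - x))); last by rewrite lerDl plat_ge0.
by rewrite ler_piMr ?plat_ge0// plat_le1//; lra.
Qed.

Definition bumpR' : R -> R := fun x => 'D_1 bumpR x.

Lemma is_derive_bump (x : R) : is_derive x 1 bumpR (bumpR' x).
Proof.
have [g gd _] := iter_derivable_bump 1.
by apply: DeriveDef => //; have [] := gd x.
Qed.

(** One constant bounds both the size of [bumpR'] and its Lipschitz constant: the first two
    derivatives are continuous on a compact interval. *)
Lemma bumpR'_bounds : exists M : R, [/\ 0 < M,
  forall x, `|x| <= 1 -> `|bumpR' x| <= M &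
  forall x y, `|x| <= 1 -> `|y| <= 1 -> `|bumpR' x - bumpR' y| <= M * `|x - y|].
Proof.
have [g gd [g' g'd cg']] := iter_derivable_bump 2.
have -> : bumpR' = g by apply/funext => x; have [_ <-] := gd x.
have cg := is_derive1_continuous g'd.
have bd (f : R -> R) : continuous f -> exists2 M : R, 0 < M & forall x, `|x| <= 1 -> `|f x| <= M.
  move=> cf; have cf' : {within `[(-1 : R), 1], continuous (fun x => `|f x|)}.
    apply: continuous_subspaceT => x; apply: (@continuous_comp _ _ _ f Num.norm).
      exact: cf.
    exact: norm_continuous.
  have [c _ cM] := EVT_max (ltW (gtrN (@ltr01 R))) cf'.
  exists (1 + `|f c|) => [|x x1]; first by rewrite ltr_pwDl.
  by rewrite (le_trans (cM x _)) ?lerDr// in_itv/= -ler_norml.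
have [M1 M10 gM] := bd _ cg; have [M2 M20 g'M] := bd _ cg'.
exists (M1 + M2); split; first by rewrite addr_gt0.
  by move=> x /gM /le_trans; apply; rewrite lerDl ltW.
have lip x y : x <= y -> `|x| <= 1 -> `|y| <= 1 -> `|g y - g x| <= (M1 + M2) * `|y - x|.
  move=> xy x1 y1; have [|c] := @MVT_segment _ g g' x y xy (fun z _ => g'd z).
    by apply: continuous_subspaceT => z; exact: cg.
  rewrite in_itv/= => /andP[xc cy] ->; rewrite normrM ler_wpM2r//.
  apply: (@le_trans _ _ M2); last by rewrite lerDr ltW.
  apply: g'M; rewrite ler_norml (le_trans _ xc) ?(le_trans cy)//.
    by move: y1; rewrite ler_norml => /andP[].
  by move: x1; rewrite ler_norml => /andP[].
move=> x y x1 y1; have [xy|/ltW xy] := leP y x; first exact: lip.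
by have := lip x y xy x1 y1; rewrite (distrC (g y)) (distrC y).
Qed.

Lemma continuous_bump : continuous bumpR.
Proof. exact: is_derive1_continuous is_derive_bump. Qed.

(** The quotient defining [bumpR] is the product over the sum of two terms, so its reciprocal splits
    into two summands, each with an elementary primitive. *)
Lemma bump_inv (x : R) : `|x| < 1 -> (bumpR x)^-1 = (plat (1 - x))^-1 + (plat (1 + x))^-1.
Proof.
rewrite ltr_norml => /andP[x1 x2].
have p1 : plat (1 - x) != 0 by rewrite gt_eqF// plat_gt0//; lra.
have p2 : plat (1 + x) != 0 by rewrite gt_eqF// plat_gt0//; lra.
by rewrite /bumpR; field; rewrite p1 p2 gt_eqF// plat_add_gt0.
Qed.

(* Since [chart' = 1 / bumpR] on ]-1, 1[, the flow of the vector field [bumpR]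
   at time t is [unchart (chart x + t)]. *)
Definition chart (x : R) : R := expR (1 - x)^-1 - expR (1 + x)^-1.

Lemma is_derive_chart (x : R) : `|x| < 1 -> is_derive x 1 chart (bumpR x)^-1.
Proof.
move=> x1; rewrite bump_inv//; move: x1; rewrite ltr_norml => /andP[x1 x2].
have p1 : 0 < 1 - x by lra.
have p2 : 0 < 1 + x by lra.
have D1 : is_derive x 1 (fun x => 1 - x) (- (1 : R)).
  by have := is_deriveB (is_derive_cst (1 : R) x 1) (is_derive_id x 1); rewrite sub0r.
have D2 : is_derive x 1 (fun x => 1 + x) (1 : R).
  by have := is_deriveD (is_derive_cst (1 : R) x 1) (is_derive_id x 1); rewrite add0r.
have V1 := @is_deriveV _ (fun x => 1 - x) x _ 1 (lt0r_neq0 p1) D1.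
have V2 := @is_deriveV _ (fun x => 1 + x) x _ 1 (lt0r_neq0 p2) D2.
have E1 := @is_derive1_comp _ (@expR R) _ x _ _ (is_derive_expR _) V1.
have E2 := @is_derive1_comp _ (@expR R) _ x _ _ (is_derive_expR _) V2.
apply: (is_derive_eq (is_deriveB E1 E2)).
rewrite /GRing.scale /= !platE// !invfM !expRN !invrK.
by field; rewrite !gt_eqF.
Qed.

Lemma chart_incr (x y : R) : `|x| < 1 -> `|y| < 1 -> x < y -> chart x < chart y.
Proof.
rewrite !ltr_norml => /andP[x1 x2] /andP[y1 y2] xy.
rewrite /chart ler_ltB// ?ltr_expR ?ler_expR.
  by rewrite lef_pV2 ?posrE; lra.
by rewrite ltf_pV2 ?posrE; lra.
Qed.

Lemma chart_surj (u : R) : exists x, `|x| < 1 /\ chart x = u.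
Proof.
(* Chosen so that exp(1/(1 - z)) is at least |u| + e + 2, while exp(1/(1 + z)) is at most e. Hence
   [chart z] is at least |u|; [chart] is odd, and the intermediate value theorem applies on
   [-z, z]. *)
pose z : R := 1 - (`|u| + expR 1 + 1)^-1.
have d0 : 1 < `|u| + expR 1 + 1 by rewrite ltrDr ltr_wpDl ?expR_gt0.
have di : 0 < (`|u| + expR 1 + 1)^-1 < 1.
  by rewrite invr_gt0 invf_lt1 ?d0 ?andbT// (lt_trans _ d0).
have z01 : 0 < z < 1 by rewrite /z; lra.
have hz : `|u| <= chart z.
  rewrite /chart lerBrDr.
  have -> : (1 - z)^-1 = `|u| + expR 1 + 1 by rewrite /z opprB addrC subrK invrK.
  apply: le_trans (expR_ge1Dx _).
  have : expR (1 + z)^-1 <= expR 1 by rewrite ler_expR invf_le1; lra.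
  lra.
have hN : chart (- z) = - chart z by rewrite /chart opprK [RHS]opprB.
have hc : {within `[- z, z], continuous chart}.
  apply: derivable_within_continuous => x; rewrite in_itv/= => /andP[x1 x2].
  have : `|x| < 1 by rewrite ltr_norml; lra.
  by move/is_derive_chart => [].
have [||x] := @IVT R chart (- z) z u _ hc; first by lra.
  have u1 := ler_norm u; have u2 := ler_norm (- u); rewrite normrN in u2.
  by rewrite hN ge_min le_max; apply/andP; split; apply/orP; [left|right]; lra.
by rewrite in_itv/= => /andP[x1 x2] xu; exists x; split=> //; rewrite ltr_norml; lra.
Qed.

Definition unchart (u : R) : R := xget 0 [set x | `|x| < 1 /\ chart x = u].

Lemma unchart_lt1 u : `|unchart u| < 1.
Proof.
have : [set x | `|x| < 1 /\ chart x = u] (unchart u) by apply: xgetPex; exact: chart_surj.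
by case.
Qed.

Lemma unchartK u : chart (unchart u) = u.
Proof.
have : [set x | `|x| < 1 /\ chart x = u] (unchart u) by apply: xgetPex; exact: chart_surj.
by case.
Qed.

Lemma chart_inj (x y : R) : `|x| < 1 -> `|y| < 1 -> chart x = chart y -> x = y.
Proof.
move=> x1 y1 e; have [xy|xy|//] := ltgtP x y.
  by have := chart_incr x1 y1 xy; rewrite e ltxx.
by have := chart_incr y1 x1 xy; rewrite e ltxx.
Qed.

Lemma chartK x : `|x| < 1 -> unchart (chart x) = x.
Proof.
by move=> x1; apply: chart_inj => //; [exact: unchart_lt1|exact: unchartK].
Qed.

(** The inverse of a primitive of 1/[bumpR] solves the autonomous equation x' = [bumpR] x. *)
Lemma is_derive_unchart (u : R) : is_derive u 1 unchart (bumpR (unchart u)).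
Proof.
have k1 := unchart_lt1 u.
have nk : \forall x \near unchart u, `|x| < 1.
  have : open [set x : R | `|x| < 1].
    apply: (@open_comp _ _ (@Num.norm R R) [set y | y < 1]); last exact: open_lt.
    by move=> x _; exact: norm_continuous.
  by move=> o1; exact: open_nbhs_nbhs.
rewrite -{1}(unchartK u) -[bumpR _]invrK.
apply: is_derive_inverse.
- by near=> x; apply: chartK; near: x.
- near=> x; apply: differentiable_continuous; apply/derivable1_diffP.
  have : `|x| < 1 by near: x.
  by move/is_derive_chart => [].
- exact: is_derive_chart.
- by rewrite invr_neq0// gt_eqF// bump_gt0.
Unshelve. all: by end_near. Qed.

End bumpR.

Global Opaque plat bumpR chart unchart.

(** * Measures with a density and change of variables on the line *)

Section weighted_measure.
Context d {T : measurableType d} {R : realType}.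
Variables (mu : {measure set T -> \bar R}) (g : T -> R).
Hypotheses (mg : measurable_fun setT g) (g0 : forall x, 0 <= g x).
Local Open Scope ereal_scope.

(** The two proofs are arguments so that the measure structure can be attached to the term
    itself. *)
Definition weighted of measurable_fun setT g & (forall x, 0 <= g x)%R :=
  fun A : set T => \int[mu]_(x in A) (g x)%:E.

Notation nu := (weighted mg g0).

Let nu0 : nu set0 = 0.
Proof. exact: integral_set0. Qed.

Let nu_ge0 A : 0 <= nu A.
Proof. by apply: integral_ge0 => x _; rewrite lee_fin. Qed.

Let nu_sigma_additive : semi_sigma_additive nu.
Proof.
move=> F mF tF mUF; rewrite /weighted ge0_integral_bigcup//; last 2 first.
- by apply: measurable_funTS; exact/measurable_EFinP.
- by move=> x _; rewrite lee_fin.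
by apply: is_cvg_ereal_nneg_natsum => k _; exact: nu_ge0.
Qed.

HB.instance Definition _ := isMeasure.Build _ _ _ nu nu0 nu_ge0 nu_sigma_additive.

Import HBNNSimple.

Let integral_weighted_nnsfun (h : {nnsfun T >-> R}) :
  \int[nu]_x (h x)%:E = \int[mu]_x ((h x)%:E * (g x)%:E).
Proof.
under [LHS]eq_integral do rewrite fimfunE -fsumEFin//.
rewrite ge0_integral_fsum//; last 2 first.
  - by move=> r; exact/measurable_EFinP/measurableT_comp.
  - by move=> r x _; rewrite nnfun_muleindic_ge0.
under [RHS]eq_integral => x _.
  rewrite fimfunE -fsumEFin// ge0_mule_fsuml; last first.
    by move=> r; rewrite nnfun_muleindic_ge0.
  over.
rewrite ge0_integral_fsum//; last 2 first.
  - move=> r; apply: emeasurable_funM; last exact/measurable_EFinP.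
    exact/measurable_EFinP/measurableT_comp.
  - by move=> r x _; rewrite mule_ge0 ?nnfun_muleindic_ge0// lee_fin.
apply: eq_fsbigr => r rh.
have r0 : (0 <= r)%R by move: rh; rewrite inE => -[x _ <-].
have mI : measurable_fun setT (fun x => (\1_(h @^-1` [set r]) x : R)%:E).
  exact/measurable_EFinP.
under eq_integral do rewrite EFinM.
rewrite ge0_integralZl// ?lee_fin//; first last.
under [RHS]eq_integral do rewrite EFinM -muleA.
rewrite [RHS]ge0_integralZl ?lee_fin//; last 2 first.
  - by apply: emeasurable_funM => //; exact/measurable_EFinP.
  - by move=> x _; rewrite mule_ge0// lee_fin.
congr (_ * _); rewrite integral_indic// setIT.
rewrite -[LHS]/(\int[mu]_(x in h @^-1` [set r]) (g x)%:E) integral_mkcond.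
by apply: eq_integral => x _; rewrite patchE indicE; case: ifP => _; rewrite ?mul1e ?mul0e.
Qed.

Lemma integral_weighted (f : T -> \bar R) :
  measurable_fun setT f -> (forall x, 0 <= f x) ->
  \int[nu]_x f x = \int[mu]_x (f x * (g x)%:E).
Proof.
move=> mf f0; pose f_ := nnsfun_approx measurableT mf.
transitivity (limn (fun n => \int[nu]_x (f_ n x)%:E)).
  rewrite -monotone_convergence//.
  - apply: eq_integral => y _; apply/esym/cvg_lim => //.
    by apply: cvg_nnsfun_approx => // *; exact: f0.
  - by move=> n; exact/measurable_EFinP/measurable_funP.
  - by move=> n y _; rewrite lee_fin.
  - by move=> y _ m n mn; rewrite lee_fin; exact/lefP/nd_nnsfun_approx.
rewrite (_ : (fun _ => _) = fun n => \int[mu]_x ((f_ n x)%:E * (g x)%:E)); last first.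
  by apply/funext => n; exact: integral_weighted_nnsfun.
rewrite -monotone_convergence//.
- apply: eq_integral => y _; apply/cvg_lim => //.
  rewrite muleC; under eq_fun do rewrite muleC; apply: cvgeZl => //.
  by apply: cvg_nnsfun_approx => // *; exact: f0.
- by move=> n; apply: emeasurable_funM; apply/measurable_EFinP => //; exact/measurable_funP.
- by move=> n y _; rewrite mule_ge0// lee_fin.
- move=> y _ m n mn; apply: lee_wpmul2r => //.
    by rewrite lee_fin.
  by rewrite lee_fin; exact/lefP/nd_nnsfun_approx.
Qed.

End weighted_measure.

Section chart_integral.
Context {R : realType}.
Local Open Scope ereal_scope.
Local Notation lambda := (@lebesgue_measure R).

(* Both sides integrate [f \o k] against the Borel measure on the line that
   gives the mass [k d - k c] to ]c, d]. *)
Lemma ge0_integral_chart (a b : R) (h k k' : R -> R) (f : R -> \bar R) :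
  measurable_fun setT h ->
  (forall u, (a < k u < b)%R) -> (forall u, h (k u) = u) ->
  (forall y, (a < y < b)%R -> k (h y) = y) ->
  (forall u : R, is_derive u 1%R k (k' u)) ->
  (forall u, (0 <= k' u)%R) -> continuous k' ->
  measurable_fun setT f -> (forall y, 0 <= f y) ->
  \int[lambda]_(y in `]a, b[) f y = \int[lambda]_u (f (k u) * (k' u)%:E).
Proof.
move=> mh kab hK kK kd k'0 ck' mf f0.
have mk' : measurable_fun setT k' by exact: continuous_measurable_fun.
have ck : continuous k by exact: is_derive1_continuous kd.
have mk : measurable_fun setT k by exact: continuous_measurable_fun.
have k_le u v : (u <= v)%R -> (k u <= k v)%R.
  move=> uv; have [|c _] := @MVT_segment _ k k' u v uv (fun z _ => kd z).
    by apply: continuous_subspaceT => z; exact: ck.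
  by move/eqP; rewrite subr_eq => /eqP ->; rewrite lerDr mulr_ge0// subr_ge0.
have k_lt u v : (k u < k v)%R = (u < v)%R.
  apply/idP/idP; first by apply: contraTT; rewrite -!leNgt; exact: k_le.
  move=> uv; rewrite lt_neqAle k_le ?(ltW uv)// andbT.
  by apply: contraTneq uv => /(congr1 h); rewrite !hK => ->; rewrite ltxx.
pose mu1 : measure (measurableTypeR R) R := weighted lambda mk' k'0.
pose g : R -> R := \1_(`]a, b[%classic).
have mg : measurable_fun setT g by exact: measurable_indic.
have g0 x : (0 <= g x)%R by [].
pose W : measure (measurableTypeR R) R := weighted lambda mg g0.
have mhT : measurable_fun setT (h : measurableTypeR R -> measurableTypeR R) by exact: mh.
pose mu2 : measure (measurableTypeR R) R :=
  @measure_function_pushforward__canonical__measure_function_Measure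
    _ _ (measurableTypeR R) (measurableTypeR R) R W h mhT.
have mfk : measurable_fun setT (f \o k) by exact: measurableT_comp.
transitivity (\int[mu2]_u (f (k u))).
  rewrite /mu2 ge0_integral_pushforward// preimage_setT.
  rewrite /W integral_weighted//=; last exact: measurableT_comp.
  rewrite integral_mkcond; apply: eq_integral => y _.
  rewrite patchE /g indicE; case: ifPn => [|_]; last by rewrite mule0.
  by rewrite inE/= in_itv/= => yab; rewrite kK// mule1.
transitivity (\int[mu1]_u (f (k u))); last by rewrite /mu1 integral_weighted.
apply: eq_measure_integral => A mA _.
have mu2E (c d : R) : (c < d)%R -> mu2 `]c, d]%classic = (k d - k c)%:E.
  move=> cd; rewrite /mu2/= /pushforward /W/= /weighted integral_indic//; last first.
    by rewrite -[X in measurable X]setTI; exact: mh.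
  (* [k] is strictly increasing onto ]a, b[, with inverse [h] there, and hence carries half-open
     intervals to half-open intervals. *)
  rewrite (_ : _ `&` _ = `]k c, k d]%classic).
    by have := lebesgue_measure_itv `]k c, k d]; rewrite /= lte_fin k_lt cd -EFinB.
  apply/seteqP; split => y /=; rewrite !in_itv/=.
    by move=> [/kK ky /andP[ch hd]]; rewrite -ky k_lt ch /=; exact: k_le.
  move=> /andP[y1 y2]; have yab : (a < y < b)%R.
    have /andP[c1 _] := kab c; have /andP[_ d2] := kab d.
    by rewrite (lt_trans c1 y1) (le_lt_trans y2 d2).
  split=> //; move: y1 y2; rewrite -(kK _ yab) k_lt hK => -> /=.
  by rewrite leNgt k_lt -leNgt.
have mu1E (c d : R) : (c < d)%R -> mu1 `]c, d]%classic = (k d - k c)%:E.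
  move=> cd; rewrite /mu1/= /weighted integral_itv_obnd_cbnd; last first.
    by apply/measurable_EFinP; exact: measurable_funTS.
  rewrite (@continuous_FTC2 _ k' k)//.
  - by apply: continuous_subspaceT => x; exact: ck'.
  - split=> [x _||]; first by have [] := kd x.
      by apply: cvg_at_right_filter; exact: ck.
    by apply: cvg_at_left_filter; exact: ck.
  - by move=> x _; rewrite derive1E; have [_ ->] := kd x.
apply: (@measure_unique _ _ (measurableTypeR R) (@ocitv R)
  (fun i => `]- (i%:R : R), i%:R]%classic)%R) => //.
- exact: ocitvI.
- by move=> i; exact: is_ocitv.
- apply/seteqP; split=> // x _; exists (Num.truncn `|x|).+1 => //=.
  have := truncnS_gt `|x|; rewrite ltr_norml in_itv/= => /andP[-> /ltW ->] //.
- move=> _ [[c d] _ <-]; have [cd|dc] := ltP c d; first by rewrite mu2E// mu1E.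
  by rewrite set_itv_ge ?bnd_simp -?leNgt// !measure0.
- move=> i; have [/mu2E->|dc] := ltP (- (i%:R : R))%R i%:R; first exact: ltry.
  by rewrite set_itv_ge ?bnd_simp -?leNgt// measure0.
Qed.

End chart_integral.

Lemma measurable_invr (R : realType) : measurable_fun setT (@GRing.inv R).
Proof.
have oD : open [set x : R | x != 0].
  have -> : [set x : R | x != 0] = ~` [set 0] by apply/seteqP; split=> x /eqP.
  exact: closed_openC.
rewrite -(setUv [set (0 : R)]); apply/measurable_funU; [exact: measurable_set1| |split].
- by apply: measurableC; exact: measurable_set1.
- exact: measurable_fun_set1.
- have -> : ~` [set 0] = [set x : R | x != 0] by apply/seteqP; split=> x /eqP.
  apply: open_continuous_measurable_fun => // x; rewrite inE => x0.
  exact: inv_continuous.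
Qed.

(** * The one-dimensional flow and its Jacobian *)

Section slide.
Context {R : realType}.
Implicit Types (z e tau x : R).

Lemma measurable_chart : measurable_fun setT (@chart R).
Proof.
apply: measurable_funB.
  apply: (@measurableT_comp _ _ _ _ _ _ (@expR R)); first exact: measurable_expR.
  by apply: (@measurableT_comp _ _ _ _ _ _ (@GRing.inv R)); [exact: measurable_invr|exact: measurable_funB].
apply: (@measurableT_comp _ _ _ _ _ _ (@expR R)); first exact: measurable_expR.
by apply: (@measurableT_comp _ _ _ _ _ _ (@GRing.inv R)); [exact: measurable_invr|exact: measurable_funD].
Qed.

Lemma continuous_unchart : continuous (@unchart R).
Proof. exact: is_derive1_continuous is_derive_unchart. Qed.

Lemma continuous_chart_jac e : continuous (cst e \* (@bumpR R \o @unchart R)).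
Proof.
move=> u; apply: continuousM; first exact: cvg_cst.
exact: (continuous_comp (@continuous_unchart u) (@continuous_bump R (unchart u))).
Qed.

(* Outside ]z - e, z + e[ the value is junk: [chart] is a coordinate on ]-1, 1[
   only. *)
Definition slide z e tau x := z + e * unchart (chart ((x - z) / e) + tau).

(** The derivative of [slide] in [x] inside the interval, by the chain rule: [unchart] contributes
    the numerator and [chart] the denominator. *)
Definition slide_jac z e tau x := bumpR ((slide z e tau x - z) / e) / bumpR ((x - z) / e).

Lemma slideK z e tau x : e != 0 ->
  (slide z e tau x - z) / e = unchart (chart ((x - z) / e) + tau).
Proof. by move=> e0; rewrite /slide addrC addKr mulrC mulKf. Qed.

Lemma in_slide z e x : 0 < e ->
  (z - e < x < z + e) = (`|(x - z) / e| < 1).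
Proof.
move=> e0; rewrite normrM normfV (gtr0_norm e0) ltr_pdivrMr// mul1r ltr_norml.
by apply/idP/idP => /andP[? ?]; apply/andP; split; lra.
Qed.

Lemma measurable_slide z e : measurable_fun setT (fun p : R * R => slide z e p.1 p.2).
Proof.
apply: measurable_funD => //; apply: measurable_funM => //.
apply: (@measurableT_comp _ _ _ _ _ _ (@unchart R)).
  apply: continuous_measurable_fun; exact: continuous_unchart.
apply: measurable_funD; last exact: measurable_fst.
apply: (@measurableT_comp _ _ _ _ _ _ (@chart R)); first exact: measurable_chart.
by apply: measurable_funM => //; apply: measurable_funB => //; exact: measurable_snd.
Qed.

Lemma measurable_slide_jac z e : measurable_fun setT (fun p : R * R => slide_jac z e p.1 p.2).
Proof.
have mb : measurable_fun setT (@bumpR R) by apply: continuous_measurable_fun; exact: continuous_bump.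
apply: measurable_funM.
  apply: (@measurableT_comp _ _ _ _ _ _ (@bumpR R)) => //.
  by apply: measurable_funM => //; apply: measurable_funB => //; exact: measurable_slide.
apply: (@measurableT_comp _ _ _ _ _ _ (@GRing.inv R)); first exact: measurable_invr.
apply: (@measurableT_comp _ _ _ _ _ _ (@bumpR R)) => //.
by apply: measurable_funM => //; apply: measurable_funB => //; exact: measurable_snd.
Qed.

Lemma slide_jac_ge0 z e tau x : 0 <= slide_jac z e tau x.
Proof. by apply: divr_ge0; exact: bump_ge0. Qed.

(** Written in the chart, both integrals run over the whole line, where [slide] is the translation
    by [tau]. *)
Lemma ge0_integral_slide z e tau (f : R -> \bar R) : 0 < e ->
  measurable_fun setT f -> (forall y, 0 <= f y)%E ->
  (\int[lebesgue_measure]_(x in `](z - e)%R, (z + e)%R[) f x =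
   \int[lebesgue_measure]_(x in `](z - e)%R, (z + e)%R[)
     (f (slide z e tau x) * (slide_jac z e tau x)%:E))%E.
Proof.
move=> e0 mf f0.
have en0 : e != 0 by rewrite gt_eqF.
pose h x := chart ((x - z) / e).
pose k u := z + e * unchart u.
pose k' u := e * bumpR (unchart u).
have kz u : (k u - z) / e = unchart u by rewrite /k addrC addKr mulrC mulKf.
have mh : measurable_fun setT h.
  apply: (@measurableT_comp _ _ _ _ _ _ (@chart R)); first exact: measurable_chart.
  by apply: measurable_funM => //; exact: measurable_funB.
have kab u : z - e < k u < z + e by rewrite in_slide// kz unchart_lt1.
have hK u : h (k u) = u by rewrite /h kz unchartK.
have kK y : z - e < y < z + e -> k (h y) = y.
  by rewrite in_slide// => /chartK; rewrite /k /h => ->; rewrite mulrC divfK// addrC subrK.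
have kd (u : R) : is_derive u 1 k (k' u).
  have := is_deriveD (is_derive_cst z u 1) (is_deriveZ e (is_derive_unchart u)).
  by rewrite add0r.
have k'0 u : 0 <= k' u by rewrite mulr_ge0 ?bump_ge0// ltW.
have ck' : continuous k' by exact: continuous_chart_jac.
have chart_int := ge0_integral_chart mh kab hK kK kd k'0 ck'.
have mp : measurable_fun setT (fun x : R => (tau, x)) by exact: measurable_fun_pair.
have mslide : measurable_fun setT (slide z e tau).
  exact: (measurableT_comp (measurable_slide z e) mp).
have mjac : measurable_fun setT (slide_jac z e tau).
  exact: (measurableT_comp (measurable_slide_jac z e) mp).
have mfs : measurable_fun setT (fun x => (f (slide z e tau x) * (slide_jac z e tau x)%:E)%E).
  apply: emeasurable_funM; first exact: (measurableT_comp mf mslide).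
  exact/measurable_EFinP.
rewrite chart_int// [RHS]chart_int//; last first.
  by move=> y; rewrite mule_ge0// lee_fin slide_jac_ge0.
(* After the shift the integrands agree pointwise: [slide_jac] at [k u] times [k' u] is
   [k' (u + tau)]. *)
rewrite -(@ge0_integral_translate R tau); last 2 first.
- apply: emeasurable_funM; last by apply/measurable_EFinP; exact: continuous_measurable_fun.
  apply: measurableT_comp => //; apply: continuous_measurable_fun.
  exact: is_derive1_continuous kd.
- by move=> x; rewrite mule_ge0// lee_fin.
apply: eq_integral => u _.
rewrite /slide_jac slideK// /slide kz unchartK -/(k _) -muleA; congr (_ * _)%E.
rewrite -EFinM; congr _%:E; rewrite /k'; field.
by rewrite gt_eqF// bump_gt0// unchart_lt1.
Qed.

End slide.

Lemma is_derive_scalel (R : realType) (V : normedModType R) (v : V) (f : R -> R) (t df : R) :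
  is_derive t 1 f df -> is_derive t 1 (fun u : R => f u *: v) (df *: v).
Proof.
move=> [fd <-]; have c : h^-1 *: (f (h *: 1 + t) *: v - f t *: v) @[h --> (0 : R)^'] --> 'D_1 f t *: v.
  under eq_fun do rewrite -scalerBl scalerA.
  by apply: cvgZr_tmp; exact: fd.
by apply: DeriveDef; [apply/cvg_ex; eexists; exact: c|exact: cvg_lim].
Qed.

(** * The flow of the product bump *)

Section bump_flow.
Context {R : realType} {m : nat}.
Variables (i : 'I_m.+1) (z : 'rV[R]_m.+1) (e : R).
Hypothesis e0 : 0 < e.
Implicit Types (x : 'rV[R]_m.+1) (t : R).

Definition box : set 'rV[R]_m.+1 := rect (fun j => `](z 0 j - e), (z 0 j + e)[%classic).

Definition rho x : R := \prod_(j < m.+1) bumpR ((x 0 j - z 0 j) / e).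

Definition rho_other x : R :=
  \prod_(k < m) bumpR ((x 0 (lift i k) - z 0 (lift i k)) / e).

(** In the rescaled variable y = (x_i - z_i)/e the equation x_i' = rho reads y' = [bumpR] y times
    [rho_other]/e. The factor [rho_other] is constant along the motion, so time [t] becomes
    [t * rho_other x / e]. The indicator removes the junk values of [slide] outside the box. *)
Definition bump_flow t x : 'rV[R]_m.+1 :=
  x + (\1_box x * (slide (z 0 i) e (t * rho_other x / e) (x 0 i) - x 0 i)) *: delta_mx 0 i.

Definition bump_flow_jac t x : R := slide_jac (z 0 i) e (t * rho_other x / e) (x 0 i).

Lemma boxP x : box x <-> forall j, `|(x 0 j - z 0 j) / e| < 1.
Proof.
by split=> h j; have := h j; rewrite /= in_itv/= in_slide.
Qed.

Lemma measurable_box : measurable (box : set (borelRn R m.+1)).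
Proof. by apply: measurable_rect => j; exact: measurable_itv. Qed.

Lemma rhoE x : rho x = bumpR ((x 0 i - z 0 i) / e) * rho_other x.
Proof. by rewrite /rho (bigD1_ord i). Qed.

Lemma rho_ge0 x : 0 <= rho x.
Proof. by rewrite prodr_ge0// => j _; exact: bump_ge0. Qed.

Lemma rho_le1 x : rho x <= 1.
Proof. by rewrite prodr_ile1// => j _; rewrite bump_ge0 bump_le1. Qed.

Lemma rho_other_ge0 x : 0 <= rho_other x.
Proof. by rewrite prodr_ge0// => j _; exact: bump_ge0. Qed.

Lemma rho_other_le1 x : rho_other x <= 1.
Proof. by rewrite prodr_ile1// => j _; rewrite bump_ge0 bump_le1. Qed.

Lemma rho_out x : ~ box x -> rho x = 0.
Proof.
move=> /boxP /existsNP[j /negP]; rewrite -leNgt => xj.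
by rewrite /rho (bigD1 j)//= bump_eq0// mul0r.
Qed.

Lemma bump_flow_out t x : ~ box x -> bump_flow t x = x.
Proof. by move=> xB; rewrite /bump_flow indicE memNset// mul0r scale0r addr0. Qed.

Lemma bump_flow_in t x : box x ->
  bump_flow t x = ins i (slide (z 0 i) e (t * rho_other x / e) (x 0 i)) (col' i x).
Proof.
move=> xB; apply/rowP => j; rewrite /bump_flow indicE mem_set// mul1r !mxE eqxx/=.
case: unliftP => [k|] ->; first by rewrite eq_sym (negbTE (neq_lift _ _)) mulr0 addr0 !mxE.
by rewrite eqxx mulr1 addrC subrK.
Qed.

Lemma rho_other_ins u (v : 'rV[R]_m) x : col' i x = v -> rho_other (ins i u v) = rho_other x.
Proof.
by move=> <-; apply: eq_bigr => k _; rewrite ins_lift mxE.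
Qed.

Lemma box_ins u (v : 'rV[R]_m) :
  box (ins i u v) <-> `](z 0 i - e), (z 0 i + e)[%classic u /\
     rect (fun k => `](z 0 (lift i k) - e), (z 0 (lift i k) + e)[%classic) v.
Proof.
split=> [h|[hu hv] j].
  split; first by have := h i; rewrite ins_id.
  by move=> k; have := h (lift i k); rewrite ins_lift.
by case: (unliftP i j) => [k|] ->; rewrite ?ins_id// ins_lift; exact: hv.
Qed.

Lemma bump_flow_box t x : box x -> box (bump_flow t x).
Proof.
move=> xB; rewrite bump_flow_in//; apply/box_ins.
split; last by move=> k; rewrite mxE; exact: xB.
by rewrite /= in_itv/= in_slide// slideK ?unchart_lt1// gt_eqF.
Qed.

Lemma bump_flowD s t x : bump_flow s (bump_flow t x) = bump_flow (s + t) x.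
Proof.
have [xB|xB] := pselect (box x); last by rewrite !(bump_flow_out _ xB).
rewrite (bump_flow_in _ (bump_flow_box t xB)) !(bump_flow_in _ xB) col'_ins ins_id.
rewrite (@rho_other_ins _ _ x)//; congr ins.
rewrite {1 3}/slide slideK ?gt_eqF// unchartK; congr (_ + _ * unchart _).
by rewrite -addrA; congr (_ + _); rewrite addrC -mulrDl -mulrDl addrC.
Qed.

Lemma bump_flow0 x : bump_flow 0 x = x.
Proof.
have [xB|xB] := pselect (box x); last by rewrite !(bump_flow_out _ xB).
rewrite bump_flow_in// !mul0r -[RHS](insK i); congr ins.
rewrite /slide addr0 chartK; last by move/boxP : xB; exact.
by rewrite mulrC divfK ?gt_eqF// addrC subrK.
Qed.

Lemma bump_flowNK t x : bump_flow (- t) (bump_flow t x) = x.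
Proof. by rewrite bump_flowD addNr bump_flow0. Qed.

(** By the group law; images become preimages, for which measurability and set operations are
    immediate. *)
Lemma bump_flow_image t (E : set 'rV[R]_m.+1) :
  bump_flow t @` E = bump_flow (- t) @^-1` E.
Proof.
apply/seteqP; split=> [_ [x Ex <-]|x Ex]/=; first by rewrite bump_flowNK.
by exists (bump_flow (- t) x) => //; rewrite -{1}(opprK t) bump_flowNK.
Qed.

Lemma measurable_rho_other : measurable_fun setT (rho_other : borelRn R m.+1 -> R).
Proof.
apply: measurable_prod => k _.
apply: (@measurableT_comp _ _ _ _ _ _ (@bumpR R)).
  by apply: continuous_measurable_fun; exact: continuous_bump.
by apply: measurable_funM => //; apply: measurable_funB => //; exact: measurable_coord.
Qed.

Lemma measurable_rho : measurable_fun setT (rho : borelRn R m.+1 -> R).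
Proof.
apply: measurable_prod => k _.
apply: (@measurableT_comp _ _ _ _ _ _ (@bumpR R)).
  by apply: continuous_measurable_fun; exact: continuous_bump.
by apply: measurable_funM => //; apply: measurable_funB => //; exact: measurable_coord.
Qed.

Let measurable_arg t : measurable_fun setT
  (fun x : borelRn R m.+1 => (t * rho_other x / e, (x : 'rV_m.+1) 0 i)).
Proof.
apply: measurable_fun_pair; last exact: measurable_coord.
by apply: measurable_funM => //; apply: measurable_funM => //; exact: measurable_rho_other.
Qed.

Lemma measurable_bump_flow_jac t :
  measurable_fun setT (bump_flow_jac t : borelRn R m.+1 -> R).
Proof. exact: (measurableT_comp (measurable_slide_jac _ _) (measurable_arg t)). Qed.

Lemma measurable_bump_flow t :
  measurable_fun setT (bump_flow t : borelRn R m.+1 -> borelRn R m.+1).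
Proof.
apply: measurable_rV => j.
rewrite (_ : (fun _ => _) = (fun x : borelRn R m.+1 => (x : 'rV_m.+1) 0 j +
  (\1_box x * (slide (z 0 i) e (t * rho_other x / e) ((x : 'rV_m.+1) 0 i)
    - (x : 'rV_m.+1) 0 i)) * (i == j)%:R)); last first.
  by apply/funext => x; rewrite !mxE eqxx/= eq_sym.
apply: measurable_funD; first exact: measurable_coord.
apply: measurable_funM => //; apply: measurable_funM.
  by apply: measurable_indic; exact: measurable_box.
apply: measurable_funB; last exact: measurable_coord.
exact: (measurableT_comp (measurable_slide _ _) (measurable_arg t)).
Qed.

Lemma bump_flow_jac_ge0 t x : 0 <= bump_flow_jac t x.
Proof. exact: slide_jac_ge0. Qed.

(** Fubini along coordinate [i]: on each line the flow is a [slide] whose time depends only on the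
    other coordinates. *)
Lemma ge0_integral_bump_flow t (f : borelRn R m.+1 -> \bar R) :
  measurable_fun setT f -> (forall x, 0 <= f x)%E ->
  (\int[volm]_(x in box) f x =
   \int[volm]_(x in box) (f (bump_flow t x) * (bump_flow_jac t x)%:E))%E.
Proof.
move=> mf f0.
have mF : measurable_fun setT (fun x : borelRn R m.+1 => f (bump_flow t x) * (bump_flow_jac t x)%:E)%E.
  apply: emeasurable_funM; last by apply/measurable_EFinP; exact: measurable_bump_flow_jac.
  exact: (measurableT_comp mf (measurable_bump_flow t)).
have F0 x : (0 <= f (bump_flow t x) * (bump_flow_jac t x)%:E)%E.
  by rewrite mule_ge0// lee_fin bump_flow_jac_ge0.
have mB := measurable_box.
rewrite integral_mkcond [RHS]integral_mkcond.
have red (g : borelRn R m.+1 -> \bar R) : measurable_fun setT g -> (forall x, 0 <= g x)%E ->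
   (\int[volm]_x (g \_ box) x = \int[volm]_v (
     (fun v => \int[lebesgue_measure]_(u in `](z 0%R i - e)%R, (z 0%R i + e)%R[) g (ins i u v)) \_
      (rect (fun k => `](z 0%R (lift i k) - e)%R, (z 0%R (lift i k) + e)%R[%classic))) v)%E.
  move=> mg g0; rewrite (ge0_integral_volm_ins i); last 2 first.
  - exact/(measurable_restrictT _ _).1/measurable_funTS.
  - by move=> x; rewrite patchE; case: ifP.
  apply: eq_integral => v _; rewrite patchE; case: ifPn => [|]; rewrite ?inE ?notin_setE => vB.
    rewrite [RHS]integral_mkcond; apply: eq_integral => u _; rewrite !patchE.
    congr (if _ then _ else _); apply/idP/idP; rewrite !inE.
      by move=> /box_ins[].
    by move=> uB; apply/box_ins.
  rewrite integral0_eq// => u _; rewrite patchE ifF//.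
  by apply/negbTE; rewrite notin_setE => /box_ins[].
rewrite (red _ mf f0) (red _ mF F0); apply: eq_integral => v _; rewrite !patchE.
case: ifPn => //; rewrite inE => vB.
(* The inserted 0 is a placeholder: [rho_other] does not see coordinate [i]. *)
pose tau := t * rho_other (ins i 0 v) / e.
have mp : measurable_fun setT (fun u : measurableTypeR R => (u, v : borelRn R m)).
  exact: measurable_fun_pair.
have mfv : measurable_fun setT (fun u : R => f (ins i u v)).
  exact: (measurableT_comp mf (measurableT_comp (measurable_ins i) mp)).
rewrite (@ge0_integral_slide R (z 0 i) e tau (fun u => f (ins i u v)) e0 mfv (fun=> f0 _)).
apply: eq_integral => u; rewrite inE/= => uB.
have insB : box (ins i u v) by apply/box_ins.
rewrite bump_flow_in// col'_ins ins_id /bump_flow_jac ins_id.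
by rewrite (@rho_other_ins u v (ins i 0 v)) ?col'_ins.
Qed.

Lemma bump_flow_is_flow : is_flow (fun x => rho x *: delta_mx 0 i) bump_flow.
Proof.
split; first exact: bump_flow0.
move=> t x; have [xB|xB] := pselect (box x); last first.
  rewrite (bump_flow_out _ xB) rho_out// scale0r (_ : bump_flow^~ x = cst x).
    exact: is_derive_cst.
  by apply/funext => u; exact: bump_flow_out.
have D : is_derive t 1 (fun t : R => slide (z 0 i) e (t * rho_other x / e) (x 0 i))
    (rho (bump_flow t x)).
  have D1 := is_deriveD (is_derive_cst (chart ((x 0 i - z 0 i) / e)) t 1)
    (is_deriveZ (rho_other x / e) (is_derive_id t 1)).
  have D2 := @is_derive1_comp _ (@unchart R) _ t _ _ (is_derive_unchart _) D1.
  have := is_deriveD (is_derive_cst (z 0 i) t 1) (is_deriveZ e D2).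
  rewrite (bump_flow_in _ xB) rhoE ins_id slideK ?gt_eqF// (@rho_other_ins _ _ x)//.
  have aE (u : R) : (rho_other x / e) *: u = u * rho_other x / e.
    by rewrite /GRing.scale /= mulrC mulrA.
  rewrite /cst !add0r => D3; apply: is_derive_eq.
    rewrite (_ : (fun _ => _) = (cst (z 0 i) + e *: (@unchart R \o
      (cst (chart ((x 0 i - z 0 i) / e)) + (rho_other x / e) *: id))) :> (R -> R)).
      exact: D3.
    by apply/funext => u; rewrite /slide /= -aE.
  rewrite /= -[(_ + _) t]/(chart ((x 0 i - z 0 i) / e) + (rho_other x / e) *: t) aE.
  by rewrite /GRing.scale /= mulr1 mulrCA [e * _]mulrC divfK ?gt_eqF.
have := is_derive_scalel (delta_mx 0 i : 'rV[R]_m.+1) (is_deriveB D (is_derive_cst (x 0 i) t 1)).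
move=> /(is_deriveD (is_derive_cst x t 1)); rewrite add0r subr0.
rewrite (_ : _ + _ = bump_flow^~ x)//.
by apply/funext => u; rewrite /bump_flow indicE mem_set// mul1r.
Qed.

End bump_flow.

(** * Expansion of the Jacobian in time *)

Section mean_value.
Context {R : realType}.

Lemma MVT_between (f df : R -> R) (a b : R) :
  (forall x : R, is_derive x 1 f (df x)) ->
  exists2 c, `|c - a| <= `|b - a| & f b - f a = df c * (b - a).
Proof.
move=> fd; have cf : continuous f by exact: is_derive1_continuous fd.
have [ab|/ltW ba] := leP a b.
  have [|c] := @MVT_segment _ f df a b ab (fun z _ => fd z).
    by apply: continuous_subspaceT => z; exact: cf.
  rewrite in_itv/= => /andP[ac cb] e; exists c => //.
  by rewrite !ger0_norm ?subr_ge0// lerD2r.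
have [|c] := @MVT_segment _ f df b a ba (fun z _ => fd z).
  by apply: continuous_subspaceT => z; exact: cf.
rewrite in_itv/= => /andP[bc ca] e; exists c.
  by rewrite [`|c - a|]distrC [`|b - a|]distrC !ger0_norm ?subr_ge0// lerD2l lerN2.
by rewrite -opprB e -mulrN opprB.
Qed.

Lemma expR_quadratic (q : R) : `|expR q - 1 - q| <= q ^+ 2 * expR `|q|.
Proof.
have [c cq eq1] := MVT_between 0 q (@is_derive_expR R).
have [d dc eq2] := MVT_between 0 c (@is_derive_expR R).
rewrite !subr0 expR0 in cq eq1 dc eq2.
have -> : expR q - 1 - q = q * (expR c - 1) by rewrite eq1; ring.
rewrite eq2 !normrM -real_normK ?num_real// expr2 -!mulrA ler_wpM2l//.
rewrite mulrC; apply: ler_pM => //; rewrite ger0_norm ?expR_ge0//.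
by rewrite ler_expR (le_trans (ler_norm _))// (le_trans dc).
Qed.

End mean_value.

Section jacobian.
Context {R : realType}.

Lemma slide1_bound (y tau : R) : `|y| < 1 -> `|unchart (chart y + tau) - y| <= `|tau|.
Proof.
move=> y1; have kd (u : R) : is_derive u 1 (fun u => unchart (chart y + u)) (bumpR (unchart (chart y + u))).
  have D1 := is_deriveD (is_derive_cst (chart y) u 1) (is_derive_id u 1).
  have := @is_derive1_comp _ (@unchart R) _ u _ _ (is_derive_unchart _) D1.
  by rewrite add0r mulr1.
have [c _] := MVT_between 0 tau kd.
rewrite addr0 chartK// subr0 => ->; rewrite normrM ler_piMl//.
by rewrite ger0_norm ?bump_ge0// bump_le1.
Qed.

(** Along the flow the logarithm of the Jacobian has derivative [bumpR'], so by the mean value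
    theorem the Jacobian is exp(q) with q = [bumpR'] at an intermediate point times [tau]. *)
Lemma jac_bound : exists2 C : R, 0 < C & forall y tau : R, `|y| < 1 -> `|tau| <= 1 ->
  `|bumpR (unchart (chart y + tau)) / bumpR y - 1 - tau * bumpR' y| <= C * tau ^+ 2.
Proof.
have [M [M0 Mb Ml]] := @bumpR'_bounds R.
(* The first summand bounds exp(q) - 1 - q, where |q| is at most M |tau|; the second bounds the
   error of replacing the intermediate point by [y]. *)
exists (M ^+ 2 * expR M + M) => [|y tau y1 t1].
  by rewrite addr_gt0// mulr_gt0 ?expR_gt0// exprn_gt0.
pose g (u : R) := unchart (chart y + u).
have g1 u : `|g u| < 1 by exact: unchart_lt1.
have bg u : 0 < bumpR (g u) by rewrite bump_gt0.
have gd (u : R) : is_derive u 1 g (bumpR (g u)).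
  have D1 := is_deriveD (is_derive_cst (chart y) u 1) (is_derive_id u 1).
  have := @is_derive1_comp _ (@unchart R) _ u _ _ (is_derive_unchart _) D1.
  by rewrite add0r mulr1.
have ld (u : R) : is_derive u 1 (fun u => ln (bumpR (g u))) (bumpR' (g u)).
  have D1 := @is_derive1_comp _ (@bumpR R) g u _ _ (is_derive_bump _) (gd u).
  have := @is_derive1_comp _ (@ln R) (fun u => bumpR (g u)) u _ _ (is_derive1_ln (bg u)) D1.
  by rewrite mulrC mulfK// gt_eqF.
have [c] := MVT_between 0 tau ld.
have g0 : g 0 = y by rewrite /g addr0 chartK.
rewrite !subr0 g0 => ct lnE.
have by0 : 0 < bumpR y by rewrite -g0.
have -> : bumpR (unchart (chart y + tau)) / bumpR y = expR (bumpR' (g c) * tau).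
  by rewrite -lnE -/(g tau) expRB !lnK ?posrE.
set q := bumpR' (g c) * tau.
have qM : `|q| <= M * `|tau| by rewrite normrM ler_wpM2r// Mb// ltW.
have gcy : `|g c - y| <= `|tau| by rewrite (le_trans (slide1_bound _ y1)).
have -> : expR q - 1 - tau * bumpR' y = (expR q - 1 - q) + tau * (bumpR' (g c) - bumpR' y).
  by rewrite /q; ring.
rewrite (le_trans (ler_normD _ _))// mulrDl lerD//.
  rewrite (le_trans (expR_quadratic _))// [leRHS]mulrAC; apply: ler_pM.
  - exact: sqr_ge0.
  - exact: expR_ge0.
  - rewrite -exprMn -real_normK ?num_real// -[leRHS]real_normK ?num_real// lerXn2r ?nnegrE//.
    by rewrite [leRHS]normrM (gtr0_norm M0).
  - by rewrite ler_expR (le_trans qM)// ler_piMr// ltW.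
rewrite normrM -[tau ^+ 2]real_normK ?num_real// expr2 mulrA [M * _]mulrC -mulrA ler_wpM2l//.
by rewrite (le_trans (Ml _ _ (ltW (g1 c)) (ltW y1)))// ler_wpM2l// ltW.
Qed.

End jacobian.

Section bump_flow_estimates.
Context {R : realType} {m : nat}.
Variables (i : 'I_m.+1) (z : 'rV[R]_m.+1) (e : R).
Hypothesis e0 : 0 < e.
Implicit Types (x : 'rV[R]_m.+1) (t : R).

(** The partial derivative of [rho] along [i], which is the divergence of the field rho e_i. *)
Definition d_rho x : R := bumpR' ((x 0 i - z 0 i) / e) * rho_other i z e x / e.

Let rho_other_arg t x : `|t * rho_other i z e x / e| <= `|t| / e.
Proof.
rewrite normrM normfV (gtr0_norm e0) ler_wpM2r ?invr_ge0 ?(ltW e0)//.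
by rewrite normrM ler_piMr// ger0_norm ?rho_other_ge0 ?rho_other_le1.
Qed.

Lemma bump_flow_dist t x j : `|bump_flow i z e t x 0 j - x 0 j| <= `|t|.
Proof.
have [xB|xB] := pselect (box z e x); last first.
  by rewrite (bump_flow_out _ _ xB) subrr normr0.
rewrite (bump_flow_in _ _ xB); case: (unliftP i j) => [k|] ->.
  by rewrite ins_lift mxE subrr normr0.
rewrite ins_id /slide.
have -> : z 0 i + e * unchart (chart ((x 0 i - z 0 i) / e) + t * rho_other i z e x / e) - x 0 i =
  e * (unchart (chart ((x 0 i - z 0 i) / e) + t * rho_other i z e x / e) - (x 0 i - z 0 i) / e).
  by field; rewrite gt_eqF.
rewrite normrM (gtr0_norm e0) -ler_pdivlMl// [leRHS]mulrC.
by apply: le_trans (rho_other_arg t x); apply: slide1_bound; move/(boxP _ e0) : xB; exact.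
Qed.

(** The constant is that of the unit interval: all dependence on the scale sits in t/e. *)
Lemma bump_flow_jac_bound : exists2 C : R, 0 < C & forall t x, box z e x -> `|t| <= e ->
  `|bump_flow_jac i z e t x - 1 - t * d_rho x| <= C * (t / e) ^+ 2.
Proof.
have [C C0 CP] := @jac_bound R; exists C => // t x xB te.
have y1 : `|(x 0 i - z 0 i) / e| < 1 by move/(boxP _ e0) : xB; exact.
have t1 : `|t| / e <= 1 by rewrite ler_pdivrMr// mul1r.
have := CP _ _ y1 (le_trans (rho_other_arg t x) t1).
rewrite /bump_flow_jac /slide_jac slideK ?gt_eqF//.
have -> : t * d_rho x = t * rho_other i z e x / e * bumpR' ((x 0 i - z 0 i) / e).
  by rewrite /d_rho; ring.
move=> /le_trans; apply; rewrite ler_wpM2l ?(ltW C0)//.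
rewrite -real_normK ?num_real// -[leRHS]real_normK ?num_real// lerXn2r ?nnegrE//.
by rewrite (le_trans (rho_other_arg _ _))// normrM normfV (gtr0_norm e0).
Qed.

Lemma d_rho_bound (M : R) : (forall y : R, `|y| <= 1 -> `|bumpR' y| <= M) ->
  forall x, box z e x -> `|d_rho x| <= M / e.
Proof.
move=> Mb x xB; rewrite /d_rho normrM normfV (gtr0_norm e0) ler_wpM2r ?invr_ge0 ?(ltW e0)//.
rewrite normrM (ger0_norm (rho_other_ge0 _ _ _ _)).
apply: (@le_trans _ _ `|bumpR' ((x 0 i - z 0 i) / e)|).
  by rewrite ler_piMr// rho_other_le1.
by apply: Mb; rewrite ltW//; move/(boxP _ e0) : xB; exact.
Qed.

Lemma measurable_d_rho : measurable_fun setT (d_rho : borelRn R m.+1 -> R).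
Proof.
apply: measurable_funM => //; apply: measurable_funM; last exact: measurable_rho_other.
apply: (@measurableT_comp _ _ _ _ _ _ (@bumpR' R)).
  apply: continuous_measurable_fun.
  have [g gd [g' g'd _]] := @iter_derivable_bump R 2.
  rewrite (_ : bumpR' = g); first exact: is_derive1_continuous g'd.
  by apply/funext => x; have [_ <-] := gd x.
by apply: measurable_funM => //; apply: measurable_funB => //; exact: measurable_coord.
Qed.

End bump_flow_estimates.

(** * Integrals over a moving set, to first order in time *)

Section bounded_integrals.
Context {R : realType} {n : nat}.

Lemma integrable_bounded (D : set (borelRn R n)) (f : borelRn R n -> R) (K : R) :
  measurable D -> (volm D < +oo)%E -> measurable_fun setT f ->
  (forall x, D x -> `|f x| <= K) -> (volm).-integrable D (EFin \o f).
Proof.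
move=> mD Doo mf fK; apply: measurable_bounded_integrable => //.
  exact: measurable_funTS.
by exists K; split; [exact: num_real|move=> M KM x Dx; exact: le_trans (fK _ Dx) (ltW KM)].
Qed.

Lemma Rintegral_bound (D D' : set (borelRn R n)) (f : borelRn R n -> R) (K : R) :
  measurable D -> measurable D' -> D `<=` D' -> (volm D' < +oo)%E -> measurable_fun setT f ->
  0 <= K -> (forall x, D x -> `|f x| <= K) ->
  `|\int[volm]_(x in D) f x| <= K * fine (volm D').
Proof.
move=> mD mD' DD' D'oo mf K0 fK.
have Doo : (volm D < +oo)%E.
  by apply: le_lt_trans D'oo; apply: le_measure; rewrite ?inE.
have If := integrable_bounded mD Doo mf fK.
apply: le_trans (le_normr_Rintegral mD If) _.
apply: (@le_trans _ _ (\int[volm]_(x in D) K)).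
  apply: le_Rintegral => //.
  - by apply: (@integrable_bounded _ _ K) => // [|x Dx]; [exact: measurableT_comp|rewrite normr_id fK].
  - by apply: (@integrable_bounded _ _ K) => // x Dx; rewrite ger0_norm.
rewrite Rintegral_cst// ler_wpM2l// fine_le// ?ge0_fin_numE//.
by apply: le_measure; rewrite ?inE.
Qed.

End bounded_integrals.

Section flow_integral.
Context {R : realType} {m : nat}.
Variables (i : 'I_m.+1) (z : 'rV[R]_m.+1) (e : R).
Hypothesis e0 : 0 < e.

Lemma volm_box : volm (box z e : set (borelRn R m.+1)) = ((e *+ 2) ^+ m.+1)%:E.
Proof.
rewrite volm_rect => [|j]; last exact: measurable_itv.
rewrite (eq_bigr (fun _ => (e *+ 2)%:E)) => [|j _].
  by rewrite prodEFin prodr_const card_ord.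
rewrite lebesgue_measure_itv/= lte_fin ifT; last by rewrite ltrD2l gtrN.
by rewrite -EFinB; congr _%:E; ring.
Qed.

Lemma volm_box_fin : (volm (box z e : set (borelRn R m.+1)) < +oo)%E.
Proof. by rewrite volm_box ltry. Qed.

Definition flow_int (A : set (borelRn R m.+1)) (f : borelRn R m.+1 -> R) (t : R) : R :=
  \int[volm]_(x in box z e `&` bump_flow i z e t @` A) f x.

Lemma measurable_flow_image t (A : set (borelRn R m.+1)) : measurable A ->
  measurable (bump_flow i z e t @` A : set (borelRn R m.+1)).
Proof.
move=> mA; rewrite bump_flow_image// -[X in measurable X]setTI.
exact: (measurable_bump_flow i z e (- t)).
Qed.

Lemma flow_int_change (A : set (borelRn R m.+1)) (f : borelRn R m.+1 -> R) t :
  measurable A -> measurable_fun setT f -> (forall x, 0 <= f x) ->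
  flow_int A f t =
  \int[volm]_(x in box z e `&` A) (f (bump_flow i z e t x) * bump_flow_jac i z e t x).
Proof.
move=> mA mf f0; rewrite /flow_int /Rintegral; congr fine.
have mA' := measurable_flow_image t mA.
rewrite integral_mkcondr [RHS]integral_mkcondr.
have mfE : measurable_fun setT (EFin \o f) by exact/measurable_EFinP.
rewrite (ge0_integral_bump_flow i z e0 t); last 2 first.
- by apply/(measurable_restrictT _ mA'); exact: measurable_funTS.
- by move=> x; rewrite patchE; case: ifP => // _; rewrite lee_fin.
apply: eq_integral => x _; rewrite !patchE.
have -> : (bump_flow i z e t x \in bump_flow i z e t @` A) = (x \in A).
  apply/idP/idP; rewrite !inE; last by move=> Ax; exists x.
  by rewrite bump_flow_image// /= bump_flowNK.
by case: ifP; rewrite ?mul0e// EFinM.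
Qed.

(** [f] is never differentiated: its Lipschitz bound leaves an error [L * |t|] of first order, with
    [L] under control as e tends to 0. The constant [C] may depend on [e], because t tends to 0
    first. *)
Lemma flow_int_estimate (A : set (borelRn R m.+1)) (f : borelRn R m.+1 -> R) (K L : R) :
  measurable A -> measurable_fun setT f -> (forall x, 0 <= f x) ->
  0 <= K -> 0 <= L ->
  (forall x, box z e x -> f x <= K) ->
  (forall t x, box z e x -> `|f (bump_flow i z e t x) - f x| <= L * `|t|) ->
  exists2 C : R, 0 <= C & forall t : R, `|t| <= e ->
  `|flow_int A f t - flow_int A f 0 - t * \int[volm]_(x in box z e `&` A) (f x * d_rho i z e x)|
    <= (L * `|t| + C * t ^+ 2) * fine (volm (box z e : set (borelRn R m.+1))).
Proof.
move=> mA mf f0 K0 L0 fK fL.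
have [C C0 CP] : exists2 C : R, 0 < C & forall t x, box z e x -> `|t| <= e ->
    `|bump_flow_jac i z e t x - 1 - t * d_rho i z e x| <= C * (t / e) ^+ 2.
  exact: bump_flow_jac_bound.
have [M [M0 Mb _]] := @bumpR'_bounds R.
have dM x : box z e x -> `|d_rho i z e x| <= M / e by exact: d_rho_bound.
(* A Lipschitz bound for the Jacobian in time: (t/e)^2 is at most |t|/e for |t| <= e. *)
pose N := M / e + C / e.
exists (L * N + K * (C / e ^+ 2)) => [|t te].
  have N0 : 0 <= N by apply: addr_ge0; apply: divr_ge0; exact: ltW.
  apply: addr_ge0; apply: mulr_ge0 => //.
  by apply: divr_ge0; [exact: ltW|exact: sqr_ge0].
rewrite !flow_int_change//.
set D := box z e `&` A.
have mB := @measurable_box R m z e.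
have mD : measurable (D : set (borelRn R m.+1)) by exact: measurableI.
have Doo : (volm (D : set (borelRn R m.+1)) < +oo)%E.
  by apply: le_lt_trans volm_box_fin; apply: le_measure; rewrite ?inE//; exact: subIsetl.
have mjac := measurable_bump_flow_jac i z e t.
have md := measurable_d_rho i z e.
have mft : measurable_fun setT (fun x : borelRn R m.+1 => f (bump_flow i z e t x)).
  exact: (measurableT_comp mf (measurable_bump_flow i z e t)).
have e0' : e != 0 by rewrite gt_eqF.
have t2 : (t / e) ^+ 2 <= `|t| / e.
  rewrite -real_normK ?num_real// normrM normfV (gtr0_norm e0) expr2 ler_piMr//.
    by rewrite divr_ge0// ltW.
  by rewrite ler_pdivrMr// mul1r.
have jac1 x : box z e x -> `|bump_flow_jac i z e t x - 1| <= `|t| * N.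
  move=> xB; rewrite -[_ - 1](subrK (t * d_rho i z e x)) (le_trans (ler_normD _ _))//.
  rewrite addrC /N mulrDr lerD//; first by rewrite normrM ler_wpM2l// dM.
  by apply: le_trans (CP t x xB te) _; rewrite [leRHS]mulrCA ler_wpM2l ?(ltW C0).
have pw x : D x -> `|f (bump_flow i z e t x) * bump_flow_jac i z e t x - f x - t * (f x * d_rho i z e x)|
    <= L * `|t| + (L * N + K * (C / e ^+ 2)) * t ^+ 2.
  move=> [xB _].
  (* The product expands as a + a b + f c: of size L |t|, of second order, and of second order by
     the expansion of the Jacobian. *)
  pose a := f (bump_flow i z e t x) - f x.
  pose b := bump_flow_jac i z e t x - 1.
  pose c := bump_flow_jac i z e t x - 1 - t * d_rho i z e x.
  have -> : f (bump_flow i z e t x) * bump_flow_jac i z e t x - f x -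
    t * (f x * d_rho i z e x) = a + a * b + f x * c by rewrite /a /b /c; ring.
  have ha : `|a| <= L * `|t| by exact: fL.
  have hab : `|a * b| <= L * N * t ^+ 2.
    rewrite normrM -[t ^+ 2]real_normK ?num_real//.
    have -> : L * N * `|t| ^+ 2 = L * `|t| * (`|t| * N) by ring.
    by apply: ler_pM => //; exact: jac1.
  have hc : `|f x * c| <= K * (C / e ^+ 2) * t ^+ 2.
    rewrite normrM (ger0_norm (f0 _)) -mulrA; apply: ler_pM => //; first exact: fK.
    apply: le_trans (CP t x xB te) _.
    by rewrite le_eqVlt; apply/orP; left; apply/eqP; field.
  rewrite [(L * N + _) * _]mulrDl [leRHS]addrA; apply: le_trans (ler_normD _ _) _; apply: lerD => //.
  by apply: le_trans (ler_normD _ _) _; apply: lerD.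
have I0 : (volm).-integrable D (EFin \o f).
  by apply: (@integrable_bounded _ _ _ _ K) => // x [xB _]; rewrite ger0_norm ?fK.
have Id : (volm).-integrable D (EFin \o (fun x => f x * d_rho i z e x)).
  apply: (@integrable_bounded _ _ _ _ (K * (M / e))) => //; first exact: measurable_funM.
  by move=> x [xB _]; rewrite normrM ler_pM// ?dM// ger0_norm ?fK.
have It : (volm).-integrable D (EFin \o (fun x => f (bump_flow i z e t x) * bump_flow_jac i z e t x)).
  apply: (@integrable_bounded _ _ _ _ (K * (1 + e * N))) => //; first exact: measurable_funM.
  move=> x [xB _]; rewrite normrM ler_pM//.
    by rewrite ger0_norm ?fK//; exact: bump_flow_box.
  rewrite -[bump_flow_jac _ _ _ _ _](subrK 1) addrC (le_trans (ler_normD _ _))// normr1 lerD2l.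
  rewrite (le_trans (jac1 _ xB))// ler_wpM2r// /N.
  by rewrite addr_ge0 ?divr_ge0// ltW.
have -> : \int[volm]_(x in D) (f (bump_flow i z e 0 x) * bump_flow_jac i z e 0 x) =
          \int[volm]_(x in D) f x.
  apply: eq_Rintegral => x; rewrite inE => -[xB _]; rewrite bump_flow0//.
  have := CP 0 x xB; rewrite normr0 mul0r subr0 mul0r expr0n/= mulr0 normr_le0 => /(_ (ltW e0)).
  by rewrite subr_eq0 => /eqP ->; rewrite mulr1.
rewrite -RintegralB// -RintegralZl// -RintegralB//; last 2 first.
- exact: (integrableB mD It I0).
- exact: (integrableZl mD t Id).
apply: Rintegral_bound => //; first exact: subIsetl.
- exact: volm_box_fin.
- apply: measurable_funB; last by apply: measurable_funM => //; exact: measurable_funM.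
  by apply: measurable_funB => //; exact: measurable_funM.
- apply: addr_ge0; first exact: mulr_ge0.
  apply: mulr_ge0; last exact: sqr_ge0.
  apply: addr_ge0; apply: mulr_ge0 => //.
    by apply: addr_ge0; apply: divr_ge0; exact: ltW.
  by apply: divr_ge0; [exact: ltW|exact: sqr_ge0].
Qed.

(* The flow preserves the volume of the box. *)
Lemma Rintegral_d_rho0 : \int[volm]_(x in box z e) d_rho i z e x = 0.
Proof.
(* For the constant function L = 0 and the flow integral is constant in t, hence t times the
   integral is O(t^2). *)
have [|||||||C C0 CP] := @flow_int_estimate setT (cst 1) 1 0 => //.
  by move=> t x _; rewrite subrr normr0 mul0r.
have fE t : flow_int setT (cst 1) t = \int[volm]_(x in box z e) 1.
  by rewrite /flow_int bump_flow_image// preimage_setT setIT.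
set v := fine _ in CP; have v0 : 0 <= v by exact: fine_ge0.
set d := \int[volm]_(x in _) _.
have dE t : `|t| <= e -> `|t * d| <= C * v * t ^+ 2.
  move=> /CP; rewrite !fE subrr sub0r normrN mul0r add0r setIT.
  rewrite (_ : \int[volm]_(x in _) _ = d); first by rewrite mulrAC.
  by apply: eq_Rintegral => x _; rewrite mul1r.
apply/eqP; rewrite -normr_le0; apply/ler_addgt0Pl => r r0; rewrite addr0.
pose t := Num.min e (r / (C * v + 1)).
have t0 : 0 < t by rewrite lt_min e0 divr_gt0// ltr_wpDl// mulr_ge0.
have te : `|t| <= e by rewrite gtr0_norm// ge_min lexx.
have := dE t te; rewrite normrM (gtr0_norm t0) expr2 mulrCA ler_pM2l//.
move=> /le_trans; apply; apply: (@le_trans _ _ ((C * v + 1) * t)).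
  by rewrite ler_wpM2r ?(ltW t0)// lerDl.
rewrite mulrC -ler_pdivlMr ?ltr_wpDl ?mulr_ge0//.
by rewrite ge_min lexx orbT.
Qed.

End flow_integral.

(** * The bump field is an admissible variation *)

Section smooth_bumps.
Context {R : realType} {n : nat}.
Implicit Types (f g : 'rV[R]_n -> R).

Lemma CkW (W : normedModType R) k (f : 'rV[R]_n -> W) : Ck k.+1 f -> Ck k f.
Proof.
elim: k f => [|k IH] f [df Df]; first by move=> x; exact: differentiable_continuous.
by split=> // i; exact: IH.
Qed.

Lemma Ck_cst (W : normedModType R) k (c : W) : Ck k (fun _ : 'rV[R]_n => c).
Proof.
elim: k c => [|k IH] c; first exact: cst_continuous.
split=> [x|i]; first exact: differentiable_cst.
rewrite (_ : 'D_(delta_mx 0 i) _ = fun _ => 0); first exact: IH.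
by apply/funext => x; rewrite derive_cst.
Qed.

Lemma CkD k f g : Ck k f -> Ck k g -> Ck k (f \+ g).
Proof.
elim: k f g => [|k IH] f g; first by move=> cf cg x; apply: continuousD; [exact: cf|exact: cg].
move=> [df Df] [dg Dg]; split=> [x|i]; first exact: differentiableD.
rewrite (_ : (fun _ => _) = (fun x => 'D_(delta_mx 0 i) f x) \+ (fun x => 'D_(delta_mx 0 i) g x)).
  exact: (IH _ _ (Df i) (Dg i)).
by apply/funext => x; rewrite deriveD//; exact: diff_derivable.
Qed.

Lemma CkM k f g : Ck k f -> Ck k g -> Ck k (f \* g).
Proof.
elim: k f g => [|k IH] f g; first by move=> cf cg x; apply: continuousM; [exact: cf|exact: cg].
move=> Cf Cg; have [df Df] := Cf; have [dg Dg] := Cg.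
split=> [x|i]; first exact: differentiableM.
rewrite (_ : (fun _ => _) = (f \* (fun x => 'D_(delta_mx 0 i) g x)) \+
   (g \* (fun x => 'D_(delta_mx 0 i) f x))).
  by apply: CkD; apply: IH; [exact: CkW|exact: Dg|exact: CkW|exact: Df].
by apply/funext => x; rewrite deriveM//; exact: diff_derivable.
Qed.

Lemma Ck_prod k (I : Type) (s : seq I) (h : I -> 'rV[R]_n -> R) :
  (forall j, Ck k (h j)) -> Ck k (fun x => \prod_(j <- s) h j x).
Proof.
move=> hk; elim: s => [|j s IH].
  by under eq_fun do rewrite big_nil; exact: Ck_cst.
under eq_fun do rewrite big_cons.
by apply: (@CkM _ (h j) (fun x => \prod_(j <- s) h j x)).
Qed.

Lemma Ck_scale (W : normedModType R) k f (w : W) : Ck k f -> Ck k (fun x => f x *: w).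
Proof.
elim: k f => [|k IH] f.
  by move=> cf x; exact: (cvgZr_tmp (cf x)).
move=> [df Df]; split=> [x|i]; first exact: differentiableZl.
rewrite (_ : (fun _ => _) = fun x => 'D_(delta_mx 0 i) f x *: w); first exact: (IH _ (Df i)).
by apply/funext => x; rewrite !deriveE ?diffZl//; exact: differentiableZl.
Qed.

Lemma derive_coord_comp (phi : R -> R) (i j : 'I_n) (x : 'rV[R]_n) :
  'D_(delta_mx 0 i) (fun x : 'rV[R]_n => phi (x 0 j)) x =
  if i == j then 'D_1 phi (x 0 j) else 0.
Proof.
case: eqP => [<-|/eqP ij].
  apply: (congr1 (fun f : R -> R => lim (f @ (0 : R)^'))); apply/funext => h.
  by rewrite /= !mxE !eqxx.
rewrite /derive (_ : (fun _ => _) = fun _ => 0); first exact: lim_cst.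
by apply/funext => h; rewrite /= !mxE eqxx [j == i]eq_sym (negbTE ij) /= mulr0 add0r subrr scaler0.
Qed.

Lemma Ck_coord k (phi : R -> R) (j : 'I_n) :
  iter_derivable k phi -> Ck k (fun x : 'rV[R]_n => phi (x 0 j)).
Proof.
elim: k phi => [|k IH] phi.
  move=> cphi x; apply: (@continuous_comp _ _ _ (fun x : 'rV[R]_n => x 0 j) phi).
    exact: coord_continuous.
  exact: cphi.
move=> [g phig gk]; split=> [x|i].
  apply: (@differentiable_comp _ _ _ _ (fun x : 'rV[R]_n => x 0 j) phi).
    exact: differentiable_coord.
  by apply/derivable1_diffP; have [] := phig (x 0 j).
have [ij|/eqP ij] := eqVneq i j.
  rewrite (_ : 'D_(delta_mx 0 i) _ = fun x : 'rV[R]_n => g (x 0 j)); first exact: IH.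
  by apply/funext => x; rewrite derive_coord_comp ij eqxx; have [_ ->] := phig (x 0 j).
rewrite (_ : 'D_(delta_mx 0 i) _ = fun _ => 0); first exact: Ck_cst.
by apply/funext => x; rewrite derive_coord_comp; case: eqP.
Qed.

End smooth_bumps.

Section admissible_bump.
Context {R : realType} {m : nat}.
Variables (i : 'I_m.+1) (z : 'rV[R]_m.+1) (e : R).
Hypothesis e0 : 0 < e.

Lemma smooth_rho : smooth (fun x => rho z e x *: delta_mx 0 i : 'rV[R]_m.+1).
Proof.
move=> k; apply: Ck_scale; apply: Ck_prod => j.
rewrite (_ : (fun _ => _) = fun x : 'rV[R]_m.+1 => bumpR (e^-1 * x 0 j + (- z 0 j / e))).
  apply: (@Ck_coord _ _ _ (fun u => bumpR (e^-1 * u + (- z 0 j / e)))).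
  by apply: iter_derivable_affine; exact: iter_derivable_bump.
by apply/funext => x; congr bumpR; rewrite mulrBl mulrC mulNr.
Qed.

Lemma compactly_supported_rho :
  compactly_supported (fun x => rho z e x *: delta_mx 0 i : 'rV[R]_m.+1).
Proof.
pose K : set 'rV[R]_m.+1 := [set x | forall j, `[z 0 j - e, z 0 j + e]%classic (x 0 j)].
have cK : compact K.
  apply: (@rV_compact R _ (fun j => `[z 0 j - e, z 0 j + e]%classic)) => j.
  exact: segment_compact.
have clK : closed K by apply: compact_closed => //; exact: norm_hausdorff.
apply: (subclosed_compact _ cK); first exact: closed_closure.
rewrite [X in _ `<=` X]((closure_id K).1 clK); apply: closure_subset => x /= xX j.
have xB : box z e x.
  by apply: contrapT => /(rho_out e0) rx; move: xX; rewrite rx scale0r eqxx.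
by have := xB j; rewrite /= !in_itv/= => /andP[/ltW -> /ltW ->].
Qed.

(** The field vanishes on the boundary, where constant curves have its velocity. *)
Lemma tangent_rho (Omega : set 'rV[R]_m.+1) : box z e `&` closure Omega = set0 ->
  forall x, boundary Omega x ->
  tangent (boundary Omega) x (rho z e x *: delta_mx 0 i : 'rV[R]_m.+1).
Proof.
move=> B0 x bx; have xB : ~ box z e x.
  by move=> xB; have : (box z e `&` closure Omega) x by [split=> //; case: bx]; rewrite B0.
rewrite rho_out// scale0r; exists (cst x), (cst 0); split => //.
- by near=> t; split => //; exact: is_derive_cst.
- by near=> t; exact: cvg_cst.
Unshelve. all: by end_near. Qed.

End admissible_bump.

(** * Outer regularity of the volume *)

Section outer_regularity.
Context {R : realType} {n : nat}.
Local Open Scope ereal_scope.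
Implicit Types A U V : set 'rV[R]_n.

Lemma open_cube k : open (@cube R n k).
Proof.
(* The cube of half-side 0 is empty, except in dimension 0, where there is no coordinate to
   constrain. *)
have -> : @cube R n k = if k is 0%N then (if n is 0%N then setT else set0)
    else ball (0 : 'rV[R]_n)%R k%:R.
  case: k => [|k].
    apply/seteqP; split=> x; rewrite /cube /rect /=.
      case: n x => [//|m] x /(_ ord0); rewrite /= in_itv/= oppr0 => /andP[h1 h2].
      by have := lt_trans h1 h2; rewrite ltxx.
    by case: n x => [|m] x // _ [].
  apply/seteqP; split=> x.
    move=> h; apply/ball_rVP => // j; have := h j.
    by rewrite /= in_itv/= mxE sub0r normrN ltr_norml.
  move=> /ball_rVP h j; have := h (ltr0Sn _ _) j.
  by rewrite /= in_itv/= mxE sub0r normrN ltr_norml.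
case: k => [|k]; last exact: ball_open.
by case: n => [|m]; [exact: openT|exact: open0].
Qed.

Lemma volm_decreasing_lt (F : (set (borelRn R n))^nat) (eps : R) :
  (forall j, measurable (F j)) -> nonincreasing_seq F -> volm (F 0%N) < +oo ->
  volm (\bigcap_j F j) < eps%:E -> exists j, volm (F j) <= eps%:E.
Proof.
move=> mF niF F0 Feps; apply: contrapT => /forallNP nF.
have mI : measurable (\bigcap_j F j) by exact: bigcapT_measurable.
have Fcvg := nonincreasing_cvg_mu F0 mF mI niF.
move: Feps; apply/negP; rewrite -leNgt; apply: (cvge_to_ge Fcvg).
by apply: nearW => j; rewrite leNgt; apply/negP => /ltW; exact: nF.
Qed.

(** Approximating a set and its complement together makes the class closed under complements;
    restricting the overlap to a cube keeps all volumes finite. *)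
Definition regular_in k A := forall eps : R, (0 < eps)%R ->
  exists U V, [/\ open U, open V, A `<=` U, ~` A `<=` V & volm (U `&` V `&` @cube R n k) <= eps%:E].

Let volm_cap_cube_fin k A : measurable (A : set (borelRn R n)) ->
  volm (A `&` @cube R n k) < +oo.
Proof.
move=> mA; apply: le_lt_trans (volm_cube_fin n k); apply: le_measure; rewrite ?inE.
- by apply: measurableI => //; exact: measurable_cube.
- exact: measurable_cube.
- exact: subIsetr.
Qed.

Lemma regular_in_open k A : open A -> regular_in k A.
Proof.
move=> oA eps eps0.
(* The 1/(j+1)-neighbourhoods of the complement; their overlaps with the open set [A] decrease to
   the empty set. *)
pose C (j : nat) : set 'rV[R]_n := [set x | exists2 y, ~ A y & ball x j.+1%:R^-1 y].
have N0 (j : nat) : (0 < j.+1%:R^-1 :> R)%R by rewrite invr_gt0.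
have oC j : open (C j).
  rewrite (_ : C j = \bigcup_(y in ~` A) ball y j.+1%:R^-1).
    by apply: bigcup_open => y _; exact: ball_open.
  by apply/seteqP; split=> x [y nA xy]; exists y => //; exact: ball_sym.
have AC j : ~` A `<=` C j by move=> x nA; exists x => //; exact: ballxx.
pose F j := A `&` C j `&` @cube R n k.
have mF j : measurable (F j : set (borelRn R n)).
  by apply: open_measurable_rV; apply: openI; [exact: openI|exact: open_cube].
have F0 : \bigcap_j F j = set0.
  apply/seteqP; split=> // x Fx; have [[Ax _] _] := Fx 0%N I.
  have [e e0 exA] : exists2 e : R, (0 < e)%R & ball x e `<=` A.
    by have /nbhs_ballP[e /= e0 exA] : nbhs x A by [exact: open_nbhs_nbhs|]; exists e.
  have [j je] : exists j : nat, (j.+1%:R^-1 < e)%R.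
    exists (Num.truncn e^-1); rewrite invf_plt ?posrE//; exact: truncnS_gt.
  have [[_ [y nA xy]] _] := Fx j I.
  by apply: nA; apply: exA; exact: le_ball (ltW je) _ xy.
have [|||j Fj] := @volm_decreasing_lt F eps mF; last by exists A, (C j); split.
- apply/nonincreasing_seqP => j; apply/subsetPset => x [[Ax [y nA xy]] Qx]; split=> //; split=> //.
  exists y => //; apply: le_ball xy.
  by rewrite lef_pV2 ?posrE// ler_nat.
- by apply: volm_cap_cube_fin; apply: open_measurable_rV; exact: openI.
- by rewrite F0 measure0 lte_fin.
Qed.

Lemma regular_inC k A : regular_in k A -> regular_in k (~` A).
Proof.
move=> rA eps /rA[U [V [oU oV AU AV UV]]]; exists V, U; split => //; first by rewrite setCK.
by rewrite [V `&` U]setIC.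
Qed.

Lemma regular_in_bigcup k (F : (set 'rV[R]_n)^nat) :
  (forall j, regular_in k (F j)) -> regular_in k (\bigcup_j F j).
Proof.
move=> rF eps eps0.
(* These sum to at most eps/2, strictly below eps, which leaves room to pass from the limit to a
   finite stage. *)
have e20 (j : nat) : (0 < eps / 2 / (2 ^ j.+1)%:R)%R.
  by rewrite !divr_gt0// ltr0n expn_gt0.
have /choice[U UP] j := rF j _ (e20 j).
have /choice[V VP] := UP.
(* Only finite intersections of the [V j] stay open; continuity from above provides a sufficient
   [N]. *)
pose W N : set 'rV[R]_n := \bigcap_(j < N) V j.
have oU : open (\bigcup_j U j) by apply: bigcup_open => j _; have [] := VP j.
have oW N : open (W N).
  elim: N => [|N IH]; first by rewrite /W II0 bigcap_set0; exact: openT.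
  by rewrite /W IIS bigcap_setU bigcap_set1; apply: openI => //; have [] := VP N.
pose G N := \bigcup_j U j `&` W N `&` @cube R n k.
have mG N : measurable (G N : set (borelRn R n)).
  by apply: open_measurable_rV; apply: openI; [exact: openI|exact: open_cube].
have [|||N GN] := @volm_decreasing_lt G eps mG.
- apply/nonincreasing_seqP => N; apply/subsetPset => x [[Ux Wx] Qx]; split=> //; split=> //.
  by move=> j jN; apply: Wx; exact: leqW.
- by apply: volm_cap_cube_fin; apply: open_measurable_rV; exact: openI.
- apply: (@le_lt_trans _ _ (eps / 2)%:E); last by rewrite lte_fin gtr_pMr// invf_lt1// ltr1n.
  pose H j : set (borelRn R n) := U j `&` V j `&` @cube R n k.
  have mH j : measurable (H j).
    have [oUj oVj _ _ _] := VP j.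
    by apply: open_measurable_rV; apply: openI; [exact: openI|exact: open_cube].
  have : volm (\bigcap_N G N : set (borelRn R n)) <= \sum_(j <oo) volm (H j).
    apply: measure_sigma_subadditive => //; first exact: bigcapT_measurable.
    move=> x Gx; have [[[j _ Ujx] _] Qx] := Gx 0%N I.
    exists j => //; split=> //; split=> //.
    by have [[_ Wx] _] := Gx j.+1 I; apply: (Wx j) => /=.
  move=> /le_trans; apply.
  apply: (@le_trans _ _ (\sum_(j <oo) (eps / 2 / (2 ^ j.+1)%:R)%:E)).
    by apply: lee_nneseries => // j _; have [_ _ _ _] := VP j.
  by apply: (epsilon_trick0 xpredT); rewrite divr_ge0// ltW.
- exists (\bigcup_j U j), (W N); split => //.
    by move=> x [j _ Fx]; exists j => //; have [_ _ + _ _] := VP j; apply.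
  move=> x nFx j _; have [_ _ _ + _] := VP j; apply => Fx.
  by apply: nFx; exists j.
Qed.

Lemma regular_in_borel k (A : set (borelRn R n)) : measurable A -> regular_in k A.
Proof.
apply: smallest_sub; last exact: regular_in_open.
split.
- by apply: regular_in_open; exact: open0.
- by move=> B rB; rewrite setTD; exact: regular_inC.
- by move=> F rF; exact: regular_in_bigcup.
Qed.

(** The excess of [U] over [A] lies in [U] and in the open set covering the complement. *)
Lemma volm_outer_regular k (A : set (borelRn R n)) (eps : R) : measurable A -> (0 < eps)%R ->
  exists U : set 'rV[R]_n, [/\ open U, A `<=` U &
    volm ((U `\` A) `&` @cube R n k : set (borelRn R n)) <= eps%:E].
Proof.
move=> mA /(regular_in_borel k mA)[U [V [oU oV AU AV UV]]]; exists U; split => //.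
apply: le_trans UV; apply: le_measure; rewrite ?inE.
- apply: measurableI; last exact: measurable_cube.
  by apply: measurableD => //; exact: open_measurable_rV.
- by apply: open_measurable_rV; apply: openI; [exact: openI|exact: open_cube].
- by move=> x [[Ux nAx] Qx]; split=> //; split=> //; exact: AV.
Qed.

End outer_regularity.

(** * Positivity of the constant c_(n,s) *)

Section gamma_positivity.
Context {R : realType}.

Lemma exprn_le_expR (u : R) k : 0 <= u -> u ^+ k.+1 <= k.+1%:R ^+ k.+1 * expR u.
Proof.
move=> u0; have -> : expR u = expR (u / k.+1%:R) ^+ k.+1.
  by rewrite -expRM_natr divfK// pnatr_eq0.
rewrite -exprMn; apply: lerXn2r; rewrite ?nnegrE ?mulr_ge0 ?expR_ge0//.
rewrite -ler_pdivrMl// mulrC; apply: le_trans (expR_ge1Dx _).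
by rewrite lerDr.
Qed.

Definition gamma_fun (z t : R) : R := t `^ (z - 1) * expR (- t).

(* The derivative of [- (1 + Num.sqrt t)^-1]. *)
Definition majorant (t : R) : R := (2 * Num.sqrt t)^-1 / (1 + Num.sqrt t) ^+ 2.

Lemma gamma_fun_ge0 z t : 0 <= gamma_fun z t.
Proof. by rewrite mulr_ge0 ?powR_ge0 ?expR_ge0. Qed.

(** The threshold 1/2 matches the singularity t^(-1/2) of [majorant] at 0; both arguments of [Gamma]
    in [cns] are at least 1/2 in dimension at least 1. *)
Lemma gamma_fun_le (z : R) : 2^-1 <= z ->
  exists2 C : R, 0 <= C & forall t, 0 < t -> gamma_fun z t <= C * majorant t.
Proof.
move=> z12; pose N := Num.truncn z.
have zN : z - 2^-1 <= N.+1%:R.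
  have := truncnS_gt z; rewrite -/N => zN; apply: le_trans (ltW zN).
  by rewrite lerBlDr lerDl.
(* One factor 2 comes from 2 sqrt t in [majorant] and one from (1 + sqrt t)^2 <= 2 (1 + t); the rest
   bounds (1 + t)^(N+2) exp(-t). *)
exists (4 * N.+2%:R ^+ N.+2 * expR 1) => [|t t0].
  by rewrite mulr_ge0 ?expR_ge0// mulr_ge0 ?exprn_ge0.
have s0 : 0 < Num.sqrt t by rewrite sqrtr_gt0.
have sE : Num.sqrt t ^+ 2 = t by rewrite sqr_sqrtr// ltW.
have tz : t `^ (z - 1) <= (1 + t) ^+ N.+1 / Num.sqrt t.
  have -> : z - 1 = (z - 2^-1) + - 2^-1 by lra.
  rewrite powRD; last by rewrite (gt_eqF t0) implybT.
  rewrite powRN powR12_sqrt ?(ltW t0)// ler_wpM2r ?invr_ge0 ?(ltW s0)//.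
  rewrite -powR_mulrn; last by lra.
  apply: (@le_trans _ _ ((1 + t) `^ (z - 2^-1))).
    by apply: ge0_ler_powR; rewrite ?nnegrE ?subr_ge0//; lra.
  by apply: ler_powR => //; lra.
rewrite /gamma_fun /majorant; apply: (@le_trans _ _ ((1 + t) ^+ N.+1 / Num.sqrt t * expR (- t))).
  by rewrite ler_wpM2r ?expR_ge0.
have p0 : 0 < (1 + Num.sqrt t) ^+ 2 by rewrite exprn_gt0//; lra.
rewrite invfM -mulrA [X in _ <= X](_ : _ = (4 * N.+2%:R ^+ N.+2 * expR 1 / 2 / (1 + Num.sqrt t) ^+ 2) / Num.sqrt t); last first.
  by field; rewrite !gt_eqF.
rewrite [leLHS]mulrCA mulrC ler_wpM2r ?invr_ge0 ?(ltW s0)//.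
rewrite ler_pdivlMr//.
have hp : (1 + Num.sqrt t) ^+ 2 <= 2 * (1 + t).
  by have := sqr_ge0 (1 - Num.sqrt t); rewrite sqrrB sqrrD sE; lra.
have t10 : 0 <= 1 + t by lra.
have hk := exprn_le_expR N.+1 t10.
have E0 : 0 <= (1 + t) ^+ N.+1 * expR (- t) by rewrite mulr_ge0 ?exprn_ge0 ?expR_ge0.
apply: (le_trans (ler_wpM2l E0 hp)).
have -> : (1 + t) ^+ N.+1 * expR (- t) * (2 * (1 + t)) = 2 * expR (- t) * (1 + t) ^+ N.+2.
  by rewrite [in RHS]exprSr; ring.
apply: le_trans (ler_wpM2l _ hk) _; first by rewrite mulr_ge0 ?expR_ge0.
rewrite le_eqVlt; apply/orP; left; apply/eqP.
have eE : expR (- t) * expR (1 + t) = expR 1 by rewrite -expRD; congr expR; ring.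
by rewrite -eE; field.
Qed.

Lemma is_derive_majorant (t : R) : 0 < t ->
  is_derive t 1 (fun t : R => - (1 + Num.sqrt t)^-1) (majorant t).
Proof.
move=> t0; have s0 : 0 < Num.sqrt t by rewrite sqrtr_gt0.
have D1 := is_deriveD (is_derive_cst (1 : R) t 1) (is_derive1_sqrt t0).
have n0 : (cst 1 + Num.sqrt) t != 0 by rewrite gt_eqF// /GRing.add/=; exact: ltr_wpDl.
have := is_deriveN (is_deriveV n0 D1); rewrite add0r => D2.
apply: (is_derive_eq D2).
rewrite /majorant /GRing.scale /= -[(cst 1 + Num.sqrt) t]/(1 + Num.sqrt t).
by rewrite mulNr opprK mulrC.
Qed.

Lemma measurable_gamma_fun z : measurable_fun setT (gamma_fun z).
Proof.
apply: measurable_funM; first exact: measurable_powR.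
by apply: measurableT_comp => //; exact: measurable_expR.
Qed.

Lemma measurable_majorant : measurable_fun setT majorant.
Proof.
have ms : measurable_fun setT (@Num.sqrt R).
  by apply: continuous_measurable_fun; exact: sqrt_continuous.
apply: measurable_funM.
  by apply: (measurableT_comp (@measurable_invr R)); exact: measurable_funM.
apply: (measurableT_comp (@measurable_invr R)).
by apply: measurable_funX; exact: measurable_funD.
Qed.

Lemma continuous_majorant (t : R) : 0 < t -> {for t, continuous majorant}.
Proof.
move=> t0; have s0 : 0 < Num.sqrt t by rewrite sqrtr_gt0.
have cs := @sqrt_continuous R t.
apply: continuousM; apply: continuousV.
- by rewrite gt_eqF// mulr_gt0.
- by apply: continuousM => //; exact: cvg_cst.
- by rewrite gt_eqF// exprn_gt0// ltr_wpDl.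
- by apply: (@continuousM _ _ (fun t => 1 + Num.sqrt t) (fun t => 1 + Num.sqrt t));
    apply: continuousD => //; exact: cvg_cst.
Qed.

Lemma integral_gamma_itv (z : R) (C : R) (a b : R) : 0 <= C ->
  (forall t, 0 < t -> gamma_fun z t <= C * majorant t) -> 0 < a -> a < b ->
  (\int[lebesgue_measure]_(t in `[a, b]) (gamma_fun z t)%:E <= C%:E)%E.
Proof.
move=> C0 CP a0 ab.
have maj0 t : 0 <= majorant t.
  by rewrite divr_ge0 ?sqr_ge0// invr_ge0 mulr_ge0 ?sqrtr_ge0.
apply: (@le_trans _ _ (\int[lebesgue_measure]_(t in `[a, b]) (C%:E * (majorant t)%:E))%E).
  apply: ge0_le_integral => //.
  - by move=> t _; rewrite lee_fin gamma_fun_ge0.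
  - by apply/measurable_EFinP/measurable_funTS; exact: measurable_gamma_fun.
  - apply: emeasurable_funM => //.
    by apply/measurable_EFinP/measurable_funTS; exact: measurable_majorant.
  - move=> t /=; rewrite in_itv/= => /andP[at' _]; rewrite -EFinM lee_fin CP//.
    exact: lt_le_trans a0 at'.
rewrite ge0_integralZl//; last 2 first.
- by apply/measurable_EFinP; apply: measurable_funTS; exact: measurable_majorant.
- by move=> t _; rewrite lee_fin.
have H1 (t : R) : 0 < t -> {for t, continuous (fun t : R => - (1 + Num.sqrt t)^-1)}.
  move=> t0; apply: differentiable_continuous; apply/derivable1_diffP.
  by have [] := is_derive_majorant t0.
rewrite (@continuous_FTC2 _ majorant (fun t : R => - (1 + Num.sqrt t)^-1))//.
- rewrite -EFinB -EFinM lee_fin ler_piMr// opprK.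
  have i01 t : 0 <= (1 + Num.sqrt t)^-1 <= (1 : R).
    have := sqrtr_ge0 t => s0; rewrite invr_ge0 invf_le1 ?lerDl ?s0 ?andbT; lra.
  by have := i01 a; have := i01 b; lra.
- apply: continuous_in_subspaceT => t; rewrite inE/= in_itv/= => /andP[at' _].
  by apply: continuous_majorant; exact: lt_le_trans a0 at'.
- split.
  + move=> t; rewrite in_itv/= => /andP[at' _].
    by have [] := is_derive_majorant (lt_trans a0 at').
  + by apply: cvg_at_right_filter; exact: H1.
  + by apply: cvg_at_left_filter; apply: H1; exact: lt_trans ab.
- move=> t; rewrite in_itv/= => /andP[at' _]; rewrite derive1E.
  by have [_ ->] := is_derive_majorant (lt_trans a0 at').
Qed.

(** [Gamma] is the real part [fine] of an extended integral and would be 0 if that integral were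
    infinite, so finiteness must be proved along with positivity. *)
Lemma Gamma_gt0 (z : R) : 2^-1 <= z -> 0 < Gamma z.
Proof.
move=> z12; have [C C0 CP] := gamma_fun_le z12.
have mg (D : set (measurableTypeR R)) : measurable_fun D (fun t : measurableTypeR R => (gamma_fun z t)%:E).
  by apply/measurable_EFinP/measurable_funTS; exact: measurable_gamma_fun.
pose G : \bar R := (\int[lebesgue_measure]_(t in `]0%R, +oo[) (gamma_fun z t)%:E)%E.
have -> : Gamma z = fine G by [].
have GC : (G <= C%:E)%E.
  (* Compact intervals exhausting the half-line; on each of them [integral_gamma_itv] gives the same
     bound [C]. *)
  pose F k : set (measurableTypeR R) := `[k.+1%:R^-1, k.+2%:R]%classic.
  have FE : `]0%R, +oo[%classic = \bigcup_k F k.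
    apply/seteqP; split=> t /=; last first.
      move=> [k _]; rewrite /F /= !in_itv/= => /andP[kt _]; rewrite andbT.
      by apply: lt_le_trans kt; rewrite invr_gt0.
    rewrite in_itv/= andbT => t0; exists (Num.truncn (Num.max t t^-1)) => //.
    have := truncnS_gt (Num.max t t^-1); set k := Num.truncn _; rewrite gt_max => /andP[kt kti].
    rewrite /F /= in_itv/=; apply/andP; split.
      by rewrite invf_ple ?posrE// ltW.
    by rewrite (le_trans (ltW kt))// ler_nat.
  rewrite /G FE.
  have mF k : measurable (F k) by exact: measurable_itv.
  have ndF : nondecreasing_seq F.
    move=> j k jk; apply/subsetPset => t; rewrite /F /= !in_itv/= => /andP[jt tj].
    rewrite (le_trans _ jt) ?(le_trans tj)// ?ler_nat ?ltnS//.
    by rewrite lef_pV2 ?posrE// ler_nat.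
  have f0 k (t : measurableTypeR R) : F k t -> (0 <= (gamma_fun z t)%:E)%E by rewrite lee_fin gamma_fun_ge0.
  have cvgF := ge0_nondecreasing_set_cvg_integral ndF mF (fun k => mg (F k)) f0.
  have cF := cvgF (@lebesgue_measure R); rewrite -(cvg_lim _ cF)//.
  apply: lime_le; first by apply/cvg_ex; eexists; exact: cF.
  apply: nearW => k.
  apply: integral_gamma_itv => //.
  by rewrite (@le_lt_trans _ _ 1) ?invf_le1 ?ler1n ?ltr1n.
have G0 : (0 < G)%E.
  (* A lower bound for the integrand on [1, 2], where t^(z-1) >= 1/t >= 1/2. *)
  apply: (@lt_le_trans _ _ (2^-1 * expR (- 2))%R%:E).
    by rewrite lte_fin mulr_gt0 ?expR_gt0.
  have mI : measurable (`[(1 : R), 2] : set (measurableTypeR R)) by exact: measurable_itv.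
  have L1 : (\int[lebesgue_measure]_(t in `[1%R : R, 2%R]) (gamma_fun z t)%:E <= G)%E.
    apply: ge0_subset_integral => //.
      by move=> t _; rewrite lee_fin gamma_fun_ge0.
    by move=> t /=; rewrite !in_itv/= andbT => /andP[t1 _]; apply: lt_le_trans t1.
  have L2 : ((2^-1 * expR (- 2))%R%:E <= \int[lebesgue_measure]_(t in `[1%R : R, 2%R]) (2^-1 * expR (- 2))%R%:E)%E.
    rewrite integral_cst//= lebesgue_measure_itv/= lte_fin ltr1n -EFinD -EFinM.
    by rewrite lee_fin (_ : 2 - 1 = 1 :> R) ?mulr1//; lra.
  have L3 : (\int[lebesgue_measure]_(t in `[1%R : R, 2%R]) (2^-1 * expR (- 2))%R%:E <=
      \int[lebesgue_measure]_(t in `[1%R : R, 2%R]) (gamma_fun z t)%:E)%E.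
    apply: ge0_le_integral => //.
      move=> t /=; rewrite in_itv/= => /andP[t1 t2]; rewrite lee_fin /gamma_fun.
      apply: ler_pM; rewrite ?invr_ge0 ?expR_ge0 ?ler_expR ?lerN2//.
      apply: (@le_trans _ _ (t `^ (-1))); last by apply: ler_powR => //; lra.
      by rewrite powR_inv1 ?(le_trans _ t1)// lef_pV2 ?posrE//; lra.
  exact: le_trans L2 (le_trans L3 L1).
apply: fine_gt0; rewrite G0/=; exact: le_lt_trans GC (ltry _).
Qed.

(** Allows the factor to be cancelled from the derivative of the perimeter, and makes finiteness of
    the perimeter pass to the interactions. *)
Lemma cns_gt0 (m : nat) (s : R) : 0 < s < 1 -> 0 < cns m.+1 s.
Proof.
move=> /andP[s0 s1]; rewrite /cns; apply: mulr_gt0; last by rewrite subr_gt0.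
apply: mulr_gt0 => //; apply: divr_gt0.
  apply: mulr_gt0; first exact: powR_gt0.
  apply: Gamma_gt0; rewrite -[leLHS]mul1r ler_wpM2r// -natr1 addrAC.
  by rewrite lerDr addr_ge0// ltW.
apply: mulr_gt0; first by rewrite powR_gt0// pi_gt0.
by apply: Gamma_gt0; lra.
Qed.

End gamma_positivity.

(** * The fractional kernel, its potentials and interactions *)

Section tonelli_on_sets.
Context {R : realType} {n : nat}.
Variable k : borelRn R n * borelRn R n -> R.
Hypotheses (mk : measurable_fun setT k) (k0 : forall p, 0 <= k p).

Let measurable_indic_borel (A : set (borelRn R n)) : measurable A ->
  measurable_fun setT (\1_A : borelRn R n -> R).
Proof. by move=> mA; exact: measurable_indic. Qed.

Lemma measurable_integral_snd (A : set (borelRn R n)) : measurable A ->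
  measurable_fun setT (fun x => \int[volm]_(y in A) (k (x, y))%:E)%E.
Proof.
move=> mA; pose f p := (k p * \1_A p.2)%:E.
rewrite (_ : (fun _ => _) = fun x => (\int[volm]_y f (x, y))%E); last first.
  apply/funext => x; rewrite integral_mkcond epatch_indic.
  by apply: eq_integral => y _; rewrite /f EFinM.
apply: (@measurable_fun_fubini_tonelli_F _ _ _ _ R (@volm R n)).
  apply/measurable_EFinP; apply: measurable_funM => //.
  exact: (measurableT_comp (measurable_indic_borel mA) measurable_snd).
by move=> p; rewrite lee_fin mulr_ge0.
Qed.

Lemma tonelli_sets (A C : set (borelRn R n)) : measurable A -> measurable C ->
  (\int[volm]_(x in A) \int[volm]_(y in C) (k (x, y))%:E =
   \int[volm]_(y in C) \int[volm]_(x in A) (k (x, y))%:E)%E.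
Proof.
move=> mA mC.
pose f (p : borelRn R n * borelRn R n) := (\1_A p.1 * (k p * \1_C p.2))%:E.
have mf : measurable_fun setT f.
  apply/measurable_EFinP; apply: measurable_funM.
    exact: (measurableT_comp (measurable_indic_borel mA) measurable_fst).
  apply: measurable_funM => //.
  exact: (measurableT_comp (measurable_indic_borel mC) measurable_snd).
have f0 p : (0 <= f p)%E by rewrite lee_fin !mulr_ge0.
have H := @fubini_tonelli _ _ _ _ R (@volm R n) (@volm R n) f mf f0.
have sliceE (g : borelRn R n -> R) B (a : R) : measurable_fun setT g -> (forall y, 0 <= g y) ->
    measurable B -> 0 <= a ->
    ((\int[volm]_(y in B) (g y)%:E) * a%:E = \int[volm]_y (a * (g y * \1_B y))%:E)%E.
  move=> mg g0 mB a0; rewrite muleC [in LHS]integral_mkcond epatch_indic.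
  have mgB : measurable_fun setT (fun y => (g y * \1_B y)%:E).
    by apply/measurable_EFinP; apply: measurable_funM => //; exact: measurable_indic.
  have gB0 y : (0 <= (g y * \1_B y)%:E)%E by rewrite lee_fin mulr_ge0.
  exact: (esym (ge0_integralZl volm measurableT mgB (fun y _ => gB0 y) (a0 : (0 <= a%:E)%E))).
have mk1 x : measurable_fun setT (fun y => k (x, y)).
  have mp : measurable_fun setT (fun y : borelRn R n => (x, y)) by exact: measurable_fun_pair.
  exact: (measurableT_comp mk mp).
have mk2 y : measurable_fun setT (fun x => k (x, y)).
  have mp : measurable_fun setT (fun x : borelRn R n => (x, y)) by exact: measurable_fun_pair.
  exact: (measurableT_comp mk mp).
transitivity (\int[volm]_x \int[volm]_y f (x, y))%E.
  rewrite [LHS]integral_mkcond epatch_indic; apply: eq_integral => x _.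
  exact: sliceE.
rewrite H [RHS]integral_mkcond epatch_indic; apply: eq_integral => y _.
by rewrite sliceE//; apply: eq_integral => x _; rewrite /f; congr EFin; ring.
Qed.

End tonelli_on_sets.

Section fractional_kernel.
Context {R : realType} {n : nat}.
Variable s : R.
Implicit Types x y : 'rV[R]_n.

Definition sqnorm x : R := \sum_(j < n) x 0 j ^+ 2.

Definition frac_ker x : R := euclid x `^ (- (n%:R + s)).

(** The exponent when the kernel is written as a power of the squared norm, a polynomial in the
    coordinates. *)
Definition frac_exp : R := (n%:R + s) / 2.

Lemma sqnorm_ge0 x : 0 <= sqnorm x.
Proof. by apply: sumr_ge0 => j _; exact: sqr_ge0. Qed.

Lemma frac_kerE x : frac_ker x = sqnorm x `^ (- frac_exp).
Proof.
rewrite /frac_ker /euclid -powR12_sqrt ?sqnorm_ge0// -powRrM; congr (_ `^ _).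
by rewrite /frac_exp; field.
Qed.

Lemma frac_ker_ge0 x : 0 <= frac_ker x.
Proof. exact: powR_ge0. Qed.

Lemma frac_kerN x y : frac_ker (x - y) = frac_ker (y - x).
Proof.
rewrite !frac_kerE; congr (_ `^ _); apply: eq_bigr => j _.
by rewrite !mxE -opprB sqrrN.
Qed.

Lemma measurable_frac_ker : measurable_fun setT
  (fun p : borelRn R n * borelRn R n => frac_ker ((p.1 : 'rV_n) - p.2)).
Proof.
rewrite (_ : (fun _ => _) = (fun u : R => u `^ (- frac_exp)) \o
   (fun p : borelRn R n * borelRn R n => \sum_(j < n) ((p.1 : 'rV_n) 0 j - (p.2 : 'rV_n) 0 j) ^+ 2)); last first.
  apply/funext => p; rewrite frac_kerE /=; congr (_ `^ _); apply: eq_bigr => j _.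
  by rewrite !mxE.
apply: (measurableT_comp (measurable_powR _)).
apply: measurable_sum => j; apply: measurable_funX; apply: measurable_funB.
  exact: (measurableT_comp (measurable_coord j) measurable_fst).
exact: (measurableT_comp (measurable_coord j) measurable_snd).
Qed.

Lemma measurable_frac_ker1 x : measurable_fun setT
  (fun y : borelRn R n => frac_ker (x - y)).
Proof.
have mp : measurable_fun setT (fun y : borelRn R n => ((x : borelRn R n), y)).
  exact: measurable_fun_pair.
exact: (measurableT_comp measurable_frac_ker mp).
Qed.

(** The potential V_A, extended-valued because it may be infinite near [A]. *)
Definition frac_pot (A : set (borelRn R n)) x : \bar R :=
  (\int[volm]_(y in A) (frac_ker (x - (y : 'rV_n)))%:E)%E.

Lemma frac_pot_ge0 A x : (0 <= frac_pot A x)%E.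
Proof. by apply: integral_ge0 => y _; rewrite lee_fin frac_ker_ge0. Qed.

Lemma measurable_frac_pot (A : set (borelRn R n)) : measurable A ->
  measurable_fun setT (frac_pot A : borelRn R n -> \bar R).
Proof.
move=> mA.
exact: (measurable_integral_snd measurable_frac_ker (fun p => frac_ker_ge0 _)).
Qed.

Definition frac_inter (A C : set (borelRn R n)) : \bar R :=
  (\int[volm]_(x in A) frac_pot C x)%E.

Lemma frac_inter_sym (A C : set (borelRn R n)) : measurable A -> measurable C ->
  frac_inter A C = frac_inter C A.
Proof.
move=> mA mC.
rewrite /frac_inter /frac_pot.
rewrite (tonelli_sets measurable_frac_ker (fun p => frac_ker_ge0 _) mA mC).
by apply: eq_integral => y _; apply: eq_integral => x _; rewrite /= frac_kerN.
Qed.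

(** Passes from Lebesgue measurable sets to Borel representatives, for which Tonelli is
    available. *)
Lemma interaction_borel (A' C' : set 'rV[R]_n) (A C N : set (borelRn R n)) :
  lebesgue_measurable A' -> lebesgue_measurable C' ->
  measurable A -> measurable C -> measurable N -> volm N = 0%E ->
  A `\` A' `<=` N -> A' `\` A `<=` N -> C `\` C' `<=` N -> C' `\` C `<=` N ->
  interaction s A' C' = frac_inter A C.
Proof.
move=> mA' mC' mA mC mN N0 AN A'N CN C'N; rewrite /interaction /frac_inter.
have E x : (\int[@Leb R n]_(y in C') (euclid (x - y : 'rV[R]_n) `^ (- (n%:R + s)))%:E)%E = frac_pot C x.
  apply: (@integral_ae_set _ _ _ _ N (fun y : borelRn R n => (frac_ker (x - (y : 'rV_n)))%:E)) => //.
    by apply/measurable_EFinP; exact: measurable_frac_ker1.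
  by move=> y; rewrite lee_fin frac_ker_ge0.
under eq_integral do rewrite E.
apply: (@integral_ae_set _ _ _ _ N (frac_pot C)) => //; first exact: measurable_frac_pot.
exact: frac_pot_ge0.
Qed.

Lemma lebesgue_measurable_ae (A' : set 'rV[R]_n) (A N : set (borelRn R n)) :
  measurable A -> measurable N -> volm N = 0%E -> A' `<=` A -> A `\` A' `<=` N ->
  lebesgue_measurable A'.
Proof.
move=> mA mN N0 A'A AN.
have mD : measurable (A `\` A' : set (lebesgueRn R n)).
  apply: (@measure_is_complete_caratheodory R _ (@lebesgue R n)).
  exists N; split => //; first exact: lebesgue_measurable_borel.
  by rewrite /= lebesgue_volm.
rewrite /lebesgue_measurable (_ : A' = A `\` (A `\` A')); last first.
  by rewrite setDD (setIidr A'A).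
by apply: measurableD => //; exact: lebesgue_measurable_borel.
Qed.

Lemma lebesgue_ae (A' : set 'rV[R]_n) (A N : set (borelRn R n)) :
  measurable A -> measurable N -> volm N = 0%E ->
  A `\` A' `<=` N -> A' `\` A `<=` N -> lebesgue A' = volm A.
Proof.
move=> mA mN N0 AN A'N; have N0' : lebesgue N = 0%E by rewrite lebesgue_volm.
rewrite -lebesgue_volm//; apply/eqP; rewrite eq_le; apply/andP; split.
  apply: (@le_trans _ _ (lebesgue (A `|` N))).
    apply: le_outer_measure => x A'x; have [Ax|nA] := pselect (A x); [by left|right].
    exact: A'N.
  by apply: le_trans (outer_measureU2 _ _ _) _; rewrite [X in (_ + X)%E]N0' adde0.
apply: (@le_trans _ _ (lebesgue (A' `|` N))).
  apply: le_outer_measure => x A'x; have [Ax|nA] := pselect (A' x); [by left|right].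
  exact: AN.
by apply: le_trans (outer_measureU2 _ _ _) _; rewrite [X in (_ + X)%E]N0' adde0.
Qed.

End fractional_kernel.


(** * Bounds for potentials away from their sources *)

Lemma powRN_dist (R : realType) (a d p q : R) : 0 <= a -> 0 < d -> d <= p -> d <= q ->
  `|p `^ (- a) - q `^ (- a)| <= a * d `^ (- a) / d * `|p - q|.
Proof.
move=> a0 d0; wlog pq : p q / p <= q.
  move=> H dp dq; have [pq|/ltW qp] := leP p q; first exact: H.
  by rewrite distrC (distrC p); exact: H.
move=> dp dq.
have p0 : 0 < p by exact: lt_le_trans d0 dp.
have q0 : 0 < q by exact: lt_le_trans d0 dq.
have powE (u : R) : 0 < u -> u `^ (- a) = expR (- a * ln u) by move=> u0; rewrite /powR gt_eqF.
have mono (u v : R) : 0 < u -> u <= v -> v `^ (- a) <= u `^ (- a).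
  move=> u0 uv; have v0 := lt_le_trans u0 uv.
  by rewrite !powE// ler_expR mulNr mulNr lerN2 ler_wpM2l// ler_ln.
rewrite ger0_norm; last by rewrite subr_ge0; exact: mono.
rewrite distrC [`|q - p|]ger0_norm ?subr_ge0//.
have -> : p `^ (- a) - q `^ (- a) = p `^ (- a) * (1 - expR (- a * (ln q - ln p))).
  by rewrite mulrBr mulr1 !powE// -expRD; congr (_ - expR _); ring.
(* From 1 - exp(-r) <= r and ln(q/p) <= (q - p)/p, with p at least d. *)
have h1 : 1 - expR (- a * (ln q - ln p)) <= a * (q - p) / d.
  apply: (@le_trans _ _ (a * (ln q - ln p))).
    by have := expR_ge1Dx (- a * (ln q - ln p)); lra.
  rewrite -mulrA; apply: ler_wpM2l => //; apply: (@le_trans _ _ ((q - p) / p)).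
    have qp0 : 0 < q / p by rewrite divr_gt0.
    have := expR_ge1Dx (ln (q / p)); rewrite lnK ?posrE// ln_div ?posrE//.
    have -> : q / p = 1 + (q - p) / p by rewrite mulrBl divff ?gt_eqF//; ring.
    by rewrite lerD2l.
  by apply: ler_wpM2l; rewrite ?subr_ge0// lef_pV2 ?posrE.
apply: le_trans (ler_wpM2l (powR_ge0 _ _) h1) _.
rewrite (_ : a * d `^ (- a) / d * (q - p) = d `^ (- a) * (a * (q - p) / d)); last by field; rewrite gt_eqF.
apply: ler_wpM2r; last exact: mono.
by rewrite mulr_ge0 ?invr_ge0 ?(ltW d0)// mulr_ge0// subr_ge0.
Qed.

Section potential_bounds.
Context {R : realType} {n : nat}.
Variable s : R.
Hypothesis s0 : 0 < s.
Implicit Types x y : 'rV[R]_n.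
Local Notation a := (@frac_exp R n s).

Lemma frac_exp_ge0 : 0 <= a.
Proof. by rewrite /frac_exp divr_ge0// addr_ge0// ltW. Qed.

Lemma powRN_le (d p : R) : 0 < d -> d <= p -> p `^ (- a) <= d `^ (- a).
Proof.
move=> d0 dp; have p0 := lt_le_trans d0 dp.
rewrite !powRN lef_pV2 ?posrE ?powR_gt0//.
by apply: ge0_ler_powR; rewrite ?nnegrE ?frac_exp_ge0// ltW.
Qed.

Section far_set.
Variables (A : set (borelRn R n)) (x : 'rV[R]_n) (d : R).
Hypotheses (mA : measurable A) (Aoo : (volm A < +oo)%E) (d0 : 0 < d).
Hypothesis far : forall y, A y -> d <= sqnorm (x - y).

Lemma frac_pot_le : (frac_pot s A x <= (d `^ (- a))%:E * volm A)%E.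
Proof.
rewrite -integral_cst//; apply: ge0_le_integral => //.
- by move=> y _; rewrite lee_fin frac_ker_ge0.
- by apply/measurable_EFinP; apply: measurable_funTS; exact: measurable_frac_ker1.
- by move=> y Ay; rewrite lee_fin frac_kerE; apply: powRN_le => //; exact: far.
Qed.

Lemma frac_pot_fin : frac_pot s A x \is a fin_num.
Proof.
rewrite ge0_fin_numE ?frac_pot_ge0//; apply: le_lt_trans frac_pot_le _.
by rewrite lte_mul_pinfty// lee_fin powR_ge0.
Qed.

Lemma fine_frac_pot_le : fine (frac_pot s A x) <= d `^ (- a) * fine (volm A).
Proof.
rewrite -lee_fin fineK ?frac_pot_fin// EFinM fineK ?frac_pot_le//.
by rewrite ge0_fin_numE.
Qed.

(** A comparison function [g] instead of a second point, for two uses: [g] the squared distance to a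
    nearby point gives the Lipschitz bound, and [g] the constant |x|^2 gives the behaviour at
    infinity. *)
Lemma frac_pot_approx (g : borelRn R n -> R) (b : R) : measurable_fun setT g -> 0 <= b ->
  (forall y, A y -> d <= g y) -> (forall y, A y -> `|sqnorm (x - y) - g y| <= b) ->
  `|fine (frac_pot s A x) - \int[volm]_(y in A) (g y `^ (- a))|
    <= a * d `^ (- a) / d * b * fine (volm A).
Proof.
move=> mg b0 dg gb.
have c0 : 0 <= a * d `^ (- a) / d.
  exact: (divr_ge0 (mulr_ge0 frac_exp_ge0 (powR_ge0 _ _)) (ltW d0)).
have mga : measurable_fun setT (fun y : borelRn R n => g y `^ (- a)).
  exact: (measurableT_comp (measurable_powR _) mg).
have mk := measurable_frac_ker1 s x.
have Ig : (volm).-integrable A (EFin \o (fun y : borelRn R n => g y `^ (- a))).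
  apply: (@integrable_bounded _ _ _ _ (d `^ (- a))) => // y Ay.
  by rewrite ger0_norm ?powR_ge0// powRN_le// dg.
have Ik : (volm).-integrable A (EFin \o (fun y : borelRn R n => frac_ker s (x - (y : 'rV_n)))).
  apply: (@integrable_bounded _ _ _ _ (d `^ (- a))) => // y Ay.
  by rewrite ger0_norm ?frac_ker_ge0// frac_kerE powRN_le// far.
have -> : fine (frac_pot s A x) = \int[volm]_(y in A) frac_ker s (x - (y : 'rV_n)) by [].
rewrite -RintegralB//; apply: Rintegral_bound => //.
- exact: (measurable_funB mk mga).
- exact: mulr_ge0 c0 b0.
- move=> y Ay; rewrite frac_kerE; apply: le_trans (powRN_dist _ d0 _ _) _.
  + exact: frac_exp_ge0.
  + exact: far.
  + exact: dg.
  + apply: ler_wpM2l; last exact: gb.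
    exact: c0.
Qed.

End far_set.
End potential_bounds.


(** * The perimeter along the flow *)

Section perimeter_flow.
Context {R : realType} {m : nat}.
Variables (i : 'I_m.+1) (z : 'rV[R]_m.+1) (e : R).
Hypothesis e0 : 0 < e.
Local Notation Phi := (bump_flow i z e).

(** Inside the box by the change of variables, outside because nothing moves. It keeps the image of
    [E] almost equal to the image of its Borel hull. *)
Lemma flow_null (N : set (borelRn R m.+1)) t : measurable N -> volm N = 0%E ->
  volm (Phi t @` N : set (borelRn R m.+1)) = 0%E.
Proof.
move=> mN N0; set M : set (borelRn R m.+1) := Phi t @` N.
have mM : measurable M by exact: measurable_flow_image.
have mB := measurable_box z e.
have mBM : measurable (box z e `&` M : set (borelRn R m.+1)) by exact: measurableI.
have BM0 : volm (box z e `&` M : set (borelRn R m.+1)) = 0%E.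
  have Boo : (volm (box z e `&` M : set (borelRn R m.+1)) < +oo)%E.
    by apply: le_lt_trans (volm_box_fin z e0); apply: le_measure; rewrite ?inE.
  have := @flow_int_change _ _ i z e e0 N (cst 1) t mN (@measurable_cst _ _ _ _ _ _) (fun=> ler01).
  rewrite /flow_int Rintegral_cst// mul1r => fE.
  rewrite -[LHS]fineK ?ge0_fin_numE// fE /Rintegral null_set_integral//.
  - exact: measurableI.
  - apply/measurable_EFinP; apply: measurable_funTS; apply: measurable_funM => //.
    exact: measurable_bump_flow_jac.
  - by apply: (subset_measure0 (B := N)) => //; exact: measurableI.
have MB0 : volm (M `\` box z e : set (borelRn R m.+1)) = 0%E.
  apply: (subset_measure0 (B := N)) => //; first exact: measurableD.
  by move=> x []; rewrite /M bump_flow_image// => + xB; rewrite /preimage/= bump_flow_out.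
transitivity (volm (M `\` box z e : set (borelRn R m.+1)) + volm (box z e `&` M : set (borelRn R m.+1)))%E.
  by rewrite setIC; exact: (measureDI volm mM mB).
by rewrite MB0 BM0 adde0.
Qed.

Section far_from_Omega.
Variables (s d : R) (Omega : set (borelRn R m.+1)).
Hypotheses (s0 : 0 < s) (d0 : 0 < d).
Hypothesis (mO : measurable Omega) (Ooo : (volm Omega < +oo)%E).
Hypothesis far : forall x y, box z e x -> Omega y -> d <= sqnorm (x - y).

Let boxO x : box z e x -> ~ Omega x.
Proof.
move=> xB xO; have := far xB xO; rewrite /sqnorm big1 ?leNgt ?d0// => j _.
by rewrite subrr mxE expr0n.
Qed.

Lemma flow_Omega (A : set (borelRn R m.+1)) t : Phi t @` A `&` Omega = A `&` Omega.
Proof.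
rewrite bump_flow_image//; apply/seteqP; split=> x [+ xO]; rewrite /preimage/=.
  by rewrite bump_flow_out// => xB; exact: boxO xB xO.
by split => //; rewrite bump_flow_out// => xB; exact: boxO xB xO.
Qed.

(** The set changes inside the box only, and there the potential of [C] is bounded, so the moving
    part is a real number. *)
Lemma frac_inter_flow (A C : set (borelRn R m.+1)) t : measurable A -> measurable C ->
  C `<=` Omega ->
  frac_inter s (Phi t @` A `&` ~` Omega) C =
  (frac_inter s ((A `&` ~` Omega) `\` box z e) C
    + (flow_int i z e A (fun x => fine (frac_pot s C x)) t)%:E)%E.
Proof.
move=> mA mC CO.
have Coo : (volm C < +oo)%E.
  by apply: le_lt_trans Ooo; apply: le_measure; rewrite ?inE.
have mB := measurable_box z e.
have mA' := measurable_flow_image i z e0 t mA.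
have mnO : measurable (~` Omega) by exact: measurableC.
have mpot := measurable_frac_pot s mC.
have farC x y : box z e x -> C y -> d <= sqnorm (x - y) by move=> xB /CO; exact: far.
have -> : Phi t @` A `&` ~` Omega = ((A `&` ~` Omega) `\` box z e) `|` (box z e `&` Phi t @` A).
  rewrite bump_flow_image//; apply/seteqP; split=> x.
    move=> [+ xO]; rewrite /preimage/= => Ax; have [xB|xB] := pselect (box z e x); first by right.
    by left; split => //; split => //; rewrite bump_flow_out in Ax.
  move=> [[[Ax xO] xB]|[xB Ax]]; split => //; first by rewrite /preimage/= bump_flow_out.
  exact: boxO.
rewrite /frac_inter ge0_integral_setU; last 5 first.
- by apply: measurableD => //; exact: measurableI.
- exact: measurableI.
- exact: measurable_funTS.
- by move=> x _; exact: frac_pot_ge0.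
- by apply/disj_setPRL => x [xB _] [_ /(_ xB)].
congr adde; rewrite /flow_int /Rintegral.
transitivity (\int[volm]_(x in box z e `&` Phi t @` A) (fine (frac_pot s C x))%:E)%E.
  apply: eq_integral => x; rewrite inE => -[xB _]; rewrite fineK//.
  by apply: (@frac_pot_fin _ _ _ s0 _ _ d) => // y; exact: farC.
rewrite fineK//; apply: integrable_fin_num; first exact: measurableI.
apply: (@integrable_bounded _ _ _ _ (d `^ (- @frac_exp R m.+1 s) * fine (volm C))).
- exact: measurableI.
- by apply: le_lt_trans (volm_box_fin z e0); apply: le_measure; rewrite ?inE//; exact: measurableI.
- exact: (measurableT_comp (fine_measurable measurableT) mpot).
- move=> x [xB _]; rewrite ger0_norm ?fine_ge0 ?frac_pot_ge0//.
  by apply: fine_frac_pot_le => // y; exact: farC.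
Qed.

(** [C] collects the interactions that do not see the box. It may be infinite at this stage;
    minimality excludes this later. *)
Lemma Per_flow (E : set 'rV[R]_m.+1) (B N : set (borelRn R m.+1)) :
  measurable B -> measurable N -> volm N = 0%E -> E `<=` B -> B `\` E `<=` N ->
  exists2 C : \bar R, (0 <= C)%E & forall t,
    Per s (Phi t @` E) Omega = ((cns m.+1 s)%:E * (C +
      (flow_int i z e (~` B) (fun x => fine (frac_pot s (B `&` Omega) x)) t +
       flow_int i z e B (fun x => fine (frac_pot s (~` B `&` Omega) x)) t)%:E))%E.
Proof.
move=> mB mN N0 EB BEN.
have mnO : measurable (~` Omega) by exact: measurableC.
have mnB : measurable (~` B) by exact: measurableC.
have mbox := measurable_box z e.
exists (frac_inter s (~` B `&` Omega) (B `&` Omega)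
  + frac_inter s ((~` B `&` ~` Omega) `\` box z e) (B `&` Omega)
  + frac_inter s ((B `&` ~` Omega) `\` box z e) (~` B `&` Omega))%E.
  have I0 (A C : set (borelRn R m.+1)) : (0 <= frac_inter s A C)%E.
    by apply: integral_ge0 => x _; exact: frac_pot_ge0.
  apply: adde_ge0; last exact: I0.
  by apply: adde_ge0; exact: I0.
move=> t; rewrite /Per.
pose Et := Phi t @` E; pose Bt : set (borelRn R m.+1) := Phi t @` B.
pose Nt : set (borelRn R m.+1) := Phi t @` N.
have mBt : measurable Bt by exact: measurable_flow_image.
have mnBt : measurable (~` Bt) by exact: measurableC.
have mNt : measurable Nt by exact: measurable_flow_image.
have Nt0 : volm Nt = 0%E by exact: flow_null.
have EBt y : Et y -> Bt y by rewrite /Et /Bt !bump_flow_image//; exact: EB.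
have BENt y : Bt y -> ~ Et y -> Nt y.
  by rewrite /Et /Bt /Nt !bump_flow_image// => *; exact: BEN.
have lEt : lebesgue_measurable Et.
  by apply: (lebesgue_measurable_ae mBt mNt) => // y [? ?]; exact: BENt.
have lO : lebesgue_measurable (Omega : set 'rV_m.+1) by exact: lebesgue_measurable_borel.
have lnEt : lebesgue_measurable (~` Et) by exact: measurableC.
have lnO : lebesgue_measurable (~` Omega : set 'rV_m.+1) by exact: measurableC.
have nB : ~` Bt = Phi t @` (~` B) by rewrite /Bt !bump_flow_image.
rewrite (@interaction_borel _ _ _ _ _ (~` Bt `&` Omega) (Bt `&` Omega) Nt)//; last 8 first; try exact: measurableI.
- by move=> y [[nb o] nn]; exfalso; apply: nn; split=> // /EBt.
- by move=> y [[ne o] nn]; apply: BENt => //; apply: contrapT => nb; apply: nn.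
- by move=> y [[b o] nn]; apply: BENt => // ee; apply: nn.
- by move=> y [[ee o] nn]; exfalso; apply: nn; split=> //; exact: EBt.
rewrite (@interaction_borel _ _ _ _ _ (Bt `&` Omega) (~` Bt `&` ~` Omega) Nt)//; last 8 first; try exact: measurableI.
- by move=> y [[b o] nn]; apply: BENt => // ee; apply: nn.
- by move=> y [[ee o] nn]; exfalso; apply: nn; split=> //; exact: EBt.
- by move=> y [[nb o] nn]; exfalso; apply: nn; split=> // /EBt.
- by move=> y [[ne o] nn]; apply: BENt => //; apply: contrapT => nb; apply: nn.
rewrite (@interaction_borel _ _ _ _ _ (Bt `&` ~` Omega) (~` Bt `&` Omega) Nt)//; last 8 first; try exact: measurableI.
- by move=> y [[b o] nn]; apply: BENt => // ee; apply: nn.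
- by move=> y [[ee o] nn]; exfalso; apply: nn; split=> //; exact: EBt.
- by move=> y [[nb o] nn]; exfalso; apply: nn; split=> // /EBt.
- by move=> y [[ne o] nn]; apply: BENt => //; apply: contrapT => nb; apply: nn.
have mBtO : measurable (Bt `&` Omega) by exact: measurableI.
have mnBtO : measurable (~` Bt `&` Omega) by exact: measurableI.
have mnBtnO : measurable (~` Bt `&` ~` Omega) by exact: measurableI.
(* Symmetry puts the moving set in the outer integral, so that the inner one is a potential of a
   fixed part of Omega. *)
rewrite (frac_inter_sym s mBtO mnBtnO).
have mBO : measurable (B `&` Omega) by exact: measurableI.
have mnBO : measurable (~` B `&` Omega) by exact: measurableI.
rewrite nB /Bt !flow_Omega.
rewrite (frac_inter_flow t mnB mBO (@subIsetr _ _ _)).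
rewrite (frac_inter_flow t mB mnBO (@subIsetr _ _ _)).
have regroup (x y u v w : \bar R) : (x + (y + v) + (u + w) = x + y + u + (v + w))%E.
  by rewrite [RHS]addeACA (addeA x).
by rewrite EFinD regroup.
Qed.

End far_from_Omega.
End perimeter_flow.


(** * The first variation inequality *)

Lemma box_ball (R : realType) m (z : 'rV[R]_m.+1) e : 0 < e -> box z e = ball z e.
Proof.
move=> e0; apply/seteqP; split=> x.
  by move/boxP => /(_ e0) xB; apply/ball_rVP => // j; have := xB j;
    rewrite normrM normfV (gtr0_norm e0) ltr_pdivrMr// mul1r distrC.
move/ball_rVP => /(_ e0) xB; apply/boxP => // j; have := xB j.
by rewrite normrM normfV (gtr0_norm e0) ltr_pdivrMr// mul1r distrC.
Qed.

Lemma sqnorm_dist (R : realType) n (x x' y : 'rV[R]_n) (D h : R) : 0 <= D -> 0 <= h ->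
  (forall j, `|x 0 j| <= D) -> (forall j, `|x' 0 j| <= D) -> (forall j, `|y 0 j| <= D) ->
  (forall j, `|x 0 j - x' 0 j| <= h) ->
  `|sqnorm (x - y) - sqnorm (x' - y)| <= n%:R * (4 * D) * h.
Proof.
move=> D0 h0 xD x'D yD xx'; rewrite /sqnorm -sumrB.
apply: le_trans (ler_norm_sum _ _ _) _.
rewrite -mulrA -[n in n%:R]card_ord -[X in X * _]sumr_const mulr_suml; apply: ler_sum => j _.
(* The first factor is at most 4D and the second at most h. *)
rewrite !mxE (_ : _ - _ = (x 0 j + x' 0 j - 2 * y 0 j) * (x 0 j - x' 0 j)); last by ring.
rewrite normrM mul1r; apply: ler_pM => //.
apply: le_trans (ler_normD _ _) _; rewrite normrN normrM ger0_norm//.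
apply: le_trans (lerD (ler_normD _ _) (lexx _)) _.
by have := xD j; have := x'D j; have := yD j; lra.
Qed.

Lemma is_derive0_near (R : realType) (g : R -> R) (eps : R) : is_derive (0 : R) 1 g 0 ->
  0 < eps -> \forall t \near 0^', `|g t - g 0| <= eps * `|t|.
Proof.
move=> [dg g'0] eps0.
have : (fun h : R => h^-1 *: (g (h *: 1 + 0) - g 0)) @ 0^' --> (0 : R).
  by rewrite -[X in _ --> X]g'0; exact: dg.
move/cvgrPdist_lt => /(_ _ eps0); apply: filterS2 (nbhs_dnbhs_neq _) => t t0.
rewrite sub0r normrN /GRing.scale /= mulr1 addr0 normrM normfV => /ltW.
by rewrite mulrC ler_pdivrMr// normr_gt0.
Qed.

Section bump_derivative_average.
Context {R : realType} {m : nat}.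
Variables (i : 'I_m.+1) (z : 'rV[R]_m.+1) (e : R).
Hypothesis e0 : 0 < e.

(** [f] varies by L e on the box and [d_rho] is at most M/e: the scale cancels, leaving an error
    proportional to the volume of the box. *)
Lemma integral_lip_d_rho (f : borelRn R m.+1 -> R) (A : set (borelRn R m.+1)) (M K L : R) :
  measurable A -> measurable_fun setT f -> 0 <= K -> 0 <= L -> 0 <= M ->
  (forall x, box z e x -> `|f x| <= K) -> (forall x, box z e x -> `|f x - f z| <= L * e) ->
  (forall y : R, `|y| <= 1 -> `|bumpR' y| <= M) ->
  `|\int[volm]_(x in box z e `&` A) (f x * d_rho i z e x)
    - f z * \int[volm]_(x in box z e `&` A) d_rho i z e x|
    <= L * M * fine (volm (box z e : set (borelRn R m.+1))).
Proof.
move=> mA mf K0 L0 M0 fK fL HM.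
have mbox := measurable_box z e.
have mP : measurable (box z e `&` A : set (borelRn R m.+1)) by exact: measurableI.
have Poo : (volm (box z e `&` A : set (borelRn R m.+1)) < +oo)%E.
  by apply: le_lt_trans (volm_box_fin z e0); apply: le_measure; rewrite ?inE.
have md := @measurable_d_rho R m i z e.
have dM x : box z e x -> `|d_rho i z e x| <= M / e by exact: d_rho_bound.
have Id : (volm).-integrable (box z e `&` A) (EFin \o d_rho i z e).
  by apply: (integrable_bounded (K := M / e)) => // x [/dM].
have Ifd : (volm).-integrable (box z e `&` A) (EFin \o (fun x => f x * d_rho i z e x)).
  apply: (integrable_bounded (K := K * (M / e))) => //; first exact: measurable_funM.
  by move=> x [xB _]; rewrite normrM; apply: ler_pM => //; [exact: fK|exact: dM].
have Izd : (volm).-integrable (box z e `&` A) (EFin \o (fun x => f z * d_rho i z e x)).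
  apply: (integrable_bounded (K := `|f z| * (M / e))) => //; first exact: measurable_funM.
  by move=> x [xB _]; rewrite normrM ler_wpM2l// dM.
rewrite -RintegralZl// -RintegralB//; apply: Rintegral_bound => //.
- exact: volm_box_fin.
- by apply: measurable_funB; exact: measurable_funM.
- exact: mulr_ge0.
- move=> x [xB _]; rewrite -mulrBl normrM.
  rewrite (_ : L * M = L * e * (M / e)); last by field; rewrite gt_eqF.
  by apply: ler_pM => //; [exact: fL|exact: dM].
Qed.

End bump_derivative_average.

Section first_variation.
Context {R : realType} {m : nat}.
Variables (i : 'I_m.+1) (z : 'rV[R]_m.+1) (e s d D : R) (Omega : set (borelRn R m.+1)).
Hypotheses (e0 : 0 < e) (s01 : 0 < s < 1) (d0 : 0 < d) (D0 : 0 <= D).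
Hypotheses (openO : open (Omega : set 'rV[R]_m.+1)) (Ooo : (volm Omega < +oo)%E).
Hypothesis far : forall x y, box z e x -> Omega y -> d <= sqnorm (x - y).
Hypothesis boxD : forall x, box z e x -> forall j, `|x 0 j| <= D.
Hypothesis OmegaD : forall y : 'rV[R]_m.+1, Omega y -> forall j, `|y 0 j| <= D.

Let s0 : 0 < s. Proof. by case/andP: s01. Qed.

Definition pot_cst : R := @frac_exp R m.+1 s * d `^ (- @frac_exp R m.+1 s) / d.

(** A Lipschitz constant of the potentials of parts of Omega; it depends on [d], [D] and Omega but
    not on [e] or [z], and the uniformity of all later bounds rests on this. *)
Definition pot_lip : R := pot_cst * (m.+1%:R * (4 * D)) * fine (volm Omega).

Lemma pot_lip_ge0 : 0 <= pot_lip.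
Proof.
have c0 : 0 <= pot_cst.
  by apply: divr_ge0 (ltW d0); apply: mulr_ge0 (powR_ge0 _ _); exact: frac_exp_ge0.
have D4 : 0 <= m.+1%:R * (4 * D) by rewrite !mulr_ge0.
by rewrite /pot_lip; apply: mulr_ge0 (mulr_ge0 c0 D4) _; exact: fine_ge0.
Qed.

Lemma frac_pot_lip (C : set (borelRn R m.+1)) x x' h : measurable C -> C `<=` Omega ->
  box z e x -> box z e x' -> 0 <= h -> (forall j, `|x 0 j - x' 0 j| <= h) ->
  `|fine (frac_pot s C x) - fine (frac_pot s C x')| <= pot_lip * h.
Proof.
move=> mC CO xB x'B h0 xx'.
have mO := open_measurable_rV openO.
have CleO : (volm C <= volm Omega)%E by apply: le_measure; rewrite ?inE.
have Coo : (volm C < +oo)%E by exact: le_lt_trans Ooo.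
have c0 : 0 <= pot_cst.
  by apply: divr_ge0 (ltW d0); apply: mulr_ge0 (powR_ge0 _ _); exact: frac_exp_ge0.
have b0 : 0 <= m.+1%:R * (4 * D) * h by rewrite !mulr_ge0.
have ms : measurable_fun setT (fun y : borelRn R m.+1 => sqnorm (x' - (y : 'rV_m.+1))).
  apply: measurable_sum => j; apply: measurable_funX.
  rewrite (_ : (fun _ => _) = fun y : borelRn R m.+1 => x' 0 j - (y : 'rV_m.+1) 0 j).
    by apply: measurable_funB => //; exact: measurable_coord.
  by apply/funext => y; rewrite !mxE.
pose g (y : borelRn R m.+1) := sqnorm (x' - (y : 'rV_m.+1)).
have gE : \int[volm]_(y in C) (g y `^ (- @frac_exp R m.+1 s)) = fine (frac_pot s C x').
  rewrite /Rintegral /frac_pot; congr fine; apply: eq_integral => y _.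
  by rewrite frac_kerE.
have H : `|fine (frac_pot s C x) - \int[volm]_(y in C) (g y `^ (- @frac_exp R m.+1 s))|
    <= @frac_exp R m.+1 s * d `^ (- @frac_exp R m.+1 s) / d * (m.+1%:R * (4 * D) * h) * fine (volm C).
  apply: frac_pot_approx => //.
  - by move=> y /CO; exact: far.
  - by move=> y /CO; exact: far.
  - by move=> y /CO yO; apply: sqnorm_dist => //; [exact: boxD|exact: boxD|exact: OmegaD].
rewrite gE in H; apply: le_trans H _.
rewrite -/pot_cst /pot_lip [leRHS]mulrAC -[pot_cst * _ * h]mulrA.
apply: ler_wpM2l; first exact: mulr_ge0 c0 b0.
by rewrite fine_le// ge0_fin_numE.
Qed.

Variables (E : set 'rV[R]_m.+1) (B N : set (borelRn R m.+1)).
Hypotheses (mB : measurable B) (mN : measurable N) (N0 : volm N = 0%E).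
Hypotheses (EB : E `<=` B) (BEN : B `\` E `<=` N).
Hypothesis minE : free_boundary_minimal s Omega E.

Local Notation f1 := (fun x => fine (frac_pot s (B `&` Omega) x)).
Local Notation f2 := (fun x => fine (frac_pot s (~` B `&` Omega) x)).
Local Notation v := (fine (volm (box z e : set (borelRn R m.+1)))).

(** The perimeter is an affine function of this sum, with positive slope and finite constant, so
    criticality passes to the sum. *)
Lemma flow_int_critical :
  is_derive (0 : R) 1 (fun t => flow_int i z e (~` B) f1 t + flow_int i z e B f2 t) 0.
Proof.
have mO := open_measurable_rV openO.
set g := (fun t => _ : R); set c := cns m.+1 s.
have c0 : 0 < c by exact: cns_gt0.
have [C C0 PE] := Per_flow i e0 s0 d0 mO Ooo far mB mN N0 EB BEN.
have BO : box z e `&` closure Omega = set0.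
  rewrite -subset0 => x [xB /(_ (box z e))[]].
    by rewrite box_ball//; apply: open_nbhs_nbhs; split; [exact: ball_open|rewrite -box_ball].
  move=> y [yO yB]; have := far yB yO; rewrite /sqnorm big1 ?leNgt ?d0// => j _.
  by rewrite subrr mxE expr0n.
have [finP D1] := minE (smooth_rho i z e) (@compactly_supported_rho _ _ i z e e0)
  (fun x => @tangent_rho _ _ i z e e0 _ BO x) (bump_flow_is_flow i z e0).
have := nbhs_singleton finP; rewrite PE => Cfin.
(* An infinite [C] would make the perimeter infinite at t = 0, against the finiteness contained in
   minimality. *)
have {Cfin C0 finP} [C' CE] : exists C', C = C'%:E.
  move: C C0 PE Cfin => [r _ _ _|_ _|//]; first by exists r.
  by rewrite mulry gtr0_sg// mul1e.
have fE : (fun t => fine (Per s (bump_flow i z e t @` E) Omega)) = fun t => c * (C' + g t).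
  by apply/funext => t; rewrite PE CE.
rewrite fE in D1.
have D2 := is_deriveB (is_deriveZ c^-1 D1) (is_derive_cst C' (0 : R) 1).
rewrite scaler0 subr0 in D2.
rewrite (_ : g = c^-1 \*: (fun t => c * (C' + g t)) - cst C')//.
apply/funext => t; rewrite /GRing.add /GRing.opp /= /GRing.scale /= mulKf ?gt_eqF//.
by rewrite addrAC subrr add0r.
Qed.

Let mO : measurable Omega. Proof. exact: open_measurable_rV. Qed.
Let mBO : measurable (B `&` Omega). Proof. exact: measurableI. Qed.
Let mnB : measurable (~` B). Proof. exact: measurableC. Qed.
Let mnBO : measurable (~` B `&` Omega). Proof. exact: measurableI. Qed.

Let mf (C : set (borelRn R m.+1)) : measurable C ->
  measurable_fun setT (fun x : borelRn R m.+1 => fine (frac_pot s C x)).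
Proof.
by move=> mC; exact: (measurableT_comp (fine_measurable measurableT) (measurable_frac_pot s mC)).
Qed.

Let f0 (C : set (borelRn R m.+1)) x : 0 <= fine (frac_pot s C x).
Proof. by rewrite fine_ge0// frac_pot_ge0. Qed.

Let K := d `^ (- @frac_exp R m.+1 s) * fine (volm Omega).

Let fK (C : set (borelRn R m.+1)) x : measurable C -> C `<=` Omega -> box z e x ->
  fine (frac_pot s C x) <= K.
Proof.
move=> mC CO xB; have CleO : (volm C <= volm Omega)%E by apply: le_measure; rewrite ?inE.
have Coo : (volm C < +oo)%E by exact: le_lt_trans Ooo.
apply: le_trans (@fine_frac_pot_le _ _ _ s0 _ _ d mC Coo d0 _) _.
  by move=> y /CO; exact: far.
by apply: ler_wpM2l; [exact: powR_ge0|rewrite fine_le// ge0_fin_numE].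
Qed.

Let v0 : 0 <= v. Proof. exact: fine_ge0. Qed.

Lemma flow_int_pot_estimate (A C : set (borelRn R m.+1)) : measurable A -> measurable C ->
  C `<=` Omega -> exists2 c : R, 0 <= c & forall t : R, `|t| <= e ->
  `|flow_int i z e A (fun x => fine (frac_pot s C x)) t
    - flow_int i z e A (fun x => fine (frac_pot s C x)) 0
    - t * \int[volm]_(x in box z e `&` A) (fine (frac_pot s C x) * d_rho i z e x)| <= (pot_lip * `|t| + c * t ^+ 2) * v.
Proof.
move=> mA mC CO; apply: (@flow_int_estimate _ _ i z e e0 A _ K) => //.
- exact: mf.
- by rewrite mulr_ge0 ?powR_ge0 ?fine_ge0.
- exact: pot_lip_ge0.
- by move=> x xB; exact: fK.
- move=> t x xB; apply: frac_pot_lip => //; first exact: bump_flow_box.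
  by move=> j; exact: bump_flow_dist.
Qed.

(** The sum of the two flow integrals changes by o(t), and each is linear in t up to [pot_lip * |t|]
    per unit of volume: divide by t and let t tend to 0. *)
Lemma critical_integral_bound :
  `|\int[volm]_(x in box z e `&` ~` B) (f1 x * d_rho i z e x)
    + \int[volm]_(x in box z e `&` B) (f2 x * d_rho i z e x)| <= 2 * pot_lip * v.
Proof.
have [c1 c10 E1] := flow_int_pot_estimate mnB mBO (@subIsetr _ _ _).
have [c2 c20 E2] := flow_int_pot_estimate mB mnBO (@subIsetr _ _ _).
set S1 := Rintegral _ _ _ in E1 *; set S2 := Rintegral _ _ _ in E2 *.
suff H (eta : R) : 0 < eta -> `|S1 + S2| <= 2 * pot_lip * v + eta by apply/ler_addgt0Pr.
move=> eta0; have eta20 : 0 < eta / 2 by rewrite divr_gt0.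
have cv0 : 0 <= (c1 + c2) * v by rewrite mulr_ge0 ?addr_ge0.
(* Half of [eta] pays for the quadratic remainders and half for the derivative. *)
pose r : R := Num.min e (eta / 2 / ((c1 + c2) * v + 1)).
have r0 : 0 < r.
  by rewrite /r lt_min e0 divr_gt0// ltr_wpDl.
have nr : \forall t \near (0 : R)^', `|t| <= r by exact: dnbhs0_le.
have [t [[t0 tg] tr]] := filter_ex (filterI (filterI (nbhs_dnbhs_neq (0 : R))
  (is_derive0_near flow_int_critical eta20)) nr).
move: tr; rewrite /r le_min => /andP[te]; rewrite ler_pdivlMr; last by rewrite ltr_wpDl.
move=> tc; have {}E1 := E1 t te; have {}E2 := E2 t te.
have tp : 0 < `|t| by rewrite normr_gt0.
rewrite -(ler_pM2l tp) -normrM.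
set g1 := flow_int i z e (~` B) _ in E1 tg; set g2 := flow_int i z e B _ in E2 tg.
rewrite (_ : t * (S1 + S2) = (g1 t + g2 t - (g1 0 + g2 0))
   - (g1 t - g1 0 - t * S1) - (g2 t - g2 0 - t * S2)); last by ring.
apply: le_trans (ler_normB _ _) _; apply: le_trans (lerD (ler_normB _ _) (lexx _)) _.
apply: le_trans (lerD (lerD tg E1) E2) _.
rewrite (_ : _ + _ = `|t| * (2 * pot_lip * v) + `|t| * (eta / 2)
   + (c1 + c2) * v * t ^+ 2); last by ring.
rewrite -[t ^+ 2]real_normK ?num_real// mulrDr -addrA lerD2l.
apply: (@le_trans _ _ (`|t| * (eta / 2) + `|t| * (eta / 2))); last first.
  by rewrite -mulrDr -splitr.
rewrite lerD2l expr2 mulrA mulrC; apply: ler_wpM2l => //.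
by rewrite mulrC; apply: le_trans tc; rewrite ler_wpM2l// lerDl.
Qed.

Lemma integral_pot_d_rho (A C : set (borelRn R m.+1)) (M : R) :
  measurable A -> measurable C -> C `<=` Omega -> 0 <= M ->
  (forall y : R, `|y| <= 1 -> `|bumpR' y| <= M) ->
  `|\int[volm]_(x in box z e `&` A) (fine (frac_pot s C x) * d_rho i z e x)
    - fine (frac_pot s C z) * \int[volm]_(x in box z e `&` A) d_rho i z e x| <= pot_lip * M * v.
Proof.
move=> mA mC CO M0 HM.
apply: (integral_lip_d_rho i e0 (f := fun x => fine (frac_pot s C x)) (K := K)) => //.
- exact: mf.
- by apply: mulr_ge0; [exact: powR_ge0|exact: fine_ge0].
- exact: pot_lip_ge0.
- by move=> x xB; rewrite ger0_norm; [exact: fK|exact: f0].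
- move=> x xB; apply: frac_pot_lip => //; [|exact: ltW|].
    by rewrite box_ball//; exact: ballxx.
  by move=> j; move: xB; rewrite box_ball// => /ball_rVP => /(_ e0) /(_ j) /ltW; rewrite distrC.
Qed.

(** Freeze both potentials at [z]. The integrals of [d_rho] over the two parts of the box are
    opposite, so the difference of the potentials factors out. *)
Lemma first_variation_bound (M : R) : 0 <= M ->
  (forall y : R, `|y| <= 1 -> `|bumpR' y| <= M) ->
  `|fine (frac_pot s (~` B `&` Omega) z) - fine (frac_pot s (B `&` Omega) z)|
    * `|\int[volm]_(x in box z e `&` B) d_rho i z e x| <= 2 * pot_lip * (1 + M) * v.
Proof.
move=> M0 HM.
have H1 := integral_pot_d_rho mnB mBO (@subIsetr _ _ _) M0 HM.
have H2 := integral_pot_d_rho mB mnBO (@subIsetr _ _ _) M0 HM.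
have H := critical_integral_bound.
set S1 := Rintegral _ _ _ in H1 H; set S2 := Rintegral _ _ _ in H2 H.
set I1 := Rintegral _ _ _ in H1; set I2 := Rintegral _ _ _ in H2 *.
have mbox := measurable_box z e.
have I12 : I1 = - I2.
  apply/eqP; rewrite -addr_eq0 -Rintegral_setU.
  - rewrite -setIUr setvU setIT; apply/eqP; exact: Rintegral_d_rho0.
  - exact: measurableI.
  - exact: measurableI.
  - rewrite -setIUr setvU setIT; apply: (integrable_bounded (K := M / e)) => //.
    + exact: volm_box_fin.
    + exact: measurable_d_rho.
    + exact: d_rho_bound.
  - by apply/disj_setPS => x [[_ nb] [_ b]].
rewrite -normrM mulrBl.
set w1 := fine _ in H1 *; set w2 := fine _ in H2 *.
rewrite (_ : w2 * I2 - w1 * I2 = S1 + S2 - (S1 - w1 * I1) - (S2 - w2 * I2)); last by rewrite I12; ring.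
apply: le_trans (ler_normB _ _) _; apply: le_trans (lerD (ler_normB _ _) (lexx _)) _.
apply: le_trans (lerD (lerD H H1) H2) _.
by rewrite le_eqVlt; apply/orP; left; apply/eqP; ring.
Qed.

End first_variation.


(** * Averages at scale e and their first-order expansion *)

Section bump_taylor.
Context {R : realType}.

(** Such points are minima of the nonnegative [bumpR]; this covers the end points too. *)
Lemma bumpR'_eq0 (x : R) : 1 <= `|x| -> bumpR' x = 0.
Proof.
move=> x1; have D : is_derive x 1 (@bumpR R) 0.
  apply: (@derive1_at_min _ _ (x - 1) (x + 1)).
  - by lra.
  - by move=> t _; have [] := is_derive_bump t.
  - by rewrite in_itv/=; lra.
  - by move=> t _; rewrite (bump_eq0 x1) bump_ge0.
by have [_ <-] := D; have [_ ->] := is_derive_bump x.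
Qed.

Lemma bumpR'_lipschitz (M : R) : 0 <= M ->
  (forall x y : R, `|x| <= 1 -> `|y| <= 1 -> `|bumpR' x - bumpR' y| <= M * `|x - y|) ->
  forall x y : R, `|bumpR' x - bumpR' y| <= M * `|x - y|.
Proof.
move=> M0 HM x y.
(* Clamping to [-1, 1] is 1-Lipschitz and leaves [bumpR'] unchanged. *)
pose cl (u : R) : R := if u <= -1 then -1 else if 1 <= u then 1 else u.
have cl1 u : `|cl u| <= 1.
  rewrite /cl; case: (leP u (-1)) => u1; first by rewrite normrN1.
  by case: (leP 1 u) => u2; rewrite ?normr1// ler_norml; lra.
have clE u : bumpR' u = bumpR' (cl u).
  rewrite /cl; case: (leP u (-1)) => u1.
    by rewrite !bumpR'_eq0 ?normrN1// ler_normr; apply/orP; right; lra.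
  case: (leP 1 u) => u2; last by [].
  by rewrite !bumpR'_eq0 ?normr1// ler_normr u2.
rewrite clE (clE y); apply: le_trans (HM _ _ (cl1 _) (cl1 _)) _.
apply: ler_wpM2l => //.
wlog xy : x y / x <= y.
  move=> H; have [|/ltW] := leP x y; first exact: H.
  by move/H; rewrite distrC (distrC y).
rewrite [in leRHS]distrC [in leRHS]ger0_norm ?subr_ge0// ler_norml /cl.
by case: (leP x (-1)) => x1; case: (leP y (-1)) => y1; case: (leP 1 x) => x2; case: (leP 1 y) => y2; lra.
Qed.

Lemma bump_taylor : exists2 M : R, 0 < M & forall y k : R,
  `|bumpR (y - k) - bumpR y + k * bumpR' y| <= M * k ^+ 2.
Proof.
have [M [M0 _ HM]] := @bumpR'_bounds R; exists M => // y k.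
have [c cy E] := MVT_between y (y - k) (@is_derive_bump R).
have {}cy : `|c - y| <= `|k| by move: cy; rewrite addrAC subrr add0r normrN.
rewrite E (_ : _ + _ = - k * (bumpR' c - bumpR' y)); last by ring.
rewrite normrM normrN -real_normK ?num_real// expr2 mulrCA; apply: ler_wpM2l => //.
apply: le_trans (bumpR'_lipschitz (ltW M0) HM _ _) _.
by rewrite ler_wpM2l// ltW.
Qed.

End bump_taylor.

Section averages.
Context {R : realType} {m : nat}.
Variable e : R.
Hypothesis e0 : 0 < e.
Implicit Types (z : 'rV[R]_m.+1) (A : set (borelRn R m.+1)).

(** An average without normalization; the total mass to compare with is [favg setT 0]. *)
Definition favg A z : R := \int[volm]_(x in A) rho z e x.

Lemma favg_restrict A z (Q : set (borelRn R m.+1)) :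
  box z e `<=` Q -> favg A z = \int[volm]_(x in Q `&` A) rho z e x.
Proof.
move=> BQ; rewrite /favg /Rintegral; congr fine.
rewrite [in RHS]integral_mkcond [in LHS]integral_mkcond; apply: eq_integral => x _.
rewrite !patchE in_setI; have [xB|xB] := pselect (box z e x).
  by rewrite [x \in Q]mem_set//; exact: BQ.
by rewrite rho_out//; case: ifP; case: ifP.
Qed.

Lemma d_rho_out i z x : ~ box z e x -> d_rho i z e x = 0.
Proof.
move=> xB; have /existsNP[j /negP] : ~ forall j, `|(x 0 j - z 0 j) / e| < 1.
  by move=> h; apply: xB; apply/boxP.
rewrite -leNgt /d_rho; case: (unliftP i j) => [k|] -> hj; last by rewrite bumpR'_eq0// !mul0r.
by rewrite /rho_other (bigD1 k)//= bump_eq0// mul0r mulr0 mul0r.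
Qed.

(** Moving the centre differentiates the bump with the opposite sign, so the first variation
    inequality is a gradient bound for the averages of [B]. *)
Lemma favg_taylor : exists2 C : R, 0 <= C & forall A i z h, measurable A -> `|h| <= e ->
  `|favg A (z + h *: delta_mx 0 i) - favg A z
    + h * \int[volm]_(x in box z e `&` A) d_rho i z e x| <= C * h ^+ 2.
Proof.
have [M M0 HM] := @bump_taylor R.
have e20 : 0 < 2 * e by rewrite mulr_gt0.
(* The cube of half-side 2e contains both supports since |h| <= e; the integrand is at most M
   (h/e)^2. *)
exists (M / e ^+ 2 * (2 * e *+ 2) ^+ m.+1).
  by rewrite mulr_ge0 ?exprn_ge0 ?mulrn_wge0 ?(ltW e20)// divr_ge0 ?exprn_ge0// ltW.
move=> A i z h mA he.
pose Q : set (borelRn R m.+1) := box z (2 * e).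
have mQ : measurable Q by exact: measurable_box.
have Qoo : (volm Q < +oo)%E by exact: volm_box_fin.
have mQA : measurable (Q `&` A) by exact: measurableI.
have QAoo : (volm (Q `&` A) < +oo)%E.
  by apply: le_lt_trans Qoo; apply: le_measure; rewrite ?inE.
have BQ : box z e `<=` Q.
  move=> x; rewrite /Q !box_ball//; apply: le_ball; rewrite ler_peMl ?(ltW e0)//.
  by rewrite ler1n.
have zE (k : 'I_m.+1) : (z + h *: delta_mx 0 i) 0 k = z 0 k + h * (k == i)%:R.
  by rewrite !mxE eqxx.
have B'Q : box (z + h *: delta_mx 0 i) e `<=` Q.
  move=> x; rewrite /Q !box_ball// => /ball_rVP => /(_ e0) xB; apply/ball_rVP => // k.
  have := xB k; rewrite zE => xk.
  rewrite (_ : z 0 k - x 0 k = (z 0 k + h * (k == i)%:R - x 0 k) - h * (k == i)%:R); last by ring.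
  apply: le_lt_trans (ler_normB _ _) _.
  rewrite mulrDl mul1r; apply: ltr_leD => //.
  by rewrite normrM; case: eqP => _; rewrite ?normr1 ?mulr1// normr0 mulr0 ltW.
rewrite (favg_restrict _ B'Q) (favg_restrict _ BQ).
have dE : \int[volm]_(x in box z e `&` A) d_rho i z e x = \int[volm]_(x in Q `&` A) d_rho i z e x.
  rewrite Rintegral_mkcond [RHS]Rintegral_mkcond; apply: eq_Rintegral => x _.
  rewrite !patchE !in_setI; have [xB|xB] := pselect (box z e x).
    by rewrite (mem_set xB) (mem_set (BQ _ xB)).
  by rewrite (memNset xB) d_rho_out//=; case: ifP.
have Irho y : (volm).-integrable (Q `&` A) (EFin \o rho y e).
  apply: (integrable_bounded (K := 1)) => //; first exact: measurable_rho.
  by move=> x _; rewrite ger0_norm ?rho_ge0// rho_le1.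
have [M' [M'0 HM' _]] := @bumpR'_bounds R.
have md := @measurable_d_rho R m i z e.
have Id : (volm).-integrable (Q `&` A) (EFin \o d_rho i z e).
  apply: (integrable_bounded (K := M' / e)) => // x _.
  have [xB|xB] := pselect (box z e x); first exact: d_rho_bound.
  by rewrite d_rho_out// normr0 divr_ge0// ltW.
have Ihd : (volm).-integrable (Q `&` A) (EFin \o (fun x => h * d_rho i z e x)).
  apply: (integrable_bounded (K := `|h| * (M' / e))) => //; first exact: measurable_funM.
  move=> x _; rewrite normrM ler_wpM2l//.
  have [xB|xB] := pselect (box z e x); first exact: d_rho_bound.
  by rewrite d_rho_out// normr0 divr_ge0// ltW.
have Isub : (volm).-integrable (Q `&` A)
    (EFin \o (fun x => rho (z + h *: delta_mx 0 i) e x - rho z e x)).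
  apply: (integrable_bounded (K := 2)) => //.
    by apply: measurable_funB; exact: measurable_rho.
  move=> x _; apply: le_trans (ler_normB _ _) _.
  rewrite !ger0_norm ?rho_ge0//.
  by apply: le_trans (lerD (rho_le1 _ _ _) (rho_le1 _ _ _)) _; lra.
rewrite dE -RintegralZl// -RintegralB// -RintegralD//.
rewrite (_ : _ * h ^+ 2 = M / e ^+ 2 * h ^+ 2 * fine (volm Q)); last first.
  by rewrite volm_box//= mulrAC.
apply: Rintegral_bound => //.
- apply: measurable_funD; last exact: measurable_funM.
  by apply: measurable_funB; exact: measurable_rho.
- by rewrite mulr_ge0 ?sqr_ge0// divr_ge0 ?exprn_ge0// ltW.
- move=> x _; rewrite !(rhoE i).
  have -> : rho_other i (z + h *: delta_mx 0 i) e x = rho_other i z e x.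
    apply: eq_bigr => k _; rewrite zE (_ : lift i k == i = false) ?mulr0 ?addr0//.
    by rewrite eq_sym (negbTE (neq_lift _ _)).
  rewrite zE eqxx mulr1 /d_rho.
  set r := rho_other i z e x; set y := (x 0 i - z 0 i) / e.
  have -> : (x 0 i - (z 0 i + h)) / e = y - h / e by rewrite /y; ring.
  have HMy := HM y (h / e).
  set b1 := bumpR (y - _) in HMy *; set b2 := bumpR y in HMy *; set b3 := bumpR' y in HMy *.
  rewrite (_ : _ + _ = r * (b1 - b2 + h / e * b3)); last by ring.
  rewrite normrM ger0_norm ?rho_other_ge0//.
  rewrite [leRHS](_ : _ = M * (h / e) ^+ 2); last by field; rewrite gt_eqF.
  apply: le_trans HMy; rewrite ler_piMl//; exact: rho_other_le1.
Qed.

End averages.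


(** * From short steps to the oscillation on a ball *)

Section coordinatewise_lipschitz.
Context {R : realType} {n : nat}.
Variables (F : 'rV[R]_n -> R) (x0 : 'rV[R]_n) (r e D C : R).
Hypotheses (r0 : 0 < r) (e0 : 0 < e) (D0 : 0 <= D) (C0 : 0 <= C).
Implicit Types z : 'rV[R]_n.
Hypothesis FD : forall i z h, ball x0 r z -> `|h| <= e ->
  `|F (z + h *: delta_mx 0 i) - F z| <= D * `|h| + C * h ^+ 2.

Let add_deltaE i z h k : (z + h *: delta_mx 0 i) 0 k = z 0 k + h * (k == i)%:R.
Proof. by rewrite !mxE eqxx. Qed.

Let steps i z h (N : nat) : ball x0 r z -> ball x0 r (z + (N%:R * h) *: delta_mx 0 i) ->
  `|h| <= e -> `|F (z + (N%:R * h) *: delta_mx 0 i) - F z| <= N%:R * (D * `|h| + C * h ^+ 2).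
Proof.
move=> /(ball_rVP _ _ r0) zU /(ball_rVP _ _ r0) z'U he.
have segU (k : nat) : (k <= N)%N -> ball x0 r (z + (k%:R * h) *: delta_mx 0 i).
  move=> kN; apply/ball_rVP => // j; have := zU j; have := z'U j.
  rewrite !add_deltaE; case: eqP => _; last by rewrite !mulr0 !addr0.
  rewrite !mulr1 !ltr_norml => /andP[a1 a2] /andP[b1 b2].
  have kN' : k%:R <= N%:R :> R by rewrite ler_nat.
  have k0 : 0 <= k%:R :> R by [].
  by have [hp|hn] := leP 0 h; apply/andP; split; nra.
suff H (k : nat) : (k <= N)%N ->
    `|F (z + (k%:R * h) *: delta_mx 0 i) - F z| <= k%:R * (D * `|h| + C * h ^+ 2) by exact: H.
elim: k => [_|k IH kN]; first by rewrite !mul0r scale0r addr0 subrr normr0.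
have := FD i (segU _ (ltnW kN)) he; rewrite -addrA -scalerDl -[in X in _ -> X]natr1 mulrDl mul1r => H.
rewrite -(subrKA (F (z + (k%:R * h) *: delta_mx 0 i))) [leRHS]mulrDl mul1r addrC.
by apply: le_trans (ler_normD _ _) _; rewrite addrC addrC; apply: lerD => //; exact: IH (ltnW kN).
Qed.

(** Subdivision removes the quadratic term: N steps of length h/N cost only C h^2/N of it. This
    matters because [C] blows up as e tends to 0. *)
Let lip1 i z h : ball x0 r z -> ball x0 r (z + h *: delta_mx 0 i) ->
  `|F (z + h *: delta_mx 0 i) - F z| <= D * `|h|.
Proof.
move=> zU z'U.
suff H (eta : R) : 0 < eta -> `|F (z + h *: delta_mx 0 i) - F z| <= D * `|h| + eta.
  exact/ler_addgt0Pr.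
(* One summand makes the steps at most [e], the other makes the total quadratic error at most
   [eta]. *)
move=> eta0; pose N := (Num.truncn (`|h| / e + C * h ^+ 2 / eta)).+1.
have Nh : `|h| / e + C * h ^+ 2 / eta < N%:R by exact: truncnS_gt.
have N0 : 0 < N%:R :> R by rewrite ltr0n.
have p1 : 0 <= `|h| / e by rewrite divr_ge0// ltW.
have p2 : 0 <= C * h ^+ 2 / eta by rewrite divr_ge0 ?(ltW eta0)// mulr_ge0// sqr_ge0.
have hN : N%:R * (h / N%:R) = h by rewrite mulrC divfK// gt_eqF.
have heN : `|h / N%:R| <= e.
  rewrite normrM normfV [`|N%:R|]gtr0_norm// ler_pdivrMr// mulrC -ler_pdivrMr//.
  by apply: le_trans (ltW Nh); rewrite lerDl.
have := @steps i z (h / N%:R) N zU; rewrite hN => /(_ z'U heN) H; apply: le_trans H _.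
rewrite mulrDr; apply: lerD.
  rewrite normrM normfV [`|N%:R|]gtr0_norm// [leLHS](_ : _ = D * `|h|)//.
  by field; rewrite gt_eqF.
rewrite [leLHS](_ : _ = C * h ^+ 2 / N%:R); last by field; rewrite gt_eqF.
rewrite ler_pdivrMr// [leRHS]mulrC -ler_pdivrMr//.
by apply: le_trans (ltW Nh); rewrite lerDr.
Qed.

(** Coordinates are replaced one at a time; a ball of the sup norm is a product, so the intermediate
    points stay inside. *)
Lemma ball_oscillation a b : ball x0 r a -> ball x0 r b ->
  `|F b - F a| <= n%:R * (D * (2 * r)).
Proof.
move=> aU bU; have /(ball_rVP _ _ r0) aj := aU; have /(ball_rVP _ _ r0) bj := bU.
pose p (k : nat) : 'rV[R]_n := \row_j (if (j < k)%N then b 0 j else a 0 j).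
have pU k : ball x0 r (p k).
  by apply/ball_rVP => // j; rewrite mxE; case: ifP.
have p0 : p 0%N = a by apply/rowP => j; rewrite mxE.
have pn : p n = b by apply/rowP => j; rewrite mxE ltn_ord.
have pS (k : 'I_n) : p k.+1 = p k + (b 0 k - a 0 k) *: delta_mx 0 k.
  apply/rowP => j; rewrite add_deltaE !mxE ltnS leq_eqVlt.
  have [->|jk] := eqVneq j k; first by rewrite eqxx ltnn /= mulr1 addrC subrK.
  by rewrite (_ : (j == k :> nat) = false) ?mulr0 ?addr0//; apply/negbTE.
suff H k : (k <= n)%N -> `|F (p k) - F a| <= k%:R * (D * (2 * r)).
  by rewrite -pn; exact: H.
elim: k => [_|k IH kn]; first by rewrite p0 subrr normr0 mul0r.
have := @lip1 (Ordinal kn) (p k) (b 0 (Ordinal kn) - a 0 (Ordinal kn)) (pU k).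
rewrite -[p k + _](pS (Ordinal kn)) => /(_ (pU _)) H.
have hr : `|b 0 (Ordinal kn) - a 0 (Ordinal kn)| <= 2 * r.
  rewrite (_ : _ - _ = (x0 0 (Ordinal kn) - a 0 (Ordinal kn)) - (x0 0 (Ordinal kn) - b 0 (Ordinal kn))); last by ring.
  apply: le_trans (ler_normB _ _) _; rewrite mulrDl mul1r.
  by apply: lerD; apply: ltW; [exact: aj|exact: bj].
rewrite (_ : _ - _ = (F (p k.+1) - F (p k)) + (F (p k) - F a)); last by ring.
apply: le_trans (ler_normD _ _) _; rewrite -natr1 mulrDl mul1r addrC.
apply: lerD; first exact: IH (ltnW kn).
by apply: le_trans H _; exact: ler_wpM2l.
Qed.

End coordinatewise_lipschitz.


(** * Mollification and sets of small density *)

Section mollifier.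
Context {R : realType} {m : nat}.
Variable e : R.
Hypothesis e0 : 0 < e.
Implicit Types (z : 'rV[R]_m.+1) (A V : set (borelRn R m.+1)).

Lemma rho_sym z x : rho z e x = rho x e z.
Proof.
apply: eq_bigr => j _; rewrite -bumpN; congr bumpR.
by rewrite -mulNr opprB.
Qed.

Lemma measurable_rho2 : measurable_fun setT
  (fun p : borelRn R m.+1 * borelRn R m.+1 => rho (p.1 : 'rV_m.+1) e p.2).
Proof.
apply: measurable_prod => j _.
have mb : measurable_fun setT (@bumpR R).
  by apply: continuous_measurable_fun; exact: continuous_bump.
apply: (measurableT_comp mb); apply: measurable_funM => //; apply: measurable_funB.
  exact: (measurableT_comp (measurable_coord j) measurable_snd).
exact: (measurableT_comp (measurable_coord j) measurable_fst).
Qed.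

Lemma integrable_rho A z : measurable A -> (volm).-integrable A (EFin \o rho z e).
Proof.
move=> mA; have mbox := measurable_box z e.
apply/integrableP; split.
  by apply/measurable_EFinP; apply: measurable_funTS; exact: measurable_rho.
apply: (@le_lt_trans _ _ (volm (box z e : set (borelRn R m.+1)))); last exact: volm_box_fin.
rewrite -(setIT (box z e)) -integral_indic//.
apply: (@le_trans _ _ (\int[volm]_(x in A) (\1_(box z e) x)%:E)%E).
  apply: ge0_le_integral => //.
  - apply: measurableT_comp => //; apply/measurable_EFinP; apply: measurable_funTS.
    exact: measurable_rho.
  - by apply/measurable_EFinP; apply: measurable_funTS; exact: measurable_indic.
  - move=> x _; rewrite /= lee_fin ger0_norm ?rho_ge0// indicE.
    have [xB|xB] := pselect (box z e x); first by rewrite mem_set// rho_le1.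
    by rewrite rho_out.
by apply: ge0_subset_integral => //; apply/measurable_EFinP; exact: measurable_indic.
Qed.

Lemma favg_fin A z : measurable A -> (\int[volm]_(x in A) (rho z e x)%:E = (favg e A z)%:E)%E.
Proof.
by move=> mA; rewrite /favg /Rintegral fineK//; apply: integrable_fin_num (integrable_rho _ _).
Qed.

Lemma favgC A z : measurable A -> favg e A z + favg e (~` A) z = favg e setT z.
Proof.
move=> mA; have mAC : measurable (~` A) by exact: measurableC.
rewrite /favg -Rintegral_setU//.
- by rewrite setUv.
- exact: integrable_rho (measurableU _ _ mA mAC).
- by apply/disj_setPS => x [].
Qed.

Lemma favg_ge0 A z : 0 <= favg e A z.
Proof. by apply: fine_ge0; apply: integral_ge0 => x _; rewrite lee_fin rho_ge0. Qed.

Lemma favg_translate z : favg e setT z = favg e setT (0 : 'rV[R]_m.+1).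
Proof.
rewrite /favg /Rintegral; congr fine.
pose c := fun x : borelRn R m.+1 => ((x : 'rV_m.+1) - z)%R : borelRn R m.+1.
have mc : measurable_fun setT c.
  apply: measurable_rV => j; rewrite (_ : (fun _ => _) =
     (fun x : borelRn R m.+1 => (x : 'rV_m.+1) 0 j - z 0 j)%R).
    by apply: measurable_funB => //; exact: measurable_coord.
  by apply/funext => x; rewrite !mxE.
pose P : measure (borelRn R m.+1) R := @measure_function_pushforward__canonical__measure_function_Measure
  _ _ _ _ R (@volm R m.+1) c mc.
transitivity (\int[P]_x (rho 0 e x)%:E)%E.
  have mr : measurable_fun setT (fun x : borelRn R m.+1 => (rho (0 : 'rV[R]_m.+1) e x)%:E).
    by apply/measurable_EFinP; exact: measurable_rho.
  have r0 : {in [set: borelRn R m.+1], forall x, (0 <= (rho (0 : 'rV[R]_m.+1) e x)%:E)%E}.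
    by move=> x _; rewrite lee_fin rho_ge0.
  rewrite (ge0_integral_pushforward mc volm measurableT mr r0).
  apply: eq_integral => x _ /=; congr EFin; apply: eq_bigr => j _.
  by rewrite !mxE subr0.
by apply: eq_measure_integral => A mA _; exact: volm_translate.
Qed.

Let rho2_ge0 (p : borelRn R m.+1 * borelRn R m.+1) : 0 <= rho (p.1 : 'rV_m.+1) e p.2.
Proof. exact: rho_ge0. Qed.

Let measurable_slice A : measurable A ->
  measurable_fun setT (fun x : borelRn R m.+1 => \int[volm]_(z in A) (rho (x : 'rV_m.+1) e z)%:E)%E.
Proof. by move=> mA; exact: (measurable_integral_snd measurable_rho2 rho2_ge0 mA). Qed.

Lemma measurable_favg A : measurable A -> measurable_fun setT (favg e A : borelRn R m.+1 -> R).
Proof.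
move=> mA; apply/measurable_EFinP.
rewrite (_ : EFin \o _ = fun x : borelRn R m.+1 => (\int[volm]_(z in A) (rho (x : 'rV_m.+1) e z)%:E)%E).
  exact: measurable_slice.
by apply/funext => x; rewrite (favg_fin x mA).
Qed.

Lemma integral_favg A V : measurable A -> measurable V ->
  (\int[volm]_(x in A) (favg e V x)%:E = \int[volm]_(x in V) (favg e A x)%:E)%E.
Proof.
move=> mA mV.
have E1 x := favg_fin x mA; have E2 x := favg_fin x mV.
under eq_integral do rewrite -E2.
under [RHS]eq_integral do rewrite -E1.
rewrite (tonelli_sets measurable_rho2 rho2_ge0 mA mV); apply: eq_integral => z _.
by apply: eq_integral => x _ /=; rewrite rho_sym.
Qed.

Let integral_favg_le A V (c : R) : measurable A -> measurable V ->
  (forall z, V z -> favg e A z <= c) ->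
  (\int[volm]_(z in V) (favg e A z)%:E <= c%:E * volm V)%E.
Proof.
move=> mA mV Ac; rewrite -integral_cst//.
have mf : measurable_fun V (fun z : borelRn R m.+1 => (favg e A z)%:E).
  by apply/measurable_EFinP; apply: measurable_funTS; exact: measurable_favg.
apply: ge0_le_integral => //.
by move=> z _; rewrite lee_fin; exact: favg_ge0.
Qed.

(* Integrate the averages over V and exchange the integrals: every point of S is
   seen with the full mass of the bump. *)
Lemma average_density A V (S : set (borelRn R m.+1)) (q : R) :
  measurable A -> measurable V -> measurable S -> 0 < favg e setT (0 : 'rV[R]_m.+1) ->
  (forall x, S x -> box x e `<=` V) ->
  (forall z, V z -> favg e A z <= q * favg e setT (0 : 'rV[R]_m.+1)) ->
  (volm (A `&` S) <= q%:E * volm V)%E.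
Proof.
move=> mA mV mS M0 SV qV; have M0' : (0 < (favg e setT (0 : 'rV[R]_m.+1))%:E)%E by rewrite lte_fin.
have mAS : measurable (A `&` S) by exact: measurableI.
rewrite -(lee_pmul2l _ M0')// muleA -EFinM [X in (X%:E * volm V)%E]mulrC.
apply: le_trans (integral_favg_le mA mV qV); rewrite -integral_favg//.
have cE (c : R) : (c%:E * volm (A `&` S) = \int[volm]_(x in A `&` S) c%:E)%E.
  by rewrite integral_cst.
rewrite cE.
have mf : measurable_fun setT (fun z : borelRn R m.+1 => (favg e V z)%:E).
  by apply/measurable_EFinP; exact: measurable_favg.
apply: (@le_trans _ _ (\int[volm]_(x in A `&` S) (favg e V x)%:E)%E).
  rewrite le_eqVlt; apply/orP; left; apply/eqP; apply: eq_integral => x; rewrite inE => -[_ Sx].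
  by rewrite /= -(favg_translate x) (favg_restrict e0 setT (SV _ Sx)) setIT.
apply: ge0_subset_integral.
- exact: mAS.
- exact: mA.
- exact: measurable_funTS mf.
- by move=> x _; rewrite lee_fin favg_ge0.
- exact: subIsetl.
Qed.

End mollifier.

Section density.
Context {R : realType} {m : nat}.

Lemma bump_lower_bound : exists2 b : R, 0 < b & forall (z x : 'rV[R]_m.+1) e, 0 < e ->
  box z (e / 2) x -> b <= rho z e x.
Proof.
have h2 : - 2^-1 <= 2^-1 :> R by lra.
have [|c] := @EVT_min R (@bumpR R) _ _ h2.
  by apply: continuous_subspaceT => x; exact: continuous_bump.
rewrite in_itv/= => cI cmin.
have c0 : 0 < bumpR c.
  by apply: bump_gt0; rewrite ltr_norml; apply/andP; split; lra.
exists (bumpR c ^+ m.+1) => [|z x e e0]; first exact: exprn_gt0.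
rewrite box_ball ?divr_gt0// => /ball_rVP => /(_ (divr_gt0 e0 (ltr0Sn _ 1))) xB.
rewrite /rho -[m.+1 in leLHS]card_ord -prodr_const; apply: ler_prod => j _.
rewrite (ltW c0)/=; apply: cmin.
have := xB j; rewrite distrC ltr_norml => /andP[h1 h3].
rewrite in_itv/= ler_pdivrMr// ler_pdivlMr//; apply/andP; split; lra.
Qed.

(** The total mass is comparable to the volume of the box at every scale: the bump is bounded below
    on the concentric box of half the side. *)
Lemma favg_lower_bound : exists2 b : R, 0 < b & forall e : R, 0 < e ->
  b * fine (volm (box (0 : 'rV[R]_m.+1) e : set (borelRn R m.+1))) <= favg e setT (0 : 'rV[R]_m.+1).
Proof.
have [b b0 Hb] := bump_lower_bound.
exists (b / 2 ^+ m.+1) => [|e e0]; first by rewrite divr_gt0// exprn_gt0.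
have e20 : 0 < e / 2 by rewrite divr_gt0.
have mb := measurable_box (0 : 'rV[R]_m.+1) (e / 2).
have -> : b / 2 ^+ m.+1 * fine (volm (box (0 : 'rV[R]_m.+1) e : set (borelRn R m.+1))) =
    b * fine (volm (box (0 : 'rV[R]_m.+1) (e / 2) : set (borelRn R m.+1))).
  rewrite !volm_box//= -mulrA -exprVn -exprMn; congr (_ * _ ^+ _).
  by rewrite mulrnAr mulrC.
rewrite -Rintegral_cst ?volm_box_fin//.
have -> : favg e setT (0 : 'rV[R]_m.+1) = \int[volm]_(x in setT) rho (0 : 'rV[R]_m.+1) e x by [].
rewrite /Rintegral; apply: fine_le.
- by rewrite integral_cst// fin_numM//; rewrite ge0_fin_numE// volm_box_fin.
- by apply: integrable_fin_num => //; exact: integrable_rho.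
apply: (@le_trans _ _ (\int[volm]_(x in box (0 : 'rV[R]_m.+1) (e / 2)) (rho (0 : 'rV[R]_m.+1) e x)%:E)%E).
  apply: ge0_le_integral => //.
  - by move=> x _; rewrite lee_fin ltW.
  - by apply/measurable_EFinP; apply: measurable_funTS; exact: measurable_rho.
  - by move=> x xB; rewrite lee_fin Hb.
apply: ge0_subset_integral => //.
- by apply/measurable_EFinP; exact: measurable_rho.
- by move=> x _; rewrite lee_fin rho_ge0.
Qed.

Lemma favg_gt0 e : 0 < e -> 0 < favg e setT (0 : 'rV[R]_m.+1).
Proof.
move=> e0; have [b b0 Hb] := favg_lower_bound; apply: lt_le_trans (Hb _ e0).
by rewrite mulr_gt0// volm_box//= exprn_gt0// mulrn_wgt0.
Qed.

(** The points whose bump lives inside [V]; its complement is a union of open balls. *)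
Let inner (V : set 'rV[R]_m.+1) (e : R) : set 'rV[R]_m.+1 := [set x | ball x e `<=` V].

Let measurable_inner V e : 0 < e -> measurable (inner V e : set (borelRn R m.+1)).
Proof.
move=> e0; rewrite -[inner V e]setCK; apply: measurableC; apply: open_measurable_rV.
rewrite (_ : ~` inner V e = \bigcup_(y in ~` V) ball y e).
  by apply: bigcup_open => y _; exact: ball_open.
apply/seteqP; split=> x.
  move=> /existsNP[y /not_implyP[xy Vy]]; exists y => //; exact: ball_sym.
by move=> [y Vy /ball_sym xy] /(_ _ xy).
Qed.

Variables (A : set (borelRn R m.+1)) (U : set 'rV[R]_m.+1) (q : R).
Hypotheses (mA : measurable A) (q01 : 0 <= q < 1).
Hypothesis small : forall eps : R, 0 < eps ->
  exists e : R, [/\ 0 < e, e <= eps & forall z, U z -> favg e A z <= q * favg e setT (0 : 'rV[R]_m.+1)].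

(** [average_density] at arbitrarily small scales, applied to the inner sets that exhaust [V]. *)
Lemma open_density (V : set 'rV[R]_m.+1) : open V -> V `<=` U ->
  (volm (A `&` V) <= q%:E * volm (V : set (borelRn R m.+1)))%E.
Proof.
move=> oV VU; have mV : measurable (V : set (borelRn R m.+1)) by exact: open_measurable_rV.
pose S (k : nat) : set (borelRn R m.+1) := A `&` inner V k.+1%:R^-1.
have mS k : measurable (S k) by apply: measurableI => //; apply: measurable_inner; rewrite invr_gt0.
have SV : \bigcup_k S k = A `&` V.
  apply/seteqP; split=> x.
    by move=> [k _ [Ax]] /(_ x) xV; split => //; apply: xV; exact: ballxx.
  move=> [Ax Vx]; have /nbhs_ballP[d /= d0 dV] : nbhs x V by exact: open_nbhs_nbhs.
  exists (Num.truncn d^-1) => //; split => //; apply: subset_trans dV; apply: le_ball.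
  by rewrite invf_ple ?posrE// ltW// truncnS_gt.
have ndS : nondecreasing_seq S.
  move=> j k jk; apply/subsetPset => x [Ax xV]; split => //; apply: subset_trans xV.
  by apply: le_ball; rewrite lef_pV2 ?posrE// ler_nat.
have mSV : measurable (\bigcup_k S k) by exact: bigcup_measurable.
have cS := @nondecreasing_cvg_mu _ _ _ (@volm R m.+1) _ mS mSV ndS.
rewrite -SV -(cvg_lim _ cS)//; apply: lime_le; first by apply/cvg_ex; eexists; exact: cS.
apply: nearW => k /=; rewrite /S.
have k0 : 0 < k.+1%:R^-1 :> R by rewrite invr_gt0.
have [e [e0 ek He]] := small k0.
apply: (average_density e0) => //.
- exact: measurable_inner.
- exact: favg_gt0.
- by move=> x xV; rewrite box_ball//; apply: subset_trans xV; exact: le_ball.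
- by move=> z /VU; exact: He.
Qed.

(** Does the work of the density theorem: an open [W] containing [A] with small excess gives |A cap
    U| <= q |W cap U| <= q (|A cap U| + eps), and q < 1. *)
Lemma density_null k : open U -> U `<=` @cube R m.+1 k ->
  volm (A `&` U : set (borelRn R m.+1)) = 0%E.
Proof.
move=> oU Uk; have /andP[q0 q1] := q01.
have mU : measurable (U : set (borelRn R m.+1)) by exact: open_measurable_rV.
have mAU : measurable (A `&` U : set (borelRn R m.+1)) by exact: measurableI.
have AUoo : (volm (A `&` U : set (borelRn R m.+1)) < +oo)%E.
  apply: le_lt_trans (@volm_cube_fin R m.+1 k); apply: le_measure; rewrite ?inE//.
    exact: measurable_cube.
  by move=> x [_ /Uk].
have AUfin : volm (A `&` U : set (borelRn R m.+1)) \is a fin_num by rewrite ge0_fin_numE.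
have main (eps : R) : 0 < eps -> fine (volm (A `&` U : set (borelRn R m.+1))) * (1 - q) <= eps.
  move=> eps0; have [W [oW AW Weps]] := volm_outer_regular k mA eps0.
  have oV : open (W `&` U) by exact: openI.
  have := open_density oV (@subIsetr _ _ _).
  rewrite (_ : A `&` (W `&` U) = A `&` U); last first.
    by apply/seteqP; split=> x [Ax]; [move=> [_ Ux]|move=> Ux]; split => //; split => //; exact: AW.
  have mV : measurable (W `&` U : set (borelRn R m.+1)) by exact: open_measurable_rV.
  have mWA : measurable ((W `\` A) `&` @cube R m.+1 k : set (borelRn R m.+1)).
    apply: measurableI; last exact: measurable_cube.
    by apply: measurableD => //; exact: open_measurable_rV.
  have Vle : (volm (W `&` U : set (borelRn R m.+1)) <= volm (A `&` U : set (borelRn R m.+1)) + eps%:E)%E.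
    apply: le_trans (leeD2l _ Weps); apply: le_trans (measureU2 _ mAU mWA).
    apply: le_measure; rewrite ?inE//; first exact: measurableU.
    move=> x [Wx Ux]; have [Ax|nAx] := pselect (A x); [by left|right].
    by split => //; exact: Uk.
  move=> /le_trans /(_ (lee_wpmul2l _ Vle)) => /(_ q0).
  rewrite -(fineK AUfin) -EFinD -EFinM lee_fin => H.
  by have : q * eps <= eps; [rewrite ler_piMl// ltW|lra].
apply/eqP; rewrite -(fineK AUfin) eqe eq_le fine_ge0// andbT.
rewrite -(pmulr_lle0 _ (_ : 0 < 1 - q)) ?subr_gt0//.
by apply/ler_addgt0Pr => eps eps0; rewrite add0r; exact: main.
Qed.

End density.


(** * Elementary inequalities *)

Lemma coord_le_norm (R : realType) n (x : 'rV[R]_n) j : `|x 0 j| <= `|x|.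
Proof.
by rewrite [leRHS]/Num.norm /= mx_normrE; apply/bigmax_geP; right => /=; exists (0, j).
Qed.

Lemma norm_coord_ex (R : realType) n (x : 'rV[R]_n) : 0 < `|x| -> exists j, `|x| = `|x 0 j|.
Proof.
move=> x0; have /mx_norm_neq0[[i j] /= E] : mx_norm x != 0 by rewrite gt_eqF.
by exists j; rewrite [LHS]E (ord1 i).
Qed.

Lemma sqnorm_ge (R : realType) n (x : 'rV[R]_n) (c : R) j : 0 <= c -> c <= `|x 0 j| ->
  c ^+ 2 <= sqnorm x.
Proof.
move=> c0 cx; rewrite /sqnorm (bigD1 j)//= -[x 0 j ^+ 2]real_normK ?num_real//.
apply: (@le_trans _ _ (`|x 0 j| ^+ 2)); first by apply: lerXn2r; rewrite ?nnegrE.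
by rewrite lerDl sumr_ge0// => k _; exact: sqr_ge0.
Qed.

Section distance_inequalities.
Context {R : realType}.
Implicit Types a b c d t D F M : R.

Lemma dist_sub_le a b c d t : `|a - b| <= t -> `|c - d| <= t -> `|a - c| <= `|b - d| + 2 * t.
Proof.
move=> h1 h2; rewrite (_ : a - c = (b - d) + ((a - b) - (c - d))); last by ring.
apply: le_trans (ler_normD _ _) _; rewrite lerD2l mulrDl mul1r.
by apply: le_trans (ler_normB _ _) _; exact: lerD.
Qed.

Lemma dist_ge1 a b c D : D + 3 <= `|a| -> `|a - b| < 2 -> `|c| <= D -> 1 <= `|b - c|.
Proof.
move=> ha hab hc; have : `|a| <= `|a - b| + `|b - c| + `|c|.
  apply: le_trans (lerD (ler_normD _ _) (lexx _)).
  by apply: le_trans (ler_normD _ _); rewrite addrA !subrK.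
by move: ha hab hc; set p := `|a|; set q := `|a - b|; set r := `|b - c|; set u := `|c|; lra.
Qed.

Lemma norm_le_dist a b D : `|a| <= D -> `|a - b| < 2 -> `|b| <= D + 2.
Proof.
move=> ha hab; rewrite (_ : b = a - (a - b)); last by ring.
by apply: le_trans (ler_normB _ _) _; apply: lerD => //; exact: ltW.
Qed.

Lemma average_le F a M : `|F - a| <= M / 4 -> a <= M / 2 -> F <= 3 / 4 * M.
Proof. by rewrite ler_norml => /andP[]; lra. Qed.

Lemma half_le a b r L : 0 <= L -> 0 <= r -> r * (4 * L + 1) <= a -> a <= b + 2 * L * r -> a / 2 <= b.
Proof. by move=> *; nra. Qed.

Lemma complement_dist a b c d M t : a + b = M -> c + d = M -> `|a - c| <= t -> `|b - d| <= t.
Proof. by move=> ab cd; rewrite (_ : a - c = d - b) 1?distrC//; lra. Qed.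

Lemma complement_half a b M : a + b = M -> M / 2 <= a -> b <= M / 2.
Proof. by move=> ab; lra. Qed.

Lemma quotient_bound a b c d t : 0 < a -> a / 2 <= b -> 0 <= c -> b * c <= d * t ->
  c <= d / (a / 2) * t.
Proof.
move=> a0 ab c0 H; have a20 : 0 < a / 2 by rewrite divr_gt0.
rewrite mulrAC ler_pdivlMr// mulrC; apply: le_trans H.
exact: ler_wpM2r.
Qed.

Lemma increment_bound a b c d t h : `|a - b + h * c| <= t -> `|c| <= d ->
  `|a - b| <= d * `|h| + t.
Proof.
move=> H cd; rewrite (_ : a - b = (a - b + h * c) - h * c); last by ring.
apply: le_trans (ler_normB _ _) _; rewrite [leRHS]addrC; apply: lerD => //.
by rewrite normrM mulrC ler_wpM2r.
Qed.

End distance_inequalities.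

(** * Equal potentials at distant boundary points *)

Section critical_points.
Context {R : realType} {m : nat}.
Variables (s D0 : R) (Omega E : set 'rV[R]_m.+1) (B N : set (borelRn R m.+1)).
Hypotheses (s01 : 0 < s < 1) (D00 : 0 <= D0).
Hypotheses (openO : open Omega) (Ooo : (volm (Omega : set (borelRn R m.+1)) < +oo)%E).
Hypothesis OmegaD0 : forall y : 'rV[R]_m.+1, Omega y -> forall j, `|y 0 j| <= D0.
Hypotheses (mB : measurable B) (mN : measurable N) (N0 : volm N = 0%E).
Hypotheses (EB : E `<=` B) (BEN : B `\` E `<=` N).
Hypothesis minE : free_boundary_minimal s Omega E.

Let mO : measurable (Omega : set (borelRn R m.+1)). Proof. exact: open_measurable_rV. Qed.
Let mBO : measurable (B `&` Omega : set (borelRn R m.+1)). Proof. exact: measurableI. Qed.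
Let mnB : measurable (~` B). Proof. exact: measurableC. Qed.
Let mnBO : measurable (~` B `&` Omega : set (borelRn R m.+1)). Proof. exact: measurableI. Qed.

Local Notation w x := (fine (frac_pot s (~` B `&` Omega) x) - fine (frac_pot s (B `&` Omega) x)).

Variables (x0 : 'rV[R]_m.+1) (j0 : 'I_m.+1).
Hypothesis x0far : D0 + 3 <= `|x0 0 j0|.

Let D := `|x0| + 2 + D0.

Let D_ge0 : 0 <= D. Proof. by rewrite !addr_ge0. Qed.

Let OmegaD (y : 'rV[R]_m.+1) : Omega y -> forall j, `|y 0 j| <= D.
Proof. by move=> yO j; apply: le_trans (OmegaD0 yO j) _; rewrite lerDr addr_ge0. Qed.

(** The margin 3 in coordinate [j0] leaves a distance 1 after a move of less than 2. Half-side 2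
    accommodates boxes of size at most 1 centred in the unit ball around [x0]. *)
Let far x y : box x0 2 x -> Omega y -> 1 <= sqnorm (x - y).
Proof.
rewrite box_ball// => /ball_rVP => /(_ (ltr0Sn _ 1)) xB yO.
rewrite -[leLHS](expr1n _ 2); apply: (sqnorm_ge (j := j0)) => //.
by rewrite !mxE; exact: dist_ge1 x0far (xB j0) (OmegaD0 yO j0).
Qed.

Let boxD x : box x0 2 x -> forall j, `|x 0 j| <= D.
Proof.
rewrite box_ball// => /ball_rVP => /(_ (ltr0Sn _ 1)) xB j.
apply: le_trans (norm_le_dist (coord_le_norm x0 j) (xB j)) _.
by rewrite /D lerDl.
Qed.

Let L := pot_lip s 1 D (Omega : set (borelRn R m.+1)).

Let L_ge0 : 0 <= L. Proof. exact: pot_lip_ge0. Qed.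

Let w_near z r : 0 < r -> r <= 1 -> ball x0 r z -> `|w x0| <= `|w z| + 2 * L * r.
Proof.
move=> r0 r1 zU.
have zB : box x0 2 z by rewrite box_ball//; apply: le_ball zU; apply: le_trans r1 _; rewrite ler1n.
have x0B : box x0 2 x0 by rewrite box_ball//; exact: ballxx.
have dz j : `|x0 0 j - z 0 j| <= r by move: zU => /ball_rVP => /(_ r0) /(_ j) /ltW.
have H (C : set (borelRn R m.+1)) : measurable C -> C `<=` Omega ->
    `|fine (frac_pot s C x0) - fine (frac_pot s C z)| <= L * r.
  move=> mC CO.
  exact: (frac_pot_lip s01 ltr01 D_ge0 openO Ooo far boxD OmegaD mC CO x0B zB (ltW r0) dz).
rewrite -mulrA; apply: dist_sub_le.
  exact: H mnBO (@subIsetr _ _ _).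
exact: H mBO (@subIsetr _ _ _).
Qed.

(** The radius is chosen before the scale: the bound on the gradient is a constant times the volume
    of the box, and so a fixed multiple of the total mass at every [e]. *)
Let oscillation : 0 < `|w x0| -> exists r, [/\ 0 < r, r <= 1 & forall e, 0 < e -> e <= 1 ->
  forall z, ball x0 r z -> `|favg e B z - favg e B x0| <= favg e setT (0 : 'rV[R]_m.+1) / 4].
Proof.
move=> w0.
have [M [M0 HM _]] := @bumpR'_bounds R.
have [b b0 Hb] := @favg_lower_bound R m.
(* The constant of [first_variation_bound] divided by a lower bound for |w| near [x0]. *)
pose c := 2 * L * (1 + M) / (`|w x0| / 2).
have c0 : 0 <= c.
  apply: divr_ge0; last by rewrite divr_ge0.
  by apply: mulr_ge0; [exact: mulr_ge0|exact: addr_ge0 ler01 (ltW M0)].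
(* The second term keeps |w| at least |w x0|/2 on the ball. The third keeps (m+1) c v 2r below b
   v/4, hence below a quarter of the total mass; 8 is 2 times 4. *)
pose r := Num.min 1 (Num.min (`|w x0| / (4 * L + 1)) (b / (m.+1%:R * 8 * c + 1))).
have p1 : 0 < 4 * L + 1 by rewrite ltr_wpDl// mulr_ge0.
have p2 : 0 < m.+1%:R * 8 * c + 1.
  by apply: ltr_wpDl => //; apply: mulr_ge0 c0; exact: mulr_ge0.
have r0 : 0 < r by rewrite !lt_min ltr01 !divr_gt0.
have r1 : r <= 1 by rewrite ge_min lexx.
have rw : r * (4 * L + 1) <= `|w x0|.
  by rewrite -ler_pdivlMr// /r !ge_min lexx orbT.
have rb : r * (m.+1%:R * 8 * c + 1) <= b.
  by rewrite -ler_pdivlMr// /r !ge_min lexx !orbT.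
exists r; split => // e e0 e1 z zU.
set v := fine (volm (box (0 : 'rV[R]_m.+1) e : set (borelRn R m.+1))).
have v0 : 0 <= v by exact: fine_ge0.
have [C C0 HC] := @favg_taylor R m e e0.
have step i z' h : ball x0 r z' -> `|h| <= e ->
    `|favg e B (z' + h *: delta_mx 0 i) - favg e B z'| <= c * v * `|h| + C * h ^+ 2.
  move=> z'U he.
  have sub : box z' e `<=` box x0 2.
    move=> x; rewrite !box_ball// => xz'; rewrite (_ : 2 = 1 + 1)//.
    by apply: (ball_triangle (y := z')); [apply: le_ball z'U|apply: le_ball xz'].
  have far' x y : box z' e x -> Omega y -> 1 <= sqnorm (x - y) by move=> /sub; exact: far.
  have boxD' x : box z' e x -> forall j, `|x 0 j| <= D by move=> /sub; exact: boxD.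
  have FV := first_variation_bound i e0 s01 ltr01 D_ge0 openO Ooo far' boxD' OmegaD
    mB mN N0 EB BEN minE (ltW M0) HM.
  have vE : fine (volm (box z' e : set (borelRn R m.+1))) = v by rewrite /v !volm_box.
  rewrite vE -/L in FV.
  have wz : `|w x0| / 2 <= `|w z'|.
    exact: half_le L_ge0 (ltW r0) rw (w_near r0 r1 z'U).
  have H := HC B i z' h mB he; set I := Rintegral _ _ _ in H FV.
  exact: increment_bound H (quotient_bound w0 wz (normr_ge0 I) FV).
have cv0 : 0 <= c * v by rewrite mulr_ge0.
have H := ball_oscillation r0 e0 cv0 C0 step (ballxx x0 r0) zU.
apply: le_trans H _.
apply: (@le_trans _ _ (b * v / 4)); last by rewrite ler_wpM2r// Hb.
rewrite (_ : _ * _ = (r * (m.+1%:R * 8 * c)) * v / 4); last by field.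
apply: ler_wpM2r => //; apply: ler_wpM2r => //; apply: le_trans rb.
by apply: ler_wpM2l; [exact: ltW|rewrite lerDl].
Qed.

Lemma critical_point_balance : mboundary E x0 ->
  fine (frac_pot s (~` B `&` Omega) x0) = fine (frac_pot s (B `&` Omega) x0).
Proof.
move=> bx0; apply/eqP; rewrite -subr_eq0 -normr_eq0 eq_le normr_ge0 andbT leNgt.
apply/negP => /oscillation[r [r0 r1 osc]].
pose U : set 'rV[R]_m.+1 := ball x0 r.
have oU : open U by exact: ball_open.
have mU : measurable (U : set (borelRn R m.+1)) by exact: open_measurable_rV.
have Uk : U `<=` @cube R m.+1 (Num.truncn D).+1.
  move=> x xU j; have /boxD/(_ j) : box x0 2 x.
    by rewrite box_ball//; apply: le_ball xU; apply: le_trans r1 _; rewrite ler1n.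
  have := truncnS_gt D => h1 h2; rewrite /= in_itv/= -ltr_norml.
  exact: le_lt_trans h1.
have [bB bnB] : volm (B `&` U : set (borelRn R m.+1)) != 0%E /\
    volm (~` B `&` U : set (borelRn R m.+1)) != 0%E.
  have [] := bx0 U (nbhsx_ballx _ _ r0).
  rewrite (@lebesgue_ae _ _ _ (B `&` U) N)//; last 3 first.
  - exact: measurableI.
  - by move=> y [[By Uy] nE]; apply: BEN; split => // Ey; apply: nE.
  - by move=> y [[Ey Uy] nB]; exfalso; apply: nB; split => //; exact: EB.
  rewrite (@lebesgue_ae _ _ _ (~` B `&` U) N)//; last 3 first.
  - exact: measurableI.
  - by move=> y [[nBy Uy] nE]; exfalso; apply: nE; split => // /EB.
  - move=> y [[nEy Uy] nB]; apply: BEN; split => //; apply: contrapT => By; exact: nB.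
  by move=> h1 h2; rewrite !gt_eqF.
have q34 : 0 <= (3 / 4 : R) < 1 by apply/andP; split; lra.
(* If averages of at most 1/2 at [x0] occur at arbitrarily small scales, [B] has density at most 1/2
   + 1/4 on the ball at those scales. Otherwise the complement does at all small scales. Either one
   is then null near [x0]. *)
have [H|] := pselect (forall eps : R, 0 < eps -> exists e, [/\ 0 < e, e <= Num.min eps 1 &
    favg e B x0 <= favg e setT (0 : 'rV[R]_m.+1) / 2]).
  move/eqP: bB; apply; apply: (density_null mB q34 _ oU Uk) => eps eps0.
  have [e [e0]] := H _ eps0; rewrite le_min => /andP[ee e1] He.
  by exists e; split => // z zU; exact: average_le (osc _ e0 e1 z zU) He.
move=> /existsNP[eps /not_implyP[eps0 /forallNP Hn]].
move/eqP: bnB; apply; apply: (density_null mnB q34 _ oU Uk) => eps' eps'0.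
pose e := Num.min (Num.min eps 1) eps'.
have e0 : 0 < e by rewrite !lt_min eps0 ltr01.
have e1 : e <= 1 by rewrite !ge_min lexx orbT.
have ee : e <= Num.min eps 1 by rewrite ge_min lexx.
exists e; split => //; first by rewrite ge_min lexx orbT.
move=> z zU; apply: (@average_le _ _ (favg e (~` B) x0)).
  have Ez := favgC e0 z mB; have Ex := favgC e0 x0 mB.
  rewrite favg_translate in Ez; rewrite favg_translate in Ex.
  exact: complement_dist Ez Ex (osc _ e0 e1 z zU).
have Hx0 : favg e setT (0 : 'rV[R]_m.+1) / 2 <= favg e B x0.
  by rewrite leNgt; apply/negP => h; apply: (Hn e); split => //; exact: ltW.
have Ex := favgC e0 x0 mB; rewrite favg_translate in Ex.
exact: complement_half Ex Hx0.
Qed.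

End critical_points.


(** * Asymptotics of the potentials at infinity *)

Section far_points.
Context {R : realType} {m : nat}.
Variables (s D0 : R).
Hypotheses (s0 : 0 < s) (D00 : 0 <= D0).
Local Notation a := (@frac_exp R m.+1 s).

Let a_ge0 : 0 <= a. Proof. exact: frac_exp_ge0. Qed.

(** With |y| <= D0 <= |x|/2 the squared distance is at least |x|^2/4, in the sup norm and so in the
    Euclidean one; the error is smaller than the main term by a factor of order 1/|x|. *)
Lemma frac_pot_far (C : set (borelRn R m.+1)) (x : 'rV[R]_m.+1) :
  measurable C -> (volm C < +oo)%E ->
  (forall y : 'rV[R]_m.+1, C y -> forall j, `|y 0 j| <= D0) -> 0 < `|x| -> 2 * D0 <= `|x| ->
  `|fine (frac_pot s C x) - sqnorm x `^ (- a) * fine (volm C)| <=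
    a * (`|x| ^+ 2 / 4) `^ (- a) / (`|x| ^+ 2 / 4) * (m.+1%:R * (4 * `|x|) * D0) * fine (volm C).
Proof.
move=> mC Coo CD x0 xD; have [j0 xj0] := norm_coord_ex x0.
have d0 : 0 < `|x| ^+ 2 / 4 by rewrite divr_gt0// exprn_gt0.
have dE : `|x| ^+ 2 / 4 = (`|x| / 2) ^+ 2 by rewrite expr_div_n; congr (_ / _); ring.
have x20 : 0 <= `|x| / 2 by rewrite divr_ge0.
have xx : `|x| / 2 <= `|x| by rewrite ler_pdivrMr// ler_peMr// ler1n.
rewrite -Rintegral_cst//; apply: (frac_pot_approx s0 mC Coo d0) => //.
- move=> y Cy; rewrite dE; apply: (sqnorm_ge (j := j0)) => //.
  rewrite !mxE; apply: le_trans (lerB_dist _ _); rewrite -xj0.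
  by have := CD y Cy j0; lra.
- by rewrite !mulr_ge0.
- by move=> y _; rewrite dE; apply: (sqnorm_ge (j := j0)) => //; rewrite -xj0.
- move=> y Cy.
  have := @sqnorm_dist _ _ (y : 'rV[R]_m.+1) 0 x `|x| D0 (normr_ge0 _) D00.
  have -> : sqnorm ((y : 'rV[R]_m.+1) - x) = sqnorm (x - y).
    by apply: eq_bigr => j _; rewrite !mxE -opprB sqrrN.
  have -> : sqnorm (0 - x) = sqnorm x.
    by apply: eq_bigr => j _; rewrite !mxE sub0r sqrrN.
  apply.
  + by move=> j; apply: le_trans (CD y Cy j) _; apply: le_trans xD; rewrite ler_peMl// ler1n.
  + by move=> j; rewrite mxE normr0.
  + exact: coord_le_norm.
  + by move=> j; rewrite mxE subr0; exact: CD.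
Qed.

Lemma sqnorm_le (x : 'rV[R]_m.+1) : sqnorm x <= m.+1%:R * `|x| ^+ 2.
Proof.
have -> : m.+1%:R * `|x| ^+ 2 = \sum_(j < m.+1) `|x| ^+ 2.
  by rewrite sumr_const card_ord mulr_natl.
apply: ler_sum => j _.
rewrite -[x 0 j ^+ 2]real_normK ?num_real//.
by apply: lerXn2r; rewrite ?nnegrE//; exact: coord_le_norm.
Qed.

(** Equal potentials at [x] leave only the two error terms against the difference of volumes, and
    the common power of |x| cancels. *)
Lemma volume_gap (C C' : set (borelRn R m.+1)) : measurable C -> measurable C' ->
  (volm C < +oo)%E -> (volm C' < +oo)%E ->
  (forall y : 'rV[R]_m.+1, C y -> forall j, `|y 0 j| <= D0) ->
  (forall y : 'rV[R]_m.+1, C' y -> forall j, `|y 0 j| <= D0) ->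
  exists2 K : R, 0 <= K & forall x : 'rV[R]_m.+1, 0 < `|x| -> 2 * D0 <= `|x| ->
    fine (frac_pot s C x) = fine (frac_pot s C' x) ->
    `|fine (volm C) - fine (volm C')| * `|x| <= K.
Proof.
move=> mC mC' Coo C'oo CD C'D.
pose v := fine (volm C); pose v' := fine (volm C').
have v0 : 0 <= v by exact: fine_ge0.
have v'0 : 0 <= v' by exact: fine_ge0.
(* Compares the norms: the Euclidean square is at most (m+1) |x|^2 = 4 (m+1) d with d = |x|^2/4. *)
pose q : R := (4 * m.+1%:R) `^ (- a).
have q0 : 0 < q by rewrite powR_gt0// mulr_gt0.
(* 16 is the 4 of [frac_pot_far] times the 4 in |x|^2/d. *)
exists (a * 16 * m.+1%:R * D0 * (v + v') / q) => [|x x0 xD].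
  apply: divr_ge0 (ltW q0); apply: mulr_ge0; last exact: addr_ge0.
  by apply: mulr_ge0 D00; apply: mulr_ge0 => //; exact: mulr_ge0.
move=> CC'.
have H := frac_pot_far mC Coo CD x0 xD; have H' := frac_pot_far mC' C'oo C'D x0 xD.
rewrite -/v CC' in H; rewrite -/v' in H'.
set p := fine (frac_pot s C' x) in H H'.
pose d := `|x| ^+ 2 / 4; rewrite -/d in H H'.
have d0 : 0 < d by rewrite divr_gt0// exprn_gt0.
have da0 : 0 < d `^ (- a) by exact: powR_gt0.
have sq0 : 0 < sqnorm x.
  have [j xj] := norm_coord_ex x0; apply: (@lt_le_trans _ _ (`|x| ^+ 2)); first by rewrite exprn_gt0.
  by apply: (sqnorm_ge (j := j)) => //; rewrite xj.
have lower : q * d `^ (- a) <= sqnorm x `^ (- a).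
  rewrite /q -powRM ?mulr_ge0 ?(ltW d0)//; apply: powRN_le => //.
  apply: le_trans (sqnorm_le x) _; rewrite le_eqVlt; apply/orP; left; apply/eqP.
  by rewrite /d; field.
rewrite ler_pdivlMr// -(ler_pM2r da0).
have gap : sqnorm x `^ (- a) * `|v - v'| <= a * d `^ (- a) / d * (m.+1%:R * (4 * `|x|) * D0) * (v + v').
  rewrite -[sqnorm x `^ (- a)]ger0_norm ?powR_ge0// -normrM mulrBr.
  rewrite (_ : _ - _ = (p - sqnorm x `^ (- a) * v') - (p - sqnorm x `^ (- a) * v)); last by ring.
  rewrite mulrDr [leRHS]addrC; apply: le_trans (ler_normB _ _) _.
  exact: lerD H' H.
have {}gap : q * d `^ (- a) * `|v - v'| <= a * d `^ (- a) / d * (m.+1%:R * (4 * `|x|) * D0) * (v + v').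
  by apply: le_trans gap; exact: ler_wpM2r.
rewrite -(ler_pM2r x0) in gap.
rewrite (_ : `|v - v'| * `|x| * q * d `^ (- a) = q * d `^ (- a) * `|v - v'| * `|x|); last by ring.
apply: le_trans gap _; rewrite le_eqVlt; apply/orP; left; apply/eqP.
by rewrite /d; field; rewrite gt_eqF.
Qed.

End far_points.

(** * Conclusion along an unbounded boundary *)

Lemma bounded_coords (R : realType) n (A : set 'rV[R]_n) : bounded_set A ->
  exists2 D : R, 0 <= D & forall x, A x -> forall j, `|x 0 j| <= D.
Proof.
move=> [M [_ HM]]; exists (`|M| + 1) => [|x Ax j]; first by rewrite addr_ge0.
apply: le_trans (coord_le_norm x j) _; apply: HM => //.
by apply: le_lt_trans (ler_norm M) _; rewrite ltrDl.
Qed.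

Lemma unbounded_norm (R : realType) n (A : set 'rV[R]_n) (K : R) : ~ bounded_set A ->
  exists2 x, A x & K < `|x|.
Proof.
move=> nb; apply: contrapT => /forall2NP H; apply: nb.
exists K; split; first exact: num_real.
move=> M KM x Ax; have [//|/negP] := H x; rewrite -leNgt => xK.
exact: le_trans (ltW KM).
Qed.


Theorem theorem1p8 (R : realType) (n : nat) (s : R) (Omega E : set 'rV[R]_n)
  (s01 : 0 < s < 1)
  (openO : open Omega) (bndO : bounded_set Omega) (C1O : C1_boundary Omega)
  (mE : lebesgue_measurable E)
  (minE : free_boundary_minimal s Omega E)
  (unbE : ~ bounded_set (mboundary E)) :
  lebesgue (E `&` Omega) = lebesgue (~` E `&` Omega).
Proof.
case: n Omega E openO bndO C1O mE minE unbE => [|m] Omega E openO bndO _ mE minE unbE.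
  (* In dimension 0 the only point has norm 0, so no set is unbounded. *)
  have [x _] := unbounded_norm 0 unbE.
  by rewrite (_ : x = 0) ?normr0 ?ltxx//; apply/rowP => -[].
have [D0 D00 OmegaD] := bounded_coords bndO.
have mO : measurable (Omega : set (borelRn R m.+1)) by exact: open_measurable_rV.
have Ok : Omega `<=` @cube R m.+1 (Num.truncn D0).+1.
  move=> y yO j; rewrite /= in_itv/= -ltr_norml.
  exact: le_lt_trans (OmegaD y yO j) (truncnS_gt _).
have Ooo : (volm (Omega : set (borelRn R m.+1)) < +oo)%E.
  apply: le_lt_trans (@volm_cube_fin R m.+1 (Num.truncn D0).+1).
  by apply: le_measure; rewrite ?inE//; exact: measurable_cube.
have [B [N [mB mN N0 EB BEN]]] := lebesgue_ex_borel mE.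
have mBO : measurable (B `&` Omega : set (borelRn R m.+1)) by exact: measurableI.
have mnBO : measurable (~` B `&` Omega : set (borelRn R m.+1)).
  by apply: measurableI => //; exact: measurableC.
have BOoo : (volm (B `&` Omega : set (borelRn R m.+1)) < +oo)%E.
  by apply: le_lt_trans Ooo; apply: le_measure; rewrite ?inE.
have nBOoo : (volm (~` B `&` Omega : set (borelRn R m.+1)) < +oo)%E.
  by apply: le_lt_trans Ooo; apply: le_measure; rewrite ?inE.
rewrite (@lebesgue_ae _ _ _ (B `&` Omega) N)//; last 2 first.
- by move=> y [[By Oy] nE]; apply: BEN; split => // Ey; apply: nE.
- by move=> y [[Ey Oy] nB]; exfalso; apply: nB; split => //; exact: EB.
rewrite (@lebesgue_ae _ _ _ (~` B `&` Omega) N)//; last 2 first.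
- by move=> y [[nBy Oy] nE]; exfalso; apply: nE; split => // /EB.
- by move=> y [[nEy Oy] nB]; apply: BEN; split => //; apply: contrapT => By; exact: nB.
have s0 : 0 < s by case/andP: s01.
have [K K0 gap] := volume_gap s0 D00 mnBO mBO nBOoo BOoo
  (fun y yO => OmegaD y yO.2) (fun y yO => OmegaD y yO.2).
suff /eqP : fine (volm (~` B `&` Omega : set (borelRn R m.+1)))
    - fine (volm (B `&` Omega : set (borelRn R m.+1))) = 0.
  rewrite subr_eq0 => /eqP vE.
  by rewrite -[LHS]fineK ?ge0_fin_numE// -[RHS]fineK ?ge0_fin_numE// vE.
apply/eqP; rewrite -normr_eq0 eq_le normr_ge0 andbT leNgt; apply/negP => v0.
set v := `|_ - _| in v0 gap.
(* Far enough for the balance at [x] and for the asymptotics, and beyond K/v, which contradicts v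
   |x| <= K. *)
have [x bx Kx] := unbounded_norm (K / v + 2 * D0 + 3) unbE.
have Kv0 : 0 <= K / v by rewrite divr_ge0// ltW.
have x0 : 0 < `|x| by apply: lt_trans Kx; rewrite ltr_wpDl// addr_ge0// mulr_ge0.
have [j xj] := norm_coord_ex x0.
have xfar : D0 + 3 <= `|x 0 j|.
  by rewrite -xj; apply: le_trans (ltW Kx); lra.
have xD : 2 * D0 <= `|x| by apply: le_trans (ltW Kx); lra.
have := gap x x0 xD (critical_point_balance s01 D00 openO Ooo OmegaD mB mN N0 EB BEN minE xfar bx).
rewrite leNgt mulrC -ltr_pdivrMr//; move/negP; apply; apply: lt_trans Kx.
by rewrite -addrA ltrDl; lra.
Qed.
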